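(* Let $G$ be a finite group of permutations of $[k]$ such that every element of the commutator subgroup $[G,G]$ (i.e. every product of commutators $g^{-1}h^{-1}gh$) can be written as a single commutator. Then Maximum Section of $G$-Covering Spaces on graphs reduces (by a polynomial-time gap-preserving reduction) to Maximum Section of $G$-Covering Spaces on cell decompositions of closed 2-manifolds. In particular, Maximum Section of $S_k$-Covering Spaces on cell decompositions of closed 2-manifolds is Unique Games-complete.
   Context: A $G$-covering space of a graph $X$ is specified by an element $g_{ij}\in G$ for each directed edge $(i,j)$ (with $g_{ji}=g_{ij}^{-1}$); it is the graph on $V(X)\times[k]$ with an edge between $(i,a)$ and $(j,g_{ij}(a))$ for each edge $(i,j)$ and $a\in[k]$. A cell decomposition of a closed 2-manifold is a combinatorial 2-dimensional CW complex (vertices, edges, and 2-cells whose boundaries are glued along closed walks in the 1-skeleton) homeomorphic to a closed surface; a $G$-covering space of it is given by such labels $g_{ij}$ on the edges of its 1-skeleton such that for every 2-cell the product of the labels along its boundary walk (using $g_{ij}^{-1}$ when an edge is traversed backwards) is the identity. Maximum Section of a $G$-Covering Space: given such data, find $x\colon V\to[k]$ maximizing the fraction of edges $(i,j)$ with $g_{ij}(x_i)=x_j$ (equivalently, the edges over which a partial continuous section of the covering projection exists). For $G=S_k$ on graphs this is exactly Unique Games with label set $[k]$. A problem is Unique Games-complete if there are gap-preserving reductions in both directions with Unique Games such that the statement ''for all $\varepsilon,\delta>0$ there is $k$ with $\mathrm{Gap}_{1-\varepsilon,\delta}$ NP-hard'' for the problem holds iff the Unique Games Conjecture (the same statement for Unique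 Games) holds; here $\mathrm{Gap}_{c,s}$ means distinguishing optimum $\ge c$ from optimum $\le s$. *)

(* Defs.v *)
From HB Require Import structures.
From mathcomp Require Import all_boot all_order all_algebra all_fingroup all_solvable.
From mathcomp Require Import all_classical all_reals all_analysis.

Set Implicit Arguments.
Unset Strict Implicit.
Unset Printing Implicit Defensive.

Import Order.TTheory GRing.Theory Num.Theory.
Import numFieldNormedType.Exports.

Local Open Scope classical_set_scope.
Local Open Scope ring_scope.

(* Deterministic multitape Turing machines over the alphabet {0, 1, blank};
   [None] is the blank symbol.  A tape is unbounded in both directions and is
   stored as (cells left of the head, nearest first; scanned cell; cells right
   of the head); all the cells that are not listed are blank. *)
Definition symbol : Type := option bool.
Definition tape : Type := (seq symbol * symbol * seq symbol)%type.

Variant move := MoveL | Stay | MoveR.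

Definition tape_read (t : tape) : symbol := t.1.2.

Definition tape_write (t : tape) (a : symbol) : tape := (t.1.1, a, t.2).

Definition tape_move (t : tape) (m : move) : tape :=
  let: (l, a, r) := t in
  match m with
  | MoveL => (behead l, head None l, a :: r)
  | Stay => t
  | MoveR => (a :: l, head None r, behead r)
  end.

Definition tape_of_bits (x : seq bool) : tape :=
  ([::], head None (map Some x), behead (map Some x)).

(* The word that starts at the head and extends to the first blank. *)
Definition tape_output (t : tape) : seq bool :=
  let s := t.1.2 :: t.2 in
  pmap id (take (index None s) s).

(* Tape [ord0] is both the input and the output tape.  [None] as the value of
   the transition function means that the machine halts. *)
Record machine := Machine {
  extra_tapes : nat;
  state : finType;
  start : state;
  delta : state -> ('I_extra_tapes.+1 -> symbol) ->
          option (state * ('I_extra_tapes.+1 -> symbol * move))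
}.

Definition config (T : machine) : Type :=
  (state T * ('I_(extra_tapes T).+1 -> tape))%type.

Definition init (T : machine) (x : seq bool) : config T :=
  (start T, fun i => tape_of_bits (if i == ord0 then x else [::])).

Definition next (T : machine) (c : config T) : option (config T) :=
  if delta c.1 (fun i => tape_read (c.2 i)) is Some (q, act) then
    Some (q, fun i => tape_move (tape_write (c.2 i) (act i).1) (act i).2)
  else None.

(* [run n c] is the halting configuration reached from [c] if it is reached
   within [n] steps, and [None] otherwise. *)
Fixpoint run (T : machine) (n : nat) (c : config T) : option (config T) :=
  if next c is Some c' then (if n is n'.+1 then run n' c' else None)
  else Some c.

(* Every polynomial is bounded by some [n ^ d + d]. *)
Definition polytime (f : seq bool -> seq bool) : Prop :=
  exists (T : machine) (d : nat), forall x : seq bool,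
    exists2 c : config T,
      run (size x ^ d + d)%N (init T x) = Some c & tape_output (c.2 ord0) = f x.

Definition language : Type := seq bool -> Prop.

Definition pair_code (x w : seq bool) : seq bool :=
  flatten [seq [:: true; b] | b <- x] ++ false :: w.

Definition in_NP (L : language) : Prop :=
  exists (V : seq bool -> seq bool) (d : nat), polytime V /\
    forall x, L x <->
      exists2 w : seq bool,
        (size w <= size x ^ d + d)%N & V (pair_code x w) = [:: true].

Record promise_problem := PromiseProblem {
  yes_instance : language;
  no_instance : language
}.

Definition promise_of_language (L : language) : promise_problem :=
  PromiseProblem L (fun x => ~ L x).

Definition poly_reducible (P Q : promise_problem) : Prop :=
  exists f : seq bool -> seq bool,
    [/\ polytime f,
        (forall x, yes_instance P x -> yes_instance Q (f x)) &
        (forall x, no_instance P x -> no_instance Q (f x))].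

Definition NP_hard (P : promise_problem) : Prop :=
  forall L : language, in_NP L -> poly_reducible (promise_of_language L) P.

Record max_problem (R : realType) := MaxProblem {
  instance : Type;
  valid : instance -> Prop;
  code : instance -> seq bool;
  optimum : instance -> R
}.

Definition gap (R : realType) (P : max_problem R) (c s : R) : promise_problem :=
  PromiseProblem
    (fun z => exists I : instance P, [/\ valid I, code I = z & c <= optimum I])
    (fun z => exists I : instance P, [/\ valid I, code I = z & optimum I <= s]).

(* Gaps are preserved up to an arbitrarily small loss at both thresholds. *)
Definition gap_reducible (R : realType) (P Q : max_problem R) : Prop :=
  forall s s' c' c : R, 0 <= s -> s < s' -> s' < c' -> c' < c -> c <= 1 ->
    poly_reducible (gap P c s) (gap Q c' s').

(* A finite graph viewed as a 1-dimensional CW complex: parallel edges and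
   loops are allowed.  The orientation of an edge is only a reference
   orientation, used to attach a permutation to it. *)
Record graph := Graph {
  nv : nat;
  ne : nat;
  src : 'I_ne -> 'I_nv;
  tgt : 'I_ne -> 'I_nv
}.

(* [g e] is g_ij, where i = src e and j = tgt e; the label of e traversed
   backwards is the inverse of [g e]. *)
Definition labelling (k : nat) (X : graph) : Type := 'I_(ne X) -> 'S_k.

Definition labelled_by (k : nat) (G : {group 'S_k}) (X : graph)
    (g : labelling k X) : Prop :=
  forall e, g e \in G.

Definition section_edges (k : nat) (X : graph) (g : labelling k X)
    (x : {ffun 'I_(nv X) -> 'I_k}) : {set 'I_(ne X)} :=
  [set e | g e (x (src e)) == x (tgt e)]%SET.

Definition max_section (R : realType) (k : nat) (X : graph)
    (g : labelling k X) : R :=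
  (\max_(x : {ffun 'I_(nv X) -> 'I_k}) #|section_edges g x|)%N%:R / (ne X)%:R.

(* An edge with a direction of traversal; [true] is src-to-tgt. *)
Definition dart (X : graph) : Type := ('I_(ne X) * bool)%type.

Definition dart_src (X : graph) (d : dart X) : 'I_(nv X) :=
  if d.2 then src d.1 else tgt d.1.

Definition dart_tgt (X : graph) (d : dart X) : 'I_(nv X) :=
  if d.2 then tgt d.1 else src d.1.

Definition closed_walk (X : graph) (w : seq (dart X)) : bool :=
  (w != [::]) && path.cycle (fun d d' => dart_tgt d == dart_src d') w.

Record complex2 := Complex2 {
  skeleton : graph;
  nf : nat;
  boundary : 'I_nf -> seq (dart skeleton);
  boundary_closed : forall f, closed_walk (boundary f)
}.

(* In 'S_k the product [s * t] is [s] followed by [t], so this is the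
   permutation obtained by following the walk. *)
Definition holonomy (k : nat) (X : graph) (g : labelling k X)
    (w : seq (dart X)) : 'S_k :=
  (\prod_(d <- w) (if d.2 then g d.1 else (g d.1)^-1))%g.

Definition flat (k : nat) (K : complex2) (g : labelling k (skeleton K)) : Prop :=
  forall f : 'I_(nf K), holonomy g (boundary f) = 1%g.

Definition closed_disc (R : realType) : set (R * R) :=
  [set z | z.1 ^+ 2 + z.2 ^+ 2 <= 1].

Definition open_disc (R : realType) : set (R * R) :=
  [set z | z.1 ^+ 2 + z.2 ^+ 2 < 1].

Definition circle_point (R : realType) (t : R) : R * R :=
  (cos (2 * pi * t), sin (2 * pi * t)).

Section CellDecomposition.
Variables (R : realType) (K : complex2) (M : topologicalType).
Variable vmap : 'I_(nv (skeleton K)) -> M.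
Variable emap : 'I_(ne (skeleton K)) -> R -> M.
Variable fmap : 'I_(nf K) -> R * R -> M.

Definition dart_map (d : dart (skeleton K)) (t : R) : M :=
  emap d.1 (if d.2 then t else 1 - t).

Definition cell_point : Type :=
  ('I_(nv (skeleton K)) + 'I_(ne (skeleton K)) * R + 'I_(nf K) * (R * R))%type.

Definition open_cells : set cell_point := [set p |
  match p with
  | inl (inl _) => True
  | inl (inr (_, t)) => 0 < t < 1
  | inr (_, z) => open_disc z
  end].

Definition cell_map (p : cell_point) : M :=
  match p with
  | inl (inl v) => vmap v
  | inl (inr (e, t)) => emap e t
  | inr (f, z) => fmap f z
  end.

(* The three families are characteristic maps of a CW structure on M with
   combinatorics K: M is the disjoint union of the open cells, and the
   attaching map of the face f runs through the darts of its boundary walk,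
   the i-th one along the i-th of n equal arcs of the circle.  (For finitely
   many cells in a Hausdorff space the remaining axioms of CW complexes are
   automatic.) *)
Definition characteristic_maps : Prop :=
  [/\ (forall e, [/\ {within `[0, 1], continuous (emap e)},
                     emap e 0 = vmap (src e) & emap e 1 = vmap (tgt e)]),
      (forall f, {within @closed_disc R, continuous (fmap f)}),
      (forall f d0 (i : nat) (t : R),
         (i < size (boundary f))%N -> 0 <= t <= 1 ->
         fmap f (circle_point ((i%:R + t) / (size (boundary f))%:R))
           = dart_map (nth d0 (boundary f) i) t) &
      set_bij open_cells [set: M] cell_map].

End CellDecomposition.

Definition locally_planar (R : realType) (M : topologicalType) : Prop :=
  forall p : M, exists (U : set M) (h : M -> R * R),
    [/\ open U /\ U p, {within U, continuous h}, set_inj U h &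
        forall O : set M, open O -> O `<=` U -> open (h @` O)].

Definition closed_surface (R : realType) (M : topologicalType) : Prop :=
  [/\ hausdorff_space M, compact [set: M], connected [set: M] &
      locally_planar R M].

Definition surface_decomposition (R : realType) (K : complex2) : Prop :=
  exists M : topologicalType, closed_surface R M /\
    exists vmap emap fmap, @characteristic_maps R K M vmap emap fmap.

(* Numbers are written in unary, which affects sizes only polynomially. *)
Definition code_nat (n : nat) : seq bool := nseq n true ++ [:: false].

Definition code_perm (k : nat) (s : 'S_k) : seq bool :=
  flatten [seq code_nat (s a) | a <- enum 'I_k].

Definition code_labelled (k : nat) (X : graph) (g : labelling k X) : seq bool :=
  code_nat (nv X) ++ code_nat (ne X) ++
  flatten [seq code_nat (src e) ++ code_nat (tgt e) ++ code_perm (g e)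
          | e <- enum 'I_(ne X)].

Definition code_walk (X : graph) (w : seq (dart X)) : seq bool :=
  code_nat (size w) ++ flatten [seq rcons (code_nat d.1) d.2 | d : dart X <- w].

Definition code_complex (k : nat) (K : complex2)
    (g : labelling k (skeleton K)) : seq bool :=
  code_labelled g ++ code_nat (nf K) ++
  flatten [seq code_walk (boundary f) | f <- enum 'I_(nf K)].

(* Instances have at least one edge, so that fractions of edges make sense. *)
Definition MaxSectionGraph (R : realType) (k : nat) (G : {group 'S_k}) :
    max_problem R :=
  {| instance := {X : graph & labelling k X};
     valid := fun I => (0 < ne (projT1 I))%N /\ labelled_by G (projT2 I);
     code := fun I => code_labelled (projT2 I);
     optimum := fun I => max_section R (projT2 I) |}.

Definition MaxSectionSurface (R : realType) (k : nat) (G : {group 'S_k}) :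
    max_problem R :=
  {| instance := {K : complex2 & labelling k (skeleton K)};
     valid := fun I =>
       [/\ (0 < ne (skeleton (projT1 I)))%N,
           surface_decomposition R (projT1 I),
           labelled_by G (projT2 I) & flat (projT2 I)];
     code := fun I => code_complex (projT2 I);
     optimum := fun I => max_section R (projT2 I) |}.

Definition UniqueGames (R : realType) (k : nat) : max_problem R :=
  MaxSectionGraph R [group of [set: 'S_k]].

Definition gap_conjecture (R : realType) (P : nat -> max_problem R) : Prop :=
  forall eps del : R, 0 < eps -> 0 < del ->
    exists2 k : nat, (0 < k)%N & NP_hard (gap (P k) (1 - eps) del).

Definition UniqueGamesConjecture (R : realType) : Prop :=
  gap_conjecture (UniqueGames R).

Definition unique_games_complete (R : realType) (P : nat -> max_problem R) :
    Prop :=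
  [/\ (forall k, (0 < k)%N -> gap_reducible (UniqueGames R k) (P k)),
      (forall k, (0 < k)%N -> gap_reducible (P k) (UniqueGames R k)) &
      (gap_conjecture P <-> UniqueGamesConjecture R)].

(* Main.v *)
(** Replace every edge of a graph with [n] vertices by [2H] parallel copies, keeping
    its label, and join a new vertex, the hub, to every old vertex by a star edge
    labelled [1]. Attach a single polygon along the following closed walk: from the
    hub go to each vertex [v] in turn along its star edge, then for each pair [e, e']
    of parallel copies at [v] go out along [e] and back along [e'], and return to the
    hub. Each edge occurs once in each direction, and consecutive labels cancel, so
    every labelling of the graph becomes flat, for any group [G]. The corners of the
    polygon at each vertex form a single cycle, which makes the quotient of the disc
    a closed surface: the caps cut from the disc at the boundary points that are
    identified are laid side by side as sectors of a disc, and compactness turns this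
    injective continuous map into a chart. With [H = C n] the star edges are a
    fraction of at most [1 / (2 C)] of all edges, so the value of the instance changes
    by at most that much. Conversely, a labelled complex reduces to its 1-skeleton.

    Both reductions are values of terms of a small language of nested loops over
    words; every term is computed by a multitape machine in polynomial time. *)
Require Import Defs.
From HB Require Import structures.
From mathcomp Require Import all_boot all_order all_algebra all_fingroup all_solvable.
From mathcomp Require Import all_classical all_reals all_analysis.
From mathcomp Require Import ring lra zify.

Set Implicit Arguments.
Unset Strict Implicit.
Unset Printing Implicit Defensive.

Import Order.TTheory GRing.Theory Num.Theory.
Import numFieldNormedType.Exports.

(** * Multitape machines computing terms *)

Section Cells.
Local Open Scope ring_scope.

(** Hardness is defined through actual machines, so each reduction must come with a running time.
    The loops of the term language range only over lengths of words that already exist, so every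
    term runs in polynomial time by induction on its structure. Only one composition of machines is
    then needed: an arbitrary machine followed by a term. The obstacle to gluing a single polygon
    lies at the vertices. If the walk went out along an edge and straight back along it, the corner
    at the far end would close up on itself, and the far vertex would be a pinch point where several
    discs meet. Going back along a parallel copy turns this corner into a link between two
    neighbouring copies, and these links chain all corners of the vertex into one cycle. The second
    passage of each copy takes place in the block at its other end. The hub makes a single closed
    walk possible even if the graph is disconnected or has isolated vertices. Its star edges are
    additional constraints; the many parallel copies serve to make them negligible. *)

Definition cell (t : tape) (i : int) : symbol :=
  match i with
  | Posz 0 => t.1.2
  | Posz n.+1 => nth None t.2 n
  | Negz n => nth None t.1.1 n
  end.

Definition word (x : seq bool) (i : int) : symbol :=
  if i is Posz n then nth None (map Some x) n else None.

Lemma cell_read t : tape_read t = cell t 0.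
Proof. by []. Qed.

Lemma cell_write t a i : cell (tape_write t a) i = if i == 0 then a else cell t i.
Proof. by case: i => [[|n]|n]. Qed.

Lemma cell_moveR t i : cell (tape_move t MoveR) i = cell t (i + 1).
Proof.
case: t => [[l a] r]; case: i => [n|[|n]] //=.
  by rewrite addn1; case: n => [|n] /=; [case: r | rewrite nth_behead].
by rewrite subn1.
Qed.

Lemma cell_moveL t i : cell (tape_move t MoveL) i = cell t (i - 1).
Proof.
case: t => [[l a] r]; case: i => [[|[|n]]|n] //=.
by rewrite addn0 nth_behead.
Qed.

Lemma word_in x (i : int) : 0 <= i < (size x)%:Z -> word x i = Some (nth false x `|i|%N).
Proof. by case: i => [n|n] //= h; rewrite (nth_map false) //; move: h; lia. Qed.

Lemma word_out x (i : int) : ~~ (0 <= i < (size x)%:Z) -> word x i = None.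
Proof. by case: i => [n|n] //= h; rewrite nth_default // size_map; move: h; lia. Qed.

Lemma word_None x (i : int) : (word x i == None) = ~~ (0 <= i < (size x)%:Z).
Proof.
by case h: (0 <= i < _); [rewrite (word_in h) | rewrite word_out ?h].
Qed.

(* The head of [t] stands at position [w.2] of the word [w.1]. *)
Definition holds (t : tape) (w : seq bool * int) : Prop :=
  forall i, cell t i = word w.1 (i + w.2).

Lemma holds_read t w : holds t w -> tape_read t = word w.1 w.2.
Proof. by move=> h; rewrite cell_read h add0r. Qed.

Definition offset (m : move) : int :=
  match m with MoveL => -1 | Stay => 0 | MoveR => 1 end.

Lemma cell_move t m i : cell (tape_move t m) i = cell t (i + offset m).
Proof. by case: m; rewrite ?cell_moveL ?cell_moveR //= addr0; case: t => [[]]. Qed.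

Lemma write_read t : tape_write t (tape_read t) = t.
Proof. by case: t => [[l a] r]. Qed.

Lemma holds_move t w m : holds t w -> holds (tape_move t m) (w.1, w.2 + offset m).
Proof. by move=> h i; rewrite cell_move h /= -addrA (addrC w.2). Qed.

Lemma holds_append t x b m : holds t (x, (size x)%:Z) ->
  holds (tape_move (tape_write t (Some b)) m) (rcons x b, (size x)%:Z + offset m).
Proof.
move=> h i; rewrite cell_move cell_write h /=.
rewrite addrA (addrAC i); set j := i + offset m.
have [-> | j0] := eqVneq j 0.
  by rewrite add0r /= map_rcons nth_rcons size_map ltnn eqxx.
have e : j + (size x)%:Z != (size x)%:Z by move: j0; lia.
case: (j + _) e => //= n e.
have {}e : n != size x by move: e; lia.
by rewrite map_rcons nth_rcons size_map; case: ltngtP e => // h1 _; rewrite nth_default ?size_map 1?ltnW.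
Qed.

Lemma holds_erase t x b m : holds t (rcons x b, (size x)%:Z) ->
  holds (tape_move (tape_write t None) m) (x, (size x)%:Z + offset m).
Proof.
move=> h i; rewrite cell_move cell_write h /=.
rewrite addrA (addrAC i); set j := i + offset m.
have [-> | j0] := eqVneq j 0.
  by rewrite add0r /= nth_default ?size_map.
have e : j + (size x)%:Z != (size x)%:Z by move: j0; lia.
case: (j + _) e => //= n e.
have {}e : n != size x by move: e; lia.
by rewrite map_rcons nth_rcons size_map; case: ltngtP e => // h1 _; rewrite nth_default ?size_map 1?ltnW.
Qed.

Lemma holds_bits x : holds (tape_of_bits x) (x, 0).
Proof.
move=> i; rewrite addr0; case: i => [[|n]|n] /=; first by case: x.
  by rewrite nth_behead.
by rewrite nth_nil.
Qed.

Lemma cellE t (n : nat) : cell t n = nth None (t.1.2 :: t.2) n.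
Proof. by case: n. Qed.

Lemma tape_output_cells t y : (forall n : nat, (n < size y)%N -> cell t n%:Z = Some (nth false y n)) ->
  cell t (size y) = None -> tape_output t = y.
Proof.
move=> h1 h2; rewrite /tape_output.
set s := t.1.2 :: t.2.
have le1 : (size y <= index None s)%N.
  rewrite leqNgt; apply/negP => lt; have := h1 _ lt.
  rewrite cellE nth_index // -index_mem (leq_trans lt) // leqNgt.
  by apply/negP => lts; have := h1 _ lts; rewrite cellE nth_default.
have -> : take (index None s) s = map Some y.
  have sz : size (take (index None s) s) = size y.
    rewrite size_take_min; apply/eqP; rewrite eqn_leq leq_min le1.
    rewrite (leq_trans le1 (index_size _ _)) andbT geq_min.
    have [le|lt] := leqP (size s) (size y); first by rewrite orbT.
    rewrite orbF leqNgt andbT; apply/negP => lt2.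
    by have := @before_find _ None (pred1 None) s _ lt2; rewrite /= -cellE h2.
  apply: (@eq_from_nth _ None); rewrite ?size_map // sz => n ln.
  by rewrite (nth_map false) // -h1 // cellE nth_take // (leq_trans ln).
by apply: map_pK.
Qed.

Lemma take_tape_output t :
  take (index None (t.1.2 :: t.2)) (t.1.2 :: t.2) = map Some (tape_output t).
Proof.
rewrite /tape_output pmapS_filter map_id.
apply/esym/all_filterP/allP => -[b|] //.
by move/index_ltn; rewrite ltnn.
Qed.

Lemma size_tape_output t : size (tape_output t) = index None (t.1.2 :: t.2).
Proof.
rewrite -(size_map Some) -take_tape_output size_take_min.
exact/minn_idPl/index_size.
Qed.

Lemma cells_tape_output t (n : nat) : (n < size (tape_output t))%N ->
  cell t n = Some (nth false (tape_output t) n).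
Proof.
move=> h; rewrite -(nth_map _ None) // -take_tape_output cellE.
by rewrite nth_take // -size_tape_output.
Qed.

Lemma cell_tape_output t : cell t (size (tape_output t)) = None.
Proof.
rewrite cellE size_tape_output; set s := _ :: _.
have [/nth_index -> //|h] := boolP (None \in s).
by rewrite nth_default // leqNgt index_mem.
Qed.

End Cells.

(** * Program fragments on a fixed set of tapes *)

Section Fragments.

(** [machine] carries its number of tapes as a field; here it is a parameter, so that combined
    fragments share their tapes. *)
Record frag (T : nat) := Frag {
  fstate : finType;
  fstart : fstate;
  fdelta : fstate -> ('I_T.+1 -> symbol) -> option (fstate * ('I_T.+1 -> symbol * move))
}.

Definition machine_of T (F : frag T) : machine := Machine (fstart F) (@fdelta T F).

Definition frag_of (M : machine) : frag (extra_tapes M) := Frag (start M) (@delta M).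

Definition steps (M : machine) n (c c' : config M) : Prop :=
  iter n (obind (@Defs.next M)) (Some c) = Some c'.

Lemma steps1 M n (c1 c2 c3 : config M) :
  Defs.next c1 = Some c2 -> steps n c2 c3 -> steps n.+1 c1 c3.
Proof. by rewrite /steps iterSr /= => ->. Qed.

Lemma stepsD M n m (c1 c2 c3 : config M) :
  steps n c1 c2 -> steps m c2 c3 -> steps (n + m) c1 c3.
Proof. by rewrite /steps addnC iterD => ->. Qed.

Lemma iter_obind_None A (f : A -> option A) n : iter n (obind f) None = None.
Proof. by elim: n => //= n ->. Qed.

Lemma steps_run M n N (c c' : config M) :
  steps n c c' -> Defs.next c' = None -> (n <= N)%N -> run N c = Some c'.
Proof.
move=> h h'; elim: n N c h => [|n IH] N c.
  by rewrite /steps /= => -[->] _; case: N => [|N] /=; rewrite h'.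
rewrite /steps iterSr /=; case e: (Defs.next c) => [c1|] /=; last by rewrite iter_obind_None.
by case: N => [|N] // h1 h2 /=; rewrite e; apply: IH.
Qed.

Lemma run_steps M N (c c' : config M) : run N c = Some c' ->
  exists n, [/\ (n <= N)%N, steps n c c' & Defs.next c' = None].
Proof.
elim: N c => [|N IH] c /=; case e: (Defs.next c) => [c1|] //.
- by move=> [<-]; exists 0; split.
- by case/IH => n [? h1 h2]; exists n.+1; split => //; apply: steps1 h1.
- by move=> [<-]; exists 0; split.
Qed.

Lemma steps_lift M1 M2 (f : config M1 -> config M2) n c c' :
  (forall c1 c2, Defs.next c1 = Some c2 -> Defs.next (f c1) = Some (f c2)) ->
  steps n c c' -> steps n (f c) (f c').
Proof.
move=> h; elim: n c => [|n IH] c; first by rewrite /steps /= => -[->].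
rewrite /steps iterSr /=; case e: (Defs.next c) => [c1|] /=; last by rewrite iter_obind_None.
by move/IH; apply: steps1; apply: h.
Qed.

Variable T : nat.
Implicit Types (F : frag T) (s : 'I_T.+1 -> tape).

Definition tapes := 'I_T.+1 -> tape.
Definition fread s : 'I_T.+1 -> symbol := fun i => tape_read (s i).

Definition fhalts F N s s' : Prop := exists n q,
  [/\ (n <= N)%N, @steps (machine_of F) n (fstart F, s) (q, s') & fdelta q (fread s') = None].

Lemma fnext_None F q s : fdelta q (fread s) = None -> @Defs.next (machine_of F) (q, s) = None.
Proof. by rewrite /Defs.next /= -/(fread s) => ->. Qed.

Lemma next_fNone F q s : @Defs.next (machine_of F) (q, s) = None -> fdelta q (fread s) = None.
Proof. by rewrite /Defs.next /= -/(fread s); case: fdelta => [[]|]. Qed.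

Lemma fhalts_leq F N N' s s' : (N <= N')%N -> fhalts F N s s' -> fhalts F N' s s'.
Proof. by move=> h [n [q [h1 h2 h3]]]; exists n, q; split => //; apply: leq_trans h. Qed.

(** A change of control takes a step, and a step writes on every tape; rewriting the scanned symbols
    leaves all tapes as they are. These steps account for the [+ 1] and [+ 2] in the time bounds
    below. *)
Definition noop (r : 'I_T.+1 -> symbol) : 'I_T.+1 -> symbol * move := fun i => (r i, Stay).

Lemma noopE s : (fun i => tape_move (tape_write (s i) (noop (fread s) i).1) (noop (fread s) i).2) = s.
Proof. by apply/funext => i /=; rewrite write_read; case: (s i) => [[]]. Qed.

Definition skip : frag T := @Frag T unit tt (fun _ _ => None).

Lemma skip_halts s : fhalts skip 0 s s.
Proof. by exists 0, tt; split. Qed.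

Definition once (f : ('I_T.+1 -> symbol) -> 'I_T.+1 -> symbol * move) : frag T :=
  @Frag T bool true (fun q r => if q then Some (false, f r) else None).

Definition perform (f : ('I_T.+1 -> symbol) -> 'I_T.+1 -> symbol * move) s : tapes :=
  fun i => tape_move (tape_write (s i) (f (fread s) i).1) (f (fread s) i).2.

Lemma once_halts f s : fhalts (once f) 1 s (perform f s).
Proof. by exists 1, false; split. Qed.

(* One combinator for sequencing and looping: [F2] starts when [F1] has halted
   and [b] holds, and a halt of [F2] restarts [F1] if [back]. *)
Definition chain_delta F1 F2 (b : ('I_T.+1 -> symbol) -> bool) (back : bool)
    (q : fstate F1 + fstate F2) r :=
  match q with
  | inl q => if fdelta q r is Some (q', a) then Some (inl q', a)
             else if b r then Some (inr (fstart F2), noop r) else None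
  | inr q => if fdelta q r is Some (q', a) then Some (inr q', a)
             else if back then Some (inl (fstart F1), noop r) else None
  end.

Definition chain F1 F2 b back : frag T :=
  @Frag T (fstate F1 + fstate F2)%type (inl (fstart F1)) (@chain_delta F1 F2 b back).

Definition seqf F1 F2 := chain F1 F2 (fun _ => true) false.
Definition loopf F1 F2 b := chain F1 F2 b true.

Section Chain.
Variables (F1 F2 : frag T) (b : ('I_T.+1 -> symbol) -> bool) (back : bool).
Let F := chain F1 F2 b back.

Lemma chain_stepl n q s q' s' :
  @steps (machine_of F1) n (q, s) (q', s') -> @steps (machine_of F) n (inl q, s) (inl q', s').
Proof.
apply: (@steps_lift (machine_of F1) (machine_of F) (fun c => (inl c.1, c.2))) => -[q1 s1] [q2 s2].
by rewrite /Defs.next /=; case: fdelta => // -[q3 a] [<- <-].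
Qed.

Lemma chain_stepr n q s q' s' :
  @steps (machine_of F2) n (q, s) (q', s') -> @steps (machine_of F) n (inr q, s) (inr q', s').
Proof.
apply: (@steps_lift (machine_of F2) (machine_of F) (fun c => (inr c.1, c.2))) => -[q1 s1] [q2 s2].
by rewrite /Defs.next /=; case: fdelta => // -[q3 a] [<- <-].
Qed.

Lemma chain_stop N s s' : fhalts F1 N s s' -> ~~ b (fread s') -> fhalts F N s s'.
Proof.
move=> [n [q [h1 h2 h3]]] hb; exists n, (inl q); split => //; first exact: chain_stepl.
by rewrite /= h3 (negbTE hb).
Qed.

Lemma chain_go N1 N2 s s1 s2 : fhalts F1 N1 s s1 -> b (fread s1) ->
  fhalts F2 N2 s1 s2 -> exists n q, [/\ (n <= N1 + N2 + 1)%N,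
    @steps (machine_of F) n (inl (fstart F1), s) (inr q, s2) & fdelta q (fread s2) = None].
Proof.
move=> [n [q [h1 h2 h3]]] hb [n' [q' [h1' h2' h3']]].
exists (n + n'.+1)%N, q'; split => //; first by lia.
apply: stepsD (chain_stepl h2) _; apply: steps1 (chain_stepr h2').
by rewrite /Defs.next /= -/(fread _) h3 hb noopE.
Qed.

End Chain.

Lemma seqf_halts F1 F2 N1 N2 s s1 s2 : fhalts F1 N1 s s1 -> fhalts F2 N2 s1 s2 ->
  fhalts (seqf F1 F2) (N1 + N2 + 1) s s2.
Proof.
move=> h1 h2; have [n [q [? ? h]]] := @chain_go _ _ xpredT false _ _ _ _ _ h1 isT h2.
by exists n, (inr q); split => //=; rewrite h.
Qed.

Lemma loopf_halts F1 F2 (b : ('I_T.+1 -> symbol) -> bool) N1 N2 N3 s s1 s2 s3 : fhalts F1 N1 s s1 -> b (fread s1) ->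
  fhalts F2 N2 s1 s2 -> fhalts (loopf F1 F2 b) N3 s2 s3 ->
  fhalts (loopf F1 F2 b) (N1 + N2 + N3 + 2) s s3.
Proof.
move=> h1 hb h2 [n' [q' [h1' h2' h3']]].
have [n [q [hn hs h]]] := chain_go true h1 hb h2.
exists (n + n'.+1)%N, q'; split => //; first by lia.
apply: stepsD hs _; apply: steps1 h2'.
by rewrite /Defs.next /= -/(fread _) h noopE.
Qed.

Definition branch_delta F1 F2 (b : ('I_T.+1 -> symbol) -> bool)
    (q : option (fstate F1 + fstate F2)) r :=
  match q with
  | None => Some (Some (if b r then inl (fstart F1) else inr (fstart F2)), noop r)
  | Some (inl q) => if fdelta q r is Some (q', a) then Some (Some (inl q'), a) else None
  | Some (inr q) => if fdelta q r is Some (q', a) then Some (Some (inr q'), a) else None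
  end.

Definition branch F1 F2 b : frag T :=
  @Frag T (option (fstate F1 + fstate F2)%type) None (@branch_delta F1 F2 b).

Lemma branch_halts F1 F2 (b : ('I_T.+1 -> symbol) -> bool) N s s' :
  fhalts (if b (fread s) then F1 else F2) N s s' -> fhalts (branch F1 F2 b) (N + 1) s s'.
Proof.
case hb: (b _) => -[n [q [h1 h2 h3]]].
- exists n.+1, (Some (inl q)); split; [by lia| |by rewrite /= h3].
  have : @steps (machine_of (branch F1 F2 b)) n (Some (inl (fstart F1)), s) (Some (inl q), s').
    move: h2; apply: (@steps_lift (machine_of F1) (machine_of (branch F1 F2 b))
      (fun c => (Some (inl c.1), c.2))) => -[q1 s1] [q2 s2].
    by rewrite /Defs.next /=; case: fdelta => // -[q3 a] [<- <-].
  by apply: steps1; rewrite /Defs.next /= -/(fread _) hb noopE.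
- exists n.+1, (Some (inr q)); split; [by lia| |by rewrite /= h3].
  have : @steps (machine_of (branch F1 F2 b)) n (Some (inr (fstart F2)), s) (Some (inr q), s').
    move: h2; apply: (@steps_lift (machine_of F2) (machine_of (branch F1 F2 b))
      (fun c => (Some (inr c.1), c.2))) => -[q1 s1] [q2 s2].
    by rewrite /Defs.next /=; case: fdelta => // -[q3 a] [<- <-].
  by apply: steps1; rewrite /Defs.next /= -/(fread _) hb noopE.
Qed.

End Fragments.

(** * Running a fragment on a subset of the tapes *)

Section Embed.
Variables (T a : nat) (F : frag a) (f : 'I_a.+1 -> 'I_T.+1).
Hypothesis finj : injective f.

Definition overlay (A : Type) (u : 'I_a.+1 -> A) (v : 'I_T.+1 -> A) : 'I_T.+1 -> A :=
  fun i => if [pick j | f j == i] is Some j then u j else v i.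

Lemma overlay_in A (u : 'I_a.+1 -> A) v j : overlay u v (f j) = u j.
Proof. by rewrite /overlay; case: pickP => [i /eqP/finj->|/(_ j)/eqP]. Qed.

Lemma overlay_out A (u : 'I_a.+1 -> A) v i : (forall j, f j != i) -> overlay u v i = v i.
Proof. by move=> h; rewrite /overlay; case: pickP => // j; rewrite (negbTE (h j)). Qed.

Definition embed : frag T :=
  @Frag T (fstate F) (fstart F) (fun q r =>
    if fdelta q (r \o f) is Some (q', ac) then Some (q', overlay ac (noop r)) else None).

Lemma embed_halts N s s' : fhalts F N (s \o f) s' -> fhalts embed N s (overlay s' s).
Proof.
move=> [n [q [h1 h2 h3]]]; exists n, q; split => //=; last first.
  rewrite (_ : _ \o _ = fread s'); first by rewrite h3.
  by apply/funext => j /=; rewrite /fread overlay_in.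
have -> : (fstart F, s) = (fstart F, overlay (s \o f) s).
  by congr pair; apply/funext => i; rewrite /overlay; case: pickP => // j /eqP <-.
move: h2; apply: (@steps_lift (machine_of F) (machine_of embed)
  (fun c => (c.1, overlay c.2 s))) => -[q1 s1] [q2 s2].
rewrite /Defs.next /= (_ : _ \o _ = fread s1); last first.
  by apply/funext => j /=; rewrite /fread overlay_in.
rewrite -/(fread s1); case: fdelta => // -[q3 ac] [<- <-]; congr (Some (_, _)).
apply/funext => i; rewrite /overlay /noop; case e: [pick j | f j == i] => [j|] //=.
by rewrite write_read; case: (s i) => [[]].
Qed.

End Embed.

(** * Hoare triples for total correctness, with time bounds *)

Section Triples.
Variable T : nat.
Local Open Scope ring_scope.
Implicit Types (F : frag T) (s : tapes T).

(** Indexed by all of [nat], although [realizes] constrains only the first [T.+1] entries: tape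
    numbers then need no ordinals. *)
Definition store := nat -> seq bool * int.
Implicit Types (u v : store) (A : pred nat).
Local Arguments tape_move : simpl never.
Local Arguments tape_write : simpl never.

Definition realizes s u := forall i : 'I_T.+1, holds (s i) (u i).

Definition triple F N u u' := forall s, realizes s u -> exists2 s', fhalts F N s s' & realizes s' u'.

Arguments triple F N%_nat_scope u u'.

Lemma triple_leq F N N' u u' : (N <= N')%N -> triple F N u u' -> triple F N' u u'.
Proof. by move=> h t s /t [s' h1 h2]; exists s' => //; apply: fhalts_leq h1. Qed.

Lemma triple_skip u : triple (skip T) 0 u u.
Proof. by move=> s h; exists s => //; apply: skip_halts. Qed.

Lemma triple_seqf F1 F2 N1 N2 u1 u2 u3 :
  triple F1 N1 u1 u2 -> triple F2 N2 u2 u3 -> triple (seqf F1 F2) (N1 + N2 + 1) u1 u3.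
Proof.
move=> h1 h2 s /h1 [s' k1 /h2 [s2 k2 k3]]; exists s2 => //; exact: seqf_halts k1 k2.
Qed.

Definition reads u : nat -> symbol := fun j => word (u j).1 (u j).2.

Lemma rel_read s u j : realizes s u -> (j <= T)%N -> fread s (inord j) = reads u j.
Proof. by move=> h jT; rewrite /fread (holds_read (h _)) inordK. Qed.

Definition nonblank (j : nat) (r : 'I_T.+1 -> symbol) := r (inord j) != None.
Definition scans (j : nat) (a : symbol) (r : 'I_T.+1 -> symbol) := r (inord j) == a.

Lemma triple_branch F1 F2 j a N u u' : (j <= T)%N ->
  triple (if reads u j == a then F1 else F2) N u u' ->
  triple (branch F1 F2 (scans j a)) (N + 1) u u'.
Proof.
move=> jT h s hs; have [s' k1 k2] := h s hs; exists s' => //.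
by apply: branch_halts; rewrite /scans (rel_read hs jT).
Qed.

Lemma triple_loop_stop F1 F2 j N u u' : (j <= T)%N -> triple F1 N u u' ->
  reads u' j = None -> triple (loopf F1 F2 (nonblank j)) N u u'.
Proof.
move=> jT h r s /h [s' k1 k2]; exists s' => //.
by apply: chain_stop k1 _; rewrite /nonblank (rel_read k2 jT) r.
Qed.

Lemma triple_loop F1 F2 j N1 N2 N3 u1 u2 u3 u4 : (j <= T)%N -> triple F1 N1 u1 u2 ->
  reads u2 j != None -> triple F2 N2 u2 u3 ->
  triple (loopf F1 F2 (nonblank j)) N3 u3 u4 ->
  triple (loopf F1 F2 (nonblank j)) (N1 + N2 + N3 + 2) u1 u4.
Proof.
move=> jT h1 r h2 h3 s /h1 [s2 k1 r2]; have [s3 k2 /h3[s4 k3 k4]] := h2 _ r2.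
exists s4 => //; apply: loopf_halts k1 _ k2 k3.
by rewrite /nonblank (rel_read r2 jT).
Qed.

Definition displace (A : pred nat) (d : int) u : store :=
  fun i => if A i then ((u i).1, (u i).2 + d) else u i.

Lemma displaceD A d e u : displace A d (displace A e u) = displace A (e + d) u.
Proof. by apply/funext => i; rewrite /displace; case: (A i); rewrite ?addrA. Qed.

Lemma displace0 A u : displace A 0 u = u.
Proof. by apply/funext => i; rewrite /displace addr0; case: (A i); case: (u i). Qed.

Lemma displace_in A d u j : A j -> displace A d u j = ((u j).1, (u j).2 + d).
Proof. by rewrite /displace => ->. Qed.

Definition upd u (j : nat) w : store := fun i => if i == j then w else u i.

Lemma upd_same u j w : upd u j w j = w.
Proof. by rewrite /upd eqxx. Qed.

Lemma upd_other u j w i : i != j -> upd u j w i = u i.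
Proof. by rewrite /upd => /negbTE ->. Qed.

Lemma upd_id u j w : u j = w -> upd u j w = u.
Proof. by move=> <-; apply/funext => i; rewrite /upd; case: eqP => // ->. Qed.

Lemma updU u j w w' : upd (upd u j w) j w' = upd u j w'.
Proof. by apply/funext => i; rewrite /upd; case: eqP. Qed.

Lemma updC u j w j' w' : j != j' -> upd (upd u j w) j' w' = upd (upd u j' w') j w.
Proof.
by move=> h; apply/funext => i; rewrite /upd; case: (eqVneq i j) => // ->; rewrite (negbTE h).
Qed.

Lemma displace1E j d u w : u j = w -> displace (pred1 j) d u = upd u j (w.1, w.2 + d).
Proof. by move=> <-; apply/funext => i; rewrite /displace /upd /=; case: eqP => // ->. Qed.

Definition mv (A : pred nat) (m : move) : frag T :=
  once (fun r i => (r i, if A i then m else Stay)).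

Lemma triple_mv A m u : triple (mv A m) 1 u (displace A (offset m) u).
Proof.
move=> s h; eexists; first exact: once_halts.
move=> i; rewrite /perform /= /fread write_read /displace.
case: (A i); first exact: (holds_move m (h i)).
by case: (s i) (h i) => [[]].
Qed.

Definition put (j : nat) (a : symbol) (m : move) : frag T :=
  once (fun r i => if val i == j then (a, m) else (r i, Stay)).

Lemma triple_put j a m u w : (forall t, holds t (u j) -> holds (tape_move (tape_write t a) m) w) ->
  triple (put j a m) 1 u (upd u j w).
Proof.
move=> hw s h; eexists; first exact: once_halts.
move=> i; rewrite /perform /upd /=; case: eqP => [e|_] /=.
  by apply: hw; rewrite -e.
by rewrite /fread write_read; case: (s i) (h i) => [[]].
Qed.

Definition emit j b := put j (Some b) MoveR.

Lemma triple_emit j b u x : u j = (x, (size x)%:Z) ->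
  triple (emit j b) 1 u (upd u j (rcons x b, (size (rcons x b))%:Z)).
Proof.
move=> e; apply: triple_put => t; rewrite e => h.
by have := holds_append b MoveR h; rewrite /= size_rcons -[(_).+1]addn1 PoszD.
Qed.

(** All heads in [A] move in step until tape [j] shows a blank. A round costs one move and two
    changes of control, whence the factor 3 in the bounds. *)
Definition walk m A j := loopf (skip T) (mv A m) (nonblank j).

Lemma triple_walkR A j u x (p : nat) : (j <= T)%N -> A j -> u j = (x, p%:Z) -> (p <= size x)%N ->
  triple (walk MoveR A j) (3 * (size x - p)) u (displace A (size x - p)%N u).
Proof.
move=> jT Aj; move en: (size x - p)%N => n; elim: n p u en => [|n IH] p u en e le.
  rewrite displace0 muln0; apply: triple_loop_stop => //; first exact: triple_skip.
  by rewrite /reads e word_out //=; lia.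
have -> : (3 * n.+1 = 0 + 1 + 3 * n + 2)%N by lia.
have -> : displace A n.+1 u = displace A n (displace A 1 u) by rewrite displaceD.
apply: (triple_loop jT (@triple_skip u) _ (@triple_mv A MoveR u)).
  by rewrite /reads e word_None /=; lia.
by apply: (IH p.+1); [lia | rewrite displace_in // e /= -addn1 | lia].
Qed.

Lemma triple_walkL A j u x (p : nat) : (j <= T)%N -> A j -> u j = (x, p%:Z - 1) -> (p <= size x)%N ->
  triple (walk MoveL A j) (3 * p) u (displace A (- p%:Z) u).
Proof.
move=> jT Aj; elim: p u => [|p IH] u e le.
  rewrite oppr0 displace0 muln0; apply: triple_loop_stop => //; first exact: triple_skip.
  by rewrite /reads e.
have -> : (3 * p.+1 = 0 + 1 + 3 * p + 2)%N by lia.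
have -> : displace A (- p.+1%:Z) u = displace A (- p%:Z) (displace A (-1) u).
  by rewrite displaceD; congr displace; lia.
apply: (triple_loop jT (@triple_skip u) _ (@triple_mv A MoveL u)).
  by rewrite /reads e word_None /=; lia.
by apply: IH; [rewrite displace_in // e /=; congr pair; lia | lia].
Qed.

(** The head may stand on the blank behind the word, where the walk would stop at once; hence the
    initial move to the left. *)
Definition rewind A j := seqf (mv A MoveL) (seqf (walk MoveL A j) (mv A MoveR)).

Lemma triple_rewind A j u x (p : nat) : (j <= T)%N -> A j -> u j = (x, p%:Z) -> (p <= size x)%N ->
  triple (rewind A j) (3 * p + 4) u (displace A (- p%:Z) u).
Proof.
move=> jT Aj e le; have -> : (3 * p + 4 = 1 + (3 * p + 1 + 1) + 1)%N by lia.
apply: (triple_seqf (@triple_mv _ _ _)).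
have -> : displace A (- p%:Z) u = displace A 1 (displace A (- p%:Z) (displace A (-1) u)).
  by rewrite !displaceD; congr displace; lia.
apply: (triple_seqf _ (@triple_mv A MoveR _)).
by apply: (@triple_walkL A j _ x p) => //; rewrite displace_in // e.
Qed.

(** Deletion proceeds from the right end, so that the rest is at all times a word starting at
    position 0. *)
Definition erase j :=
  seqf (walk MoveR (pred1 j) j) (seqf (mv (pred1 j) MoveL)
    (seqf (loopf (skip T) (put j None MoveL) (nonblank j)) (mv (pred1 j) MoveR))).

Lemma triple_erase j u x : (j <= T)%N -> u j = (x, 0) ->
  triple (erase j) (6 * size x + 5) u (upd u j ([::], 0)).
Proof.
move=> jT e; have -> : (6 * size x + 5 = 3 * (size x - 0) + (1 + (3 * size x + 1 + 1) + 1) + 1)%N by lia.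
have h1 := @triple_walkR (pred1 j) j u x 0 jT (eqxx _) e (leq0n _).
apply: (triple_seqf h1); rewrite (displace1E _ e) subn0 /= add0r.
apply: (triple_seqf (@triple_mv _ _ _)); rewrite (displace1E _ (upd_same _ _ _)) updU /=.
have wipe y : triple (loopf (skip T) (put j None MoveL) (nonblank j)) (3 * size y)
    (upd u j (y, (size y)%:Z - 1)) (upd u j ([::], -1)).
  elim/last_ind: y => [|y b IH].
    by apply: triple_loop_stop => //; [apply: triple_skip | rewrite /reads upd_same].
  have -> : (3 * size (rcons y b) = 0 + 1 + 3 * size y + 2)%N by rewrite size_rcons; lia.
  have e2 : (size (rcons y b))%:Z - 1 = (size y)%:Z by rewrite size_rcons; lia.
  rewrite e2; apply: triple_loop IH => //; first exact: triple_skip.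
    by rewrite /reads upd_same /= map_rcons nth_rcons size_map ltnn eqxx.
  rewrite -[X in triple _ _ _ X](updU _ _ (rcons y b, (size y)%:Z)).
  by apply: triple_put => t; rewrite upd_same => h; apply: (holds_erase MoveL h).
apply: (triple_seqf (wipe x)).
have -> : upd u j ([::], 0) = displace (pred1 j) 1 (upd u j ([::], -1)).
  by rewrite (displace1E _ (upd_same _ _ _)) updU.
exact: triple_mv.
Qed.

End Triples.

(** * Polynomial bounds *)

Section PolyBounds.

(** The base is at least 2 even for [n = 0], so constants and sums are absorbed into the exponent.
    Monotonicity of [f] is never asked for, since the bound itself is monotone. *)
Definition polybnd (f : nat -> nat) := exists d, forall n, f n <= (n + 2) ^ d.

Lemma poly_const c : polybnd (fun=> c).
Proof.
exists c => n; apply: leq_trans (ltnW (ltn_expl c (isT : 1 < 2))) _.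
by case: (c) => // k; rewrite leq_exp2r //; lia.
Qed.

Lemma poly_id : polybnd id.
Proof. by exists 1 => n; rewrite expn1; lia. Qed.

Lemma poly_mul f g : polybnd f -> polybnd g -> polybnd (fun n => f n * g n).
Proof. by move=> [d hd] [e he]; exists (d + e) => n; rewrite expnD leq_mul. Qed.

Lemma poly_add f g : polybnd f -> polybnd g -> polybnd (fun n => f n + g n).
Proof.
move=> [d hd] [e he]; exists (d + e).+1 => n.
have p k : 0 < (n + 2) ^ k by rewrite expn_gt0; lia.
apply: (@leq_trans ((n + 2) ^ (d + e) * 2)); last by rewrite expnSr leq_mul2l; lia.
rewrite muln2 -addnn; apply: leq_add.
- by apply: leq_trans (hd n) _; rewrite expnD leq_pmulr.
- by apply: leq_trans (he n) _; rewrite expnD leq_pmull.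
Qed.

Lemma poly_comp f g : polybnd f -> polybnd g -> polybnd (fun n => f (g n)).
Proof.
move=> [d hd] [e he]; exists (e.+2 * d) => n.
apply: leq_trans (hd _) _; rewrite expnM.
case: (posnP d) => [->|d0]; first by rewrite !expn0.
rewrite leq_exp2r //; apply: (@leq_trans ((n + 2) ^ e + 2)); first by rewrite leq_add2r.
have p : 0 < (n + 2) ^ e by rewrite expn_gt0; lia.
rewrite !expnS mulnA; nia.
Qed.

(** For [n >= 2] one has [n + 2 <= n ^ 2]; the additive term [3 ^ d] covers [n = 0] and [n = 1]. *)
Lemma poly_bound f : polybnd f -> exists d, forall n, f n <= n ^ d + d.
Proof.
move=> [d hd]; exists (2 * d + 3 ^ d) => n; apply: leq_trans (hd n) _.
case: n => [|[|n]].
- by apply: (@leq_trans (3 ^ d)); [case: (d) => // k; rewrite leq_exp2r | lia].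
- by rewrite add1n; lia.
- apply: leq_trans (leq_addr _ _); apply: (@leq_trans (n.+2 ^ (2 * d))).
    by rewrite expnM; case: (d) => // k; rewrite leq_exp2r // expnS expn1; nia.
  by rewrite leq_pexp2l // leq_addr.
Qed.

Lemma poly_pow d : polybnd (fun n => n ^ d + d).
Proof.
apply: poly_add (poly_const d); exists d => n.
by case: d => [|d] //; rewrite leq_exp2r //; lia.
Qed.

End PolyBounds.

(** * The term language *)

Section Terms.

(* [For i t] runs [t] for every [c < size (env_i)], with [c] pushed in unary;
   [Case i j] branches on the bit of [env_i] at position [size (env_j)]. *)
Inductive term :=
  | Empty
  | Emit of bool
  | Cat of term & term
  | Let of term & term
  | For of nat & term
  | Case of nat & nat & term & term & term.

Implicit Types (env : seq (seq bool)).

Fixpoint den (t : term) env : seq bool :=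
  match t with
  | Empty => [::]
  | Emit b => [:: b]
  | Cat t1 t2 => den t1 env ++ den t2 env
  | Let t1 t2 => den t2 (den t1 env :: env)
  | For i t => flatten [seq den t (nseq c true :: env) | c <- iota 0 (size (nth [::] env i))]
  | Case i j t1 t0 tn =>
      match nth None (map Some (nth [::] env i)) (size (nth [::] env j)) with
      | Some true => den t1 env
      | Some false => den t0 env
      | None => den tn env
      end
  end.

Fixpoint wf_term (n : nat) (t : term) : bool :=
  match t with
  | Empty | Emit _ => true
  | Cat t1 t2 => wf_term n t1 && wf_term n t2
  | Let t1 t2 => wf_term n t1 && wf_term n.+1 t2
  | For i t => (i < n) && wf_term n.+1 t
  | Case i j t1 t0 tn => [&& i < n, j < n, wf_term n t1, wf_term n t0 & wf_term n tn]
  end.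

(** The largest number of binders alive at once, that is, of scratch tapes needed from [fr] on. *)
Fixpoint depth (t : term) : nat :=
  match t with
  | Empty | Emit _ => 0
  | Cat t1 t2 => maxn (depth t1) (depth t2)
  | Let t1 t2 => (maxn (depth t1) (depth t2)).+1
  | For i t => (depth t).+1
  | Case i j t1 t0 tn => maxn (depth t1) (maxn (depth t0) (depth tn))
  end.

Definition bounded env S := forall k, size (nth [::] env k) <= S.

Lemma bounded_cons x env S S' : bounded env S -> S <= S' -> size x <= S' -> bounded (x :: env) S'.
Proof. by move=> h l1 l2 [|k] //=; apply: leq_trans l1. Qed.

(** The number of rounds of a loop is fixed by a word of the environment before the loop starts, so
    [For] multiplies the bound by [S], and [Let] substitutes one polynomial into another. *)
Lemma size_den t : exists2 g, polybnd g & forall env S, bounded env S -> size (den t env) <= g S.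
Proof.
elim: t => [|b|t1 [g1 p1 h1] t2 [g2 p2 h2]|t1 [g1 p1 h1] t2 [g2 p2 h2]|i t [g p h]
           |i j t1 [g1 p1 h1] t0 [g0 p0 h0] tn [gn pn hn]] /=.
- by exists (fun=> 0) => //; apply: poly_const.
- by exists (fun=> 1) => //; apply: poly_const.
- exists (fun S => g1 S + g2 S); first exact: poly_add.
  by move=> env S hb; rewrite size_cat leq_add ?h1 ?h2.
- exists (fun S => g2 (S + g1 S)); first exact: poly_comp (poly_add poly_id p1).
  move=> env S hb; apply: h2; apply: (bounded_cons hb (leq_addr _ _)).
  by apply: leq_trans (h1 _ _ hb) (leq_addl _ _).
- exists (fun S => S * g S); first exact: poly_mul poly_id p.
  move=> env S hb; apply: (@leq_trans (size (nth [::] env i) * g S)); last by rewrite leq_mul2r hb orbT.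
  have: size (nth [::] env i) <= S by [].
  elim: (size _) => // n IH lt; rewrite -addn1 iotaD add0n map_cat flatten_cat size_cat mulnDl mul1n.
  apply: leq_add; first by apply: IH; lia.
  by rewrite /= cats0; apply: h; apply: (bounded_cons hb); rewrite ?size_nseq // ltnW.
- exists (fun S => g1 S + (g0 S + gn S)); first exact: poly_add p1 (poly_add p0 pn).
  move=> env S hb; have := h1 _ _ hb; have := h0 _ _ hb; have := hn _ _ hb.
  by case: nth => [[]|]; lia.
Qed.

End Terms.

(** * Compilation of terms to fragments *)

Section Compile.
Variable T : nat.

Definition both i j : pred nat := [pred a | (a == i) || (a == j)].
Lemma bothl i j : both i j i. Proof. by rewrite /both /= eqxx. Qed.
Lemma bothr i j : both i j j. Proof. by rewrite /both /= eqxx orbT. Qed.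
(** The length of word [j] becomes a head position in word [i]. This one device tests the condition
    [c < size x] of a loop with unary counter [c] and fetches the bit that [Case] asks for. *)
Definition seek i j : frag T := walk T MoveR (both i j) j.
Definition tick c : frag T :=
  seqf (walk T MoveR (pred1 c) c) (seqf (emit T c true) (rewind T (pred1 c) c)).

(* Variable [i] of the environment lives on tape [nth 0 vars i], the result is
   appended to tape [o], and the tapes from [fr] on are blank. *)
Fixpoint compile (t : term) (vars : seq nat) (o fr : nat) : frag T :=
  match t with
  | Empty => skip T
  | Emit b => emit T o b
  | Cat t1 t2 => seqf (compile t1 vars o fr) (compile t2 vars o fr)
  | Let t1 t2 =>
      seqf (compile t1 vars fr fr.+1) (seqf (rewind T (pred1 fr) fr)
        (seqf (compile t2 (fr :: vars) o fr.+1) (erase T fr)))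
  | For i t =>
      let a := nth 0 vars i in
      seqf (loopf (seek a fr)
              (seqf (rewind T (both a fr) fr)
                (seqf (compile t (fr :: vars) o fr.+1) (tick fr))) (nonblank a))
        (seqf (rewind T (both a fr) fr) (erase T fr))
  | Case i j t1 t0 tn =>
      let a := nth 0 vars i in let b := nth 0 vars j in
      let back := rewind T (both a b) b in
      seqf (seek a b)
        (branch (seqf back (compile t1 vars o fr))
          (branch (seqf back (compile t0 vars o fr)) (seqf back (compile tn vars o fr))
            (scans a (Some false))) (scans a (Some true)))
  end.

Definition content (x : seq bool) : seq bool * int := (x, Posz (size x)).

Record ready (u : store) (t : term) (vars : seq nat) (o fr : nat) env out : Prop := Ready {
  ready_wf : wf_term (size vars) t;
  ready_size : size env = size vars;
  ready_vars : all (ltn^~ fr) vars;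
  ready_o : o < fr;
  ready_notin : o \notin vars;
  ready_fr : fr + depth t <= T.+1;
  ready_env : forall k, k < size vars -> u (nth 0 vars k) = (nth [::] env k, 0%R);
  ready_out : u o = content out;
  ready_free : forall j, fr <= j -> u j = ([::], 0%R)
}.

Lemma triple_tick c u x : c <= T -> u c = (x, 0%R) ->
  triple (tick c) (6 * size x + 10) u (upd u c (rcons x true, 0%R)).
Proof.
move=> cT e.
have -> : 6 * size x + 10 = 3 * (size x - 0) + (1 + (3 * (size x).+1 + 4) + 1) + 1 by lia.
have h1 := @triple_walkR T (pred1 c) c u x 0 cT (eqxx _) e (leq0n _).
apply: (triple_seqf h1); rewrite (displace1E _ e) subn0 /= add0r.
apply: (triple_seqf (triple_emit true (upd_same _ _ _))); rewrite updU.
have -> : upd u c (rcons x true, 0%R) =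
    displace (pred1 c) (- Posz (size x).+1)%R (upd u c (content (rcons x true))).
  by rewrite (displace1E _ (upd_same _ _ _)) updU /= size_rcons subrr.
by apply: (@triple_rewind T (pred1 c) c _ (rcons x true)); rewrite /= ?upd_same /content ?size_rcons.
Qed.

Lemma triple_seek i j u x y : j <= T -> u i = (x, 0%R) -> u j = (y, 0%R) ->
  triple (seek i j) (3 * size y) u (displace (both i j) (size y) u) /\
  reads (displace (both i j) (size y) u) i = nth None (map Some x) (size y).
Proof.
move=> jT ei ej; split; last by rewrite /reads displace_in ?bothl // ei /= add0n.
have := @triple_walkR T (both i j) j u y 0 jT _ ej (leq0n _).
by rewrite subn0; apply; apply: bothr.
Qed.

Lemma triple_back i j u y : j <= T -> u j = (y, 0%R) ->
  triple (rewind T (both i j) j) (3 * size y + 4) (displace (both i j) (size y) u) u.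
Proof.
move=> jT ej; rewrite -[X in triple _ _ _ X](displace0 (both i j)) -(subrr (Posz (size y))) -displaceD.
by apply: (@triple_rewind T (both i j) j _ y); rewrite ?displace_in ?bothr // ej /= add0r.
Qed.

Lemma flatten_iotaS (A : Type) (f : nat -> seq A) n :
  flatten [seq f c | c <- iota 0 n.+1] = flatten [seq f c | c <- iota 0 n] ++ f n.
Proof. by rewrite -addn1 iotaD map_cat flatten_cat /= cats0. Qed.

(** The time depends on the environment only and not on the length of [out]: the head of the result
    tape stays behind the last letter, and code only appends there. *)
Lemma compile_correct t : exists2 f, polybnd f & forall vars o fr env out u S,
  ready u t vars o fr env out -> bounded env S ->
  triple (compile t vars o fr) (f S) u (upd u o (content (out ++ den t env))).
Proof.
elim: t => [|b|t1 [f1 p1 h1] t2 [f2 p2 h2]|t1 [f1 p1 h1] t2 [f2 p2 h2]|i t [f p h]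
           |i j t1 [f1 p1 h1] t0 [f0 p0 h0] tn [fn pn hn]] /=.
- exists (fun=> 0); first exact: poly_const.
  move=> vars o fr env out u S [] *; rewrite cats0 upd_id //; exact: triple_skip.
- exists (fun=> 1); first exact: poly_const.
  move=> vars o fr env out u S [] *; rewrite cats1; exact: triple_emit.
- exists (fun S => f1 S + f2 S + 1).
    exact: poly_add (poly_add p1 p2) (poly_const 1).
  move=> vars o fr env out u S [/= /andP[c1 c2] e1 e2 e3 e4 e5 e6 e7 e8] hb.
  have k1 := h1 vars o fr env out u S (Ready c1 e1 e2 e3 e4 _ e6 e7 e8) hb.
  apply: (triple_seqf (k1 _)); first by apply: leq_trans e5; rewrite leq_add2l leq_maxl.
  rewrite -[X in triple _ _ _ X](updU _ _ (content (out ++ den t1 env))) catA.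
  apply: (h2 vars o fr env) => //; split => //; last 2 first.
  + by rewrite upd_same.
  + by move=> j hj; rewrite upd_other ?e8 //; lia.
  + by apply: leq_trans e5; rewrite leq_add2l leq_maxr.
  + move=> k hk; rewrite upd_other ?e6 //; apply: contraNneq e4 => <-; exact: mem_nth.
- have [g gp hg] := size_den t1.
  have [g2 gp2 hg2] := size_den t2.
  exists (fun S => f1 S + (3 * g S + 4 + (f2 (S + g S) + (6 * g S + 5) + 1) + 1) + 1).
    have pg c d : polybnd (fun S => c * g S + d).
      exact: poly_add (poly_mul (poly_const c) gp) (poly_const d).
    apply: poly_add (poly_const 1); apply: (poly_add p1).
    apply: poly_add (poly_const 1); apply: (poly_add (pg 3 4)).
    apply: poly_add (poly_const 1); apply: (poly_add _ (pg 6 5)).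
    exact: poly_comp p2 (poly_add poly_id gp).
  move=> vars o fr env out u S [/= /andP[c1 c2] e1 e2 e3 e4 e5 e6 e7 e8] hb.
  have frT : fr <= T by lia.
  have ofr : o != fr by lia.
  have frv k : k < size vars -> nth 0 vars k != fr.
    by move=> hk; have /allP/(_ _ (mem_nth 0 hk)) := e2; rewrite /=; lia.
  set x := den t1 env.
  have sx : size x <= g S by apply: hg.
  have k1 : triple (compile t1 vars fr fr.+1) (f1 S) u (upd u fr (content x)).
    apply: (h1 vars fr fr.+1 env [::] u S) => //; split => //.
    + by apply: sub_all e2 => a /=; lia.
    + by apply/negP => /(allP e2) /=; rewrite ltnn.
    + by rewrite addSn; apply: leq_trans e5; rewrite addnS ltnS leq_add2l leq_maxl.
    + by rewrite e8.
    + by move=> j hj; apply: e8; lia.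
  apply: (triple_seqf k1).
  have k2 : triple (rewind T (pred1 fr) fr) (3 * g S + 4) (upd u fr (content x)) (upd u fr (x, 0%R)).
    apply: (@triple_leq _ _ (3 * size x + 4)); first by lia.
    have -> : upd u fr (x, 0%R) = displace (pred1 fr) (- Posz (size x))%R (upd u fr (content x)).
      by rewrite (displace1E _ (upd_same _ _ _)) updU /= subrr.
    by apply: (@triple_rewind T (pred1 fr) fr _ x); rewrite /= ?upd_same.
  apply: (triple_seqf k2).
  set y := out ++ _.
  have k3 : triple (compile t2 (fr :: vars) o fr.+1) (f2 (S + g S)) (upd u fr (x, 0%R))
      (upd (upd u fr (x, 0%R)) o (content y)).
    apply: (h2 (fr :: vars) o fr.+1 (x :: env)) => //; last first.
      by apply: (bounded_cons hb (leq_addr _ _)); apply: leq_trans sx (leq_addl _ _).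
    split => //=.
    + by rewrite e1.
    + by rewrite leqnn; apply: sub_all e2 => a /=; lia.
    + by lia.
    + by rewrite inE negb_or ofr.
    + by rewrite addSn; apply: leq_trans e5; rewrite addnS ltnS leq_add2l leq_maxr.
    + by move=> [_|k /= hk]; rewrite ?upd_same // upd_other ?e6 // frv.
    + by rewrite upd_other.
    + by move=> j hj; rewrite upd_other ?e8 //; lia.
  apply: (triple_seqf k3).
  have -> : upd u o (content y) = upd (upd (upd u fr (x, 0%R)) o (content y)) fr ([::], 0%R).
    by rewrite updC // updU [upd u fr _]upd_id // e8.
  apply: (@triple_leq _ _ (6 * size x + 5)); first by lia.
  by apply: triple_erase => //; rewrite upd_other 1?eq_sym // upd_same.
- have [g gp hg] := size_den t.
  (* The cost of one round: [seek], return of the heads, body, [tick], and the changes of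
     control. *)
  pose B S := 3 * S + (3 * S + 4 + (f S + (6 * S + 10) + 1) + 1) + 2.
  exists (fun S => S * B S + 3 * S + (3 * S + 4 + (6 * S + 5) + 1) + 1).
    have pl c d : polybnd (fun S => c * S + d).
      exact: poly_add (poly_mul (poly_const c) poly_id) (poly_const d).
    have pc c : polybnd (fun S => c * S) by exact: (poly_mul (poly_const c) poly_id).
    apply: poly_add (poly_const 1); apply: poly_add.
      apply: (poly_add _ (pc 3)); apply: (poly_mul poly_id).
      apply: poly_add (poly_const 2); apply: (poly_add (pc 3)).
      apply: poly_add (poly_const 1); apply: (poly_add (pl 3 4)).
      apply: poly_add (poly_const 1); exact: (poly_add p (pl 6 10)).
    apply: poly_add (poly_const 1); exact: poly_add (pl 3 4) (pl 6 5).
  move=> vars o fr env out u S [/= /andP[c1 c2] e1 e2 e3 e4 e5 e6 e7 e8] hb.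
  have frT : fr <= T by lia.
  have ofr : o != fr by lia.
  have frv k : k < size vars -> nth 0 vars k != fr.
    by move=> hk; have /allP/(_ _ (mem_nth 0 hk)) := e2; rewrite /=; lia.
  have ov k : k < size vars -> nth 0 vars k != o.
    by move=> hk; apply: contraNneq e4 => <-; exact: mem_nth.
  set a := nth 0 vars i; set x := nth [::] env i.
  have aT : a <= T.
    by have /allP/(_ _ (mem_nth 0 c1)) := e2; rewrite /= -/a; lia.
  have xS : size x <= S by apply: hb.
  (* The loop invariant: at the start of round [c] the result tape holds [acc c] and the counter
     tape holds [c] ones. *)
  pose acc c := out ++ flatten [seq den t (nseq c true :: env) | c <- iota 0 c].
  pose st c := upd (upd u o (content (acc c))) fr (nseq c true, 0%R).
  have st_fr c : st c fr = (nseq c true, 0%R) by rewrite /st upd_same.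
  have st_a c : st c a = (x, 0%R) by rewrite /st !upd_other ?e6 ?ov ?frv.
  have loop r c : c + r = size x ->
      triple (loopf (seek a fr) (seqf (rewind T (both a fr) fr)
        (seqf (compile t (fr :: vars) o fr.+1) (tick fr))) (nonblank a))
      (r * B S + 3 * S) (st c) (displace (both a fr) (size x) (st (size x))).
    elim: r c => [|r IH] c ec.
      have [k1 k2] := triple_seek frT (st_a c) (st_fr c).
      rewrite size_nseq in k1 k2; rewrite -ec addn0 in k2 *.
      apply: triple_loop_stop => //.
        by apply: triple_leq k1; lia.
      by rewrite k2 nth_default // size_map -ec addn0.
    have cS : c < S by apply: leq_trans xS; lia.
    have -> : r.+1 * B S + 3 * S = 3 * S + (3 * S + 4 + (f S + (6 * S + 10) + 1) + 1) + (r * B S + 3 * S) + 2.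
      by rewrite mulSn; move: (r * B S) => z; rewrite /B; lia.
    have [k1 k2] := triple_seek frT (st_a c) (st_fr c); rewrite size_nseq in k1 k2.
    apply: (triple_loop aT (triple_leq _ k1) _ _ (IH c.+1 _)); [by lia | | | by lia].
      by rewrite k2 (nth_map false) //; lia.
    have := @triple_back a fr (st c) (nseq c true) frT (st_fr c); rewrite size_nseq => k3.
    apply: (triple_seqf (triple_leq _ k3)); first by lia.
    have k4 : triple (compile t (fr :: vars) o fr.+1) (f S) (st c)
        (upd (st c) o (content (acc c.+1))).
      rewrite /acc flatten_iotaS catA.
      apply: (h (fr :: vars) o fr.+1 (nseq c true :: env)); last first.
        by apply: (bounded_cons hb) => //; rewrite size_nseq ltnW.
      split => //=.
      + by rewrite e1.
      + by rewrite leqnn; apply: sub_all e2 => b /=; lia.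
      + by lia.
      + by rewrite inE negb_or ofr.
      + by lia.
      + by move=> [_|k /= hk]; rewrite ?st_fr // /st !upd_other ?e6 ?frv ?ov.
      + by rewrite /st upd_other // upd_same.
      + by move=> j hj; rewrite /st !upd_other ?e8 //; lia.
    apply: (triple_seqf k4).
    have -> : st c.+1 = upd (upd (st c) o (content (acc c.+1))) fr (rcons (nseq c true) true, 0%R).
      have -> : rcons (nseq c true) true = nseq c.+1 true by rewrite -cats1 (_ : [:: true] = nseq 1 true) // -nseqD addn1.
      by rewrite /st [upd (upd (upd u o _) _ _) o _]updC 1?eq_sym // !updU.
    apply: (@triple_leq _ _ (6 * size (nseq c true) + 10)); first by rewrite size_nseq; lia.
    by apply: triple_tick => //; rewrite upd_other 1?eq_sym // st_fr.
  have -> : u = st 0.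
    by rewrite /st /acc cats0 [upd u o _]upd_id // upd_id // e8.
  have k1 := loop (size x) 0 (add0n _).
  apply: (triple_seqf (triple_leq _ k1)); first by rewrite leq_add2r leq_mul2r xS orbT.
  have := @triple_back a fr (st (size x)) _ frT (st_fr _); rewrite size_nseq => k2.
  apply: (triple_seqf (triple_leq _ k2)); first by lia.
  have -> : upd (st 0) o (content (out ++ flatten [seq den t (nseq c true :: env) | c <- iota 0 (size x)])) =
      upd (st (size x)) fr ([::], 0%R).
    by rewrite /st updU updC 1?eq_sym // updU.
  apply: (@triple_leq _ _ (6 * size (nseq (size x) true) + 5)); first by rewrite size_nseq; lia.
  by apply: triple_erase => //; rewrite st_fr.
- exists (fun S => 3 * S + (3 * S + 4 + (f1 S + f0 S + fn S) + 1 + 2) + 1).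
    have pl c d : polybnd (fun S => c * S + d).
      exact: poly_add (poly_mul (poly_const c) poly_id) (poly_const d).
    apply: poly_add (poly_const 1); apply: (poly_add (poly_mul (poly_const 3) poly_id)).
    apply: poly_add (poly_const 2); apply: poly_add (poly_const 1).
    exact: poly_add (pl 3 4) (poly_add (poly_add p1 p0) pn).
  move=> vars o fr env out u S [/= /and5P[ci cj c1 c0 cn] e1 e2 e3 e4 e5 e6 e7 e8] hb.
  have leT k : k < size vars -> nth 0 vars k <= T.
    by move=> hk; have /allP/(_ _ (mem_nth 0 hk)) := e2; rewrite /=; lia.
  have [k1 k2] := triple_seek (leT _ cj) (e6 _ ci) (e6 _ cj).
  apply: (triple_seqf (triple_leq _ k1)); first by rewrite leq_mul2l hb.
  have kb := @triple_back (nth 0 vars i) _ _ _ (leT _ cj) (e6 _ cj).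
  have yS : size (nth [::] env j) <= S by [].
  have main t f : (forall vars o fr env out u S,
      ready u t vars o fr env out -> bounded env S ->
      triple (compile t vars o fr) (f S) u (upd u o (content (out ++ den t env)))) ->
      wf_term (size vars) t -> fr + depth t <= T.+1 -> f S <= f1 S + f0 S + fn S ->
      triple (seqf (rewind T (both (nth 0 vars i) (nth 0 vars j)) (nth 0 vars j)) (compile t vars o fr))
        (3 * S + 4 + (f1 S + f0 S + fn S) + 1)
        (displace (both (nth 0 vars i) (nth 0 vars j)) (size (nth [::] env j)) u)
        (upd u o (content (out ++ den t env))).
    move=> h ct dt ft; apply: (triple_seqf (triple_leq _ kb)); first by lia.
    by apply: triple_leq ft _; apply: h hb.
  rewrite -[X in _ + X + 1]addnA -[2]/(1 + 1) addnA.
  apply: triple_branch; first exact: leT.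
  rewrite k2; case: eqP => [->|n1].
    by apply: triple_leq (main t1 f1 h1 c1 _ _); lia.
  apply: triple_branch; first exact: leT.
  rewrite k2; case: eqP => [->|n0].
    by apply: triple_leq (main t0 f0 h0 c0 _ _); lia.
  have -> : nth None (map Some (nth [::] env i)) (size (nth [::] env j)) = None.
    by case: nth n1 n0 => [[]|].
  by apply: triple_leq (main tn fn hn cn _ _); lia.
Qed.

End Compile.

Local Arguments tape_move : simpl never.
Local Arguments tape_write : simpl never.

(** * Output length is bounded by running time *)

Section OutputSize.

(** The listed cells other than the scanned one, blank or not; a step lists at most one more. This
    bounds the output of a machine of which only the running time is known. *)
Definition tape_size (t : tape) := size t.1.1 + size t.2.

Lemma tape_size_step t a m : tape_size (tape_move (tape_write t a) m) <= (tape_size t).+1.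
Proof.
by case: t => [[l b] r]; case: m; rewrite /tape_size /tape_move /tape_write /= ?size_behead; lia.
Qed.

Lemma tape_size_steps (M : machine) n (c c' : config M) i :
  steps n c c' -> tape_size (c'.2 i) <= tape_size (c.2 i) + n.
Proof.
elim: n c => [|n IH] c; first by rewrite /steps /= => -[->]; rewrite addn0.
rewrite /steps iterSr /=; case e: (Defs.next c) => [c1|] /=; last by rewrite iter_obind_None.
move/IH => h; apply: leq_trans h _; rewrite addnS -addSn leq_add2r.
move: e; rewrite /Defs.next; case: (delta _ _) => // -[q ac] [<-] /=.
exact: tape_size_step.
Qed.

Lemma size_tape_output_leq t : size (tape_output t) <= (tape_size t).+1.
Proof.
rewrite size_tape_output; apply: leq_trans (index_size _ _) _.
by rewrite /= ltnS /tape_size leq_addl.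
Qed.

Lemma tape_size_bits x : tape_size (tape_of_bits x) <= size x.
Proof. by rewrite /tape_size /= size_behead size_map; lia. Qed.

End OutputSize.

(** * Copying between tapes with arbitrary contents *)

Section Copy.
Variable T : nat.
Implicit Types (s : tapes T) (a b i : 'I_T.+1).

Definition active a (r : 'I_T.+1 -> symbol) := r a != None.

Definition copy_step a b : frag T :=
  once (fun r i => if i == b then (r a, MoveR) else (r i, if i == a then MoveR else Stay)).

Definition copy a b := loopf (skip T) (copy_step a b) (active a).

(** Stated for cells and not with [holds], because a tape left behind by an arbitrary machine may
    contain anything outside the word at its head. Positions are relative to the heads after
    copying, hence the negative range. *)
Lemma copy_halts a b s y : a != b ->
  (forall n : nat, n < size y -> cell (s a) n = Some (nth false y n)) ->
  cell (s a) (size y) = None ->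
  exists s', [/\ fhalts (copy a b) (3 * size y) s s',
    (forall i : int, cell (s' a) i = cell (s a) (i + size y)%R),
    (forall i : int, cell (s' b) i = if ((- Posz (size y) <= i) && (i < 0))%R
       then Some (nth false y (absz (i + size y)%R)) else cell (s b) (i + size y)%R) &
    forall i, i != a -> i != b -> s' i = s i].
Proof.
move=> ab; elim: y s => [|c y IH] s h1 h2.
  exists s; split => //.
  - by apply: chain_stop; [exact: skip_halts | rewrite /active /fread cell_read h2].
  - by move=> i; rewrite addr0.
  - by move=> i; rewrite addr0; case: ifP => //= h; exfalso; move: h; lia.
pose s1 := perform (fun r i => if i == b then (r a, MoveR) else (r i, if i == a then MoveR else Stay)) s.
have s1a : s1 a = tape_move (s a) MoveR.
  by rewrite /s1 /perform (negbTE ab) eqxx /= /fread write_read.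
have s1b : s1 b = tape_move (tape_write (s b) (Some c)) MoveR.
  by rewrite /s1 /perform eqxx /= /fread cell_read (h1 0).
have s1i i : i != a -> i != b -> s1 i = s i.
  by move=> /negbTE ha /negbTE hb; rewrite /s1 /perform ha hb /= /fread write_read; case: (s i) => [[]].
have [|| s' [k1 k2 k3 k4]] := IH s1.
- by move=> n hn; rewrite s1a cell_moveR -PoszD addn1 h1.
- by rewrite s1a cell_moveR -PoszD addn1 h2.
exists s'; split => //=.
- have -> : 3 * (size y).+1 = 0 + 1 + 3 * size y + 2 by lia.
  apply: loopf_halts (skip_halts s) _ (once_halts _ _) k1.
  by rewrite /active /fread cell_read (h1 0).
- by move=> i; rewrite k2 s1a cell_moveR; congr cell; lia.
- move=> i; rewrite k3 s1b cell_moveR cell_write.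
  case: ifP => e1; last case: eqP => e2.
  + have -> : (- Posz (size y).+1 <= i < 0)%R by lia.
    by have -> : absz (i + (size y).+1)%R = (absz (i + size y)%R).+1 by lia.
  + have -> : (- Posz (size y).+1 <= i < 0)%R by lia.
    by have -> : absz (i + (size y).+1)%R = 0%N by lia.
  + have -> : (- Posz (size y).+1 <= i < 0)%R = false by lia.
    by congr cell; lia.
- by move=> i ha hb; rewrite k4 // s1i.
Qed.

Definition mvs (A : pred 'I_T.+1) m : frag T := once (fun r i => (r i, if A i then m else Stay)).

Lemma mvs_halts A m s : exists2 s', fhalts (mvs A m) 1 s s' &
  forall i, s' i = if A i then tape_move (s i) m else s i.
Proof.
eexists; first exact: once_halts.
move=> i; rewrite /perform /= /fread write_read; case: (A i) => //.
by case: (s i) => [[]].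
Qed.

Lemma mvs_back_halts (A : pred 'I_T.+1) a s z p : A a -> holds (s a) (z, Posz p - 1)%R -> p <= size z ->
  exists2 s', fhalts (loopf (skip T) (mvs A MoveL) (active a)) (3 * p) s s' &
    forall i, A i -> forall j, cell (s' i) j = cell (s i) (j - Posz p)%R.
Proof.
move=> Aa; elim: p s => [|p IH] s h le.
  exists s; last by move=> i _ j; rewrite subr0.
  by apply: chain_stop; [exact: skip_halts | rewrite /active /fread (holds_read h)].
have [s1 k1 e1] := mvs_halts A MoveL s.
have [||s' k2 e2] := IH s1; [| by lia |].
  rewrite e1 Aa; have := holds_move MoveL h; rewrite /=.
  by have -> : (Posz p.+1 - 1 - 1 = Posz p - 1 :> int)%R by lia.
exists s'; last first.
  by move=> i Ai j; rewrite e2 // e1 Ai cell_moveL; congr cell; lia.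
have -> : 3 * p.+1 = 0 + 1 + 3 * p + 2 by lia.
apply: loopf_halts (skip_halts s) _ k1 k2.
by rewrite /active /fread (holds_read h) word_None /=; lia.
Qed.

End Copy.

(** * A machine followed by a term *)

Section Composition.
Variables (M : machine) (t : term).
Hypothesis ct : wf_term 1 t.

(* Tapes [f1 i] belong to [M]. The tapes [f2 j] evaluate [t]: the output of [M]
   is copied from [x0] to [a], and the value of [t] from [o] back to [x0], where
   it is followed by a blank. *)
Let e := extra_tapes M.
Let T2 := (depth t).+1.
Let T := e + T2.+1.
Let f1 : 'I_e.+1 -> 'I_T.+1 := @lshift e.+1 T2.+1.
Let f2 : 'I_T2.+1 -> 'I_T.+1 := @rshift e.+1 T2.+1.
Let x0 : 'I_T.+1 := ord0.
Let a : 'I_T.+1 := f2 ord0.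
Let o : 'I_T.+1 := f2 (inord 1).

Let eval : frag T2 := seqf (rewind T2 (pred1 0) 0)
  (seqf (compile T2 t [:: 0] 1 2) (rewind T2 (pred1 1) 1)).

Let A : pred 'I_T.+1 := [pred i | (i == x0) || (i == o)].
(** The value is written from the first blank behind the output of [M] on, a region that [M] may
    have used; the cut ends the word there. *)
Let cut : frag T := once (fun r i => if i == x0 then (None, MoveL) else (r i, if i == o then MoveL else Stay)).

Let total : frag T :=
  seqf (embed (frag_of M) f1) (seqf (copy x0 a) (seqf (embed eval f2) (seqf (copy o x0)
    (seqf cut (seqf (loopf (skip T) (mvs A MoveL) (active o)) (mvs A MoveR)))))).

Lemma x0E : x0 = f1 ord0. Proof. exact: val_inj. Qed.

Lemma f1_f2 i j : f1 i != f2 j.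
Proof. by rewrite -val_eqE /=; have := ltn_ord i; lia. Qed.

Lemma f1_inj : injective f1. Proof. exact: lshift_inj. Qed.
Lemma f2_inj : injective f2. Proof. by move=> i j /(congr1 val) /= /addnI h; apply: val_inj. Qed.

Lemma eval_correct : exists2 F, polybnd F & forall y s,
  realizes s (fun i => if i == 0 then content y else ([::], 0%R)) ->
  exists2 s' : tapes T2, fhalts eval (F (size y)) s s' &
    holds (s' (inord 1)) (den t [:: y], 0%R).
Proof.
have [F pF hF] := compile_correct T2 t.
have [g pg hg] := size_den t.
exists (fun n => 3 * n + 4 + (F n + (3 * g n + 4) + 1) + 1).
  have pl h c d : polybnd h -> polybnd (fun n => c * h n + d).
    by move=> ph; exact: poly_add (poly_mul (poly_const c) ph) (poly_const d).
  apply: poly_add (poly_const 1); apply: (poly_add (pl id 3 4 poly_id)).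
  apply: poly_add (poly_const 1); apply: (poly_add pF); exact: pl.
move=> y s hs; set u := fun i : nat => _ in hs.
have hb : bounded [:: y] (size y) by case=> [|k] //=; rewrite nth_nil.
set z := den t [:: y].
pose u1 := upd u 0 (y, 0%R); pose u2 := upd u1 1 (content z); pose u3 := upd u1 1 (z, 0%R).
have h1 : triple (rewind T2 (pred1 0) 0) (3 * size y + 4) u u1.
  have -> : u1 = displace (pred1 0) (- Posz (size y))%R u.
    by rewrite (@displace1E 0 _ u (content y)) //= subrr.
  by apply: (@triple_rewind T2 (pred1 0) 0 u y).
have h2 : triple (compile T2 t [:: 0] 1 2) (F (size y)) u1 u2.
  rewrite /u2 -[z]cat0s; apply: (hF [:: 0] 1 2 [:: y] [::] u1 (size y)) => //.
  by split => // [[]|[|[]]].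
have h3 : triple (rewind T2 (pred1 1) 1) (3 * g (size y) + 4) u2 u3.
  apply: (@triple_leq _ _ (3 * size z + 4)); first by have := hg _ _ hb; rewrite -/z; lia.
  have -> : u3 = displace (pred1 1) (- Posz (size z))%R u2.
    by rewrite (displace1E _ (upd_same _ _ _)) updU /= subrr.
  by apply: (@triple_rewind T2 (pred1 1) 1 u2 z); rewrite // /u2 upd_same.
have [s' k1 k2] := triple_seqf h1 (triple_seqf h2 h3) hs.
by exists s' => //; have := k2 (inord 1); rewrite inordK // /u3 upd_same.
Qed.

Lemma total_correct : exists2 F, polybnd F & forall x n c,
  run n (init M x) = Some c ->
  exists2 s, fhalts total (F (size x + n)) (init (machine_of total) x).2 s &
    tape_output (s ord0) = den t [:: tape_output (c.2 ord0)].
Proof.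
have [F [d hd] hF] := eval_correct.
have [g [d' hd'] hg] := size_den t.
(* [F] and [g] need not be monotone, so their bounds [(size y + 2) ^ d] are used instead, together
   with [size y + 2 <= size x + n + 3]. *)
pose P k m := (m + 3) ^ k.
have pP k : polybnd (P k).
  have pk : polybnd (fun n => n ^ k) by exists k => n; case: k => // k; rewrite leq_exp2r //; lia.
  exact: poly_comp pk (poly_add poly_id (poly_const 3)).
exists (fun m => m + (3 * (m + 1) + (P d m + (3 * P d' m + (1 + (3 * P d' m + 1 + 1) + 1) + 1) + 1) + 1) + 1).
  have p3 k : polybnd (fun n => 3 * P k n) by exact: poly_mul (poly_const 3) (pP k).
  have c1 h : polybnd h -> polybnd (fun n => h n + 1) by move=> ph; exact: poly_add ph (poly_const 1).
  apply: (c1 _); apply: (poly_add poly_id); apply: (c1 _); apply: poly_add.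
    by apply: (poly_mul (poly_const 3)); apply: (c1 _); exact: poly_id.
  apply: (c1 _); apply: (poly_add (pP d)); apply: (c1 _); apply: (poly_add (p3 d')).
  apply: (c1 _); apply: (poly_add (poly_const 1)); do 2 apply: (c1 _); exact: p3.
move=> x n [q s1] /run_steps [n0 [ln0 st hq]].
set y := tape_output _; set z := den t [:: y].
have sy : size y <= size x + n + 1.
  apply: leq_trans (size_tape_output_leq _) _; rewrite addn1 ltnS.
  apply: leq_trans (tape_size_steps _ st) _; apply: leq_add ln0.
  by rewrite /init /= tape_size_bits.
have sz : size z <= P d' (size x + n).
  apply: (@leq_trans (g (size y))).
    by apply: hg => -[|k] //=; rewrite nth_nil.
  by apply: leq_trans (hd' _) _; rewrite /P; case: (d') => // k; rewrite leq_exp2r //; lia.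
have sF : F (size y) <= P d (size x + n).
  by apply: leq_trans (hd _) _; rewrite /P; case: (d) => // k; rewrite leq_exp2r //; lia.
set s0 := (init (machine_of total) x).2.
have es0 : s0 \o f1 = (init M x).2.
  apply/funext => i; rewrite /s0 /init /=; congr (tape_of_bits (if _ then _ else _)).
have k1 : fhalts (frag_of M) n (s0 \o f1) s1.
  rewrite [s0 \o f1]es0; exists n0, q; split => //; exact: (@next_fNone _ (frag_of M)).
have {}k1 := embed_halts f1_inj k1; set r1 := overlay f1 s1 s0 in k1.
have r1x : r1 x0 = s1 ord0 by rewrite x0E /r1 overlay_in //; exact: f1_inj.
have r1f j : holds (r1 (f2 j)) ([::], 0%R).
  rewrite /r1 overlay_out; last by move=> i; exact: f1_f2.
  have -> : s0 (f2 j) = tape_of_bits [::] by [].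
  exact: holds_bits.
have x0a : x0 != a by rewrite x0E f1_f2.
have x0o : x0 != o by rewrite x0E f1_f2.
have [||r2 [k2 _ e2 e2']] := @copy_halts T x0 a r1 y x0a.
- by move=> i hi; rewrite r1x cells_tape_output.
- by rewrite r1x cell_tape_output.
have rel2 : realizes (r2 \o f2) (fun i => if i == 0 then content y else ([::], 0%R)).
  move=> j /=; have [->|j0] := eqVneq j ord0.
    move=> i /=; rewrite e2 r1f /= addr0; case: ifP => hi.
      by rewrite word_in //; lia.
    have -> : word [::] (i + size y)%R = None by rewrite word_out //=; lia.
    by rewrite word_out //; lia.
  have -> : (val j == 0) = false by apply/negbTE.
  rewrite e2' ?(inj_eq f2_inj) //; by rewrite eq_sym x0E f1_f2.
have [v3 k3 h3] := hF y _ rel2.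
have {}k3 := embed_halts f2_inj k3; set r3 := overlay f2 v3 r2 in k3.
have r3o : holds (r3 o) (z, 0%R) by rewrite /r3 overlay_in //; exact: f2_inj.
have ox0 : o != x0 by rewrite eq_sym.
have [||r4 [k4 e4 e4' _]] := @copy_halts T o x0 r3 z ox0.
- by move=> i hi; rewrite r3o addr0 word_in //= ?hi.
- by rewrite r3o addr0 word_out //; rewrite ltxx andbF.
have k5 := once_halts (fun r i => if i == x0 then (None, MoveL) else (r i, if i == o then MoveL else Stay)) r4.
set r5 := perform _ _ in k5.
have r5o : r5 o = tape_move (r4 o) MoveL.
  by rewrite /r5 /perform (eq_sym o) (negbTE x0o) eqxx /= /fread write_read.
have r5x : r5 x0 = tape_move (tape_write (r4 x0) None) MoveL by rewrite /r5 /perform eqxx.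
have r5h : holds (r5 o) (z, Posz (size z) - 1)%R.
  by move=> i; rewrite r5o cell_moveL e4 r3o /= addr0; congr word; lia.
have Ao : A o by apply/orP; right; apply/eqP.
have Ax : A x0 by apply/orP; left; apply/eqP.
have [r6 k6 e6] := mvs_back_halts Ao r5h (leqnn _).
have [r7 k7 e7] := mvs_halts A MoveR r6.
exists r7; last first.
  have c7 (i : int) : cell (r7 x0) i = if (i == Posz (size z))%R then None
      else cell (r4 x0) (i - Posz (size z))%R.
    rewrite e7 Ax cell_moveR e6 // r5x cell_moveL cell_write.
    have -> : (i + 1 - Posz (size z) - 1 = i - Posz (size z))%R by lia.
    by rewrite subr_eq0.
  apply: tape_output_cells => [i hi|]; last by rewrite c7 eqxx.
  rewrite c7; have -> : (Posz i == Posz (size z)) = false by lia.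
  rewrite e4'; have -> : ((- Posz (size z) <= Posz i - Posz (size z)) && (Posz i - Posz (size z) < 0))%R by lia.
  by congr (Some (nth _ _ _)); lia.
have := seqf_halts k1 (seqf_halts k2 (seqf_halts k3 (seqf_halts k4 (seqf_halts k5 (seqf_halts k6 k7))))).
apply: fhalts_leq; lia.
Qed.

End Composition.

(** An arbitrary [f] in front of the term is what the transfer of NP-hardness requires: a reduction
    to the first problem is followed by the term. *)
Lemma polytime_den (f : seq bool -> seq bool) t : wf_term 1 t -> polytime f ->
  polytime (fun x => den t [:: f x]).
Proof.
move=> ct [M [d hd]]; have [F pF hF] := total_correct M ct.
have [d' hd'] : exists d', forall n, F (n + (n ^ d + d)) <= n ^ d' + d'.
  exact/poly_bound/(poly_comp pF)/(poly_add poly_id)/poly_pow.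
set G := machine_of _ in hF; exists G, d' => x; have [c hc <-] := hd x.
have [s [n [q [ln st hq]]] <-] := hF _ _ _ hc.
exists (q, s) => //; apply: steps_run (leq_trans ln (hd' _)); first exact: st.
exact: fnext_None.
Qed.

Lemma polytime_id : polytime id.
Proof.
pose M := @Machine 0 unit tt (fun _ _ => None).
exists M, 0 => x; exists (init M x) => //=.
apply: tape_output_cells => [n hn|]; rewrite holds_bits /= addn0.
- by rewrite (nth_map false).
- by rewrite nth_default // size_map.
Qed.

(** * Surfaces glued from a disc *)

Section Circle.
Variable R : realType.
Local Open Scope ring_scope.
Local Open Scope classical_set_scope.
Implicit Types (t s : R) (z b : R * R).

Local Notation cp := (@circle_point R).

(** For a unit vector [b], [dot b z] and [crs b z] are the coordinates of [z] in the orthonormal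
    frame formed by [b] and its rotation by a quarter turn. *)
Definition dot b z : R := b.1 * z.1 + b.2 * z.2.
Definition crs b z : R := b.1 * z.2 - b.2 * z.1.
Definition nsq z : R := z.1 ^+ 2 + z.2 ^+ 2.

Lemma nsq_ge0 z : 0 <= nsq z.
Proof. by rewrite addr_ge0 ?sqr_ge0. Qed.

Lemma dot_crs b z : nsq b = 1 -> dot b z ^+ 2 + crs b z ^+ 2 = nsq z.
Proof. by move=> hb; rewrite -[RHS]mul1r -hb /nsq /dot /crs; ring. Qed.

Lemma dot_crs_inj b z z' : nsq b = 1 -> dot b z = dot b z' -> crs b z = crs b z' -> z = z'.
Proof.
case: b z z' => [b1 b2] [x y] [x' y']; rewrite /nsq /dot /crs /= => hb h1 h2.
have ex u v : u = (b1 ^+ 2 + b2 ^+ 2) * u + v - v by rewrite hb; ring.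
congr pair.
- transitivity (b1 * (b1 * x + b2 * y) - b2 * (b1 * y - b2 * x)); last rewrite h1 h2.
    by rewrite -[LHS]mul1r -hb; ring.
  by rewrite -[RHS]mul1r -hb; ring.
- transitivity (b2 * (b1 * x + b2 * y) + b1 * (b1 * y - b2 * x)); last rewrite h1 h2.
    by rewrite -[LHS]mul1r -hb; ring.
  by rewrite -[RHS]mul1r -hb; ring.
Qed.

Lemma nsq_cp t : nsq (cp t) = 1.
Proof. by rewrite /nsq /= cos2Dsin2. Qed.

Lemma dot_cp t s : dot (cp t) (cp s) = cos (2 * pi * (s - t)).
Proof. by rewrite /dot /= mulrBr cosB; ring. Qed.

Lemma crs_cp t s : crs (cp t) (cp s) = sin (2 * pi * (s - t)).
Proof. by rewrite /crs /= mulrBr sinB; ring. Qed.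

Lemma cpD1 t : cp (t + 1) = cp t.
Proof.
by rewrite /circle_point mulrDr mulr1 [2 * pi]mulr_natl cosD2pi sinD2pi.
Qed.

Lemma cpB1 t : cp (t - 1) = cp t.
Proof. by rewrite -cpD1 subrK. Qed.

(** From [cos (2 x) = 1 - 2 (sin x) ^ 2] with [x = pi t], where the sine is positive for
    [0 < t < 1]. *)
Lemma cos_eq1 t : 0 <= t < 1 -> cos (2 * pi * t) = 1 -> t = 0.
Proof.
move=> /andP[t0 t1] h; apply/eqP; case: eqVneq => // tn0.
have tp : 0 < t by rewrite lt_def tn0.
have := pi_gt0 R => pi0.
have : 0 < sin (pi * t).
  by apply: sin_gt0_pi; rewrite mulr_gt0 //= -[ltRHS]mulr1 ltr_pM2l.
have : sin (pi * t) ^+ 2 = 0.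
  have := cos_mulr2n (pi * t); rewrite -[X in cos X]mulr_natl mulrA h cos2sin2; lra.
by move/eqP; rewrite expf_eq0 /= => /eqP ->; rewrite ltxx.
Qed.

Lemma cp_inj t s : 0 <= t < 1 -> 0 <= s < 1 -> cp t = cp s -> t = s.
Proof.
wlog : t s / t <= s.
  by move=> h ht hs e; case: (leP t s) => [|/ltW] le; [apply: h | apply/esym/h].
move=> le /andP[t0 t1] /andP[s0 s1] e.
have := dot_cp t s; rewrite e dot_cp subrr mulr0 cos0 => /esym/cos_eq1 h.
by apply/esym/eqP; rewrite -subr_eq0; apply/eqP/h; lra.
Qed.

Lemma cp_surj z : nsq z = 1 -> exists2 t, 0 <= t < 1 & cp t = z.
Proof.
case: z => x y; rewrite /nsq /= => h.
have x1 : -1 <= x <= 1.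
  have : x ^+ 2 <= 1 by rewrite -h lerDl sqr_ge0.
  by move=> h1; apply/andP; split; nra.
have pi0 := pi_gt0 R; have p0 : 2 * pi != 0 :> R by rewrite gt_eqF // mulr_gt0.
have a0 := acos_ge0 x1; have a1 := acos_lepi x1.
have y2 : 1 - x ^+ 2 = y ^+ 2 by lra.
have q1 : acos x / (2 * pi) <= 2^-1 by rewrite ler_pdivrMr ?mulr_gt0 //; lra.
have q0 : 0 <= acos x / (2 * pi) by rewrite divr_ge0 // mulr_ge0 // ltW.
have cx : cos (acos x) = x by rewrite acosK // in_itv.
have [y0|y0] := leP 0 y.
  exists (acos x / (2 * pi)); first lra.
  rewrite /circle_point mulrC divfK // cx sin_acos // y2 sqrtr_sqr ger0_norm //.
exists (1 - acos x / (2 * pi)).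
  have : 0 < acos x / (2 * pi); last lra.
  rewrite divr_gt0 ?mulr_gt0 // acos_gt0 //; case/andP: x1 => -> x1 /=.
  rewrite lt_neqAle x1 andbT; apply/eqP => e1; move: y2; rewrite e1 expr1n subrr => /esym/eqP.
  by rewrite expf_eq0 /= lt_eqF.
rewrite /circle_point mulrBr mulr1 [2 * pi * _]mulrC divfK //.
have -> : 2 * pi - acos x = - acos x + pi *+ 2 by rewrite -[pi *+ 2]mulr_natl addrC.
rewrite cosD2pi sinD2pi cosN sinN cx sin_acos // y2 sqrtr_sqr ltr0_norm // opprK //.
Qed.

Lemma cp_frac t : exists2 s, 0 <= s < 1 & cp s = cp t.
Proof. exact/cp_surj/nsq_cp. Qed.

Lemma cpD t s : cp (t + s) =
  ((cp t).1 * (cp s).1 - (cp t).2 * (cp s).2, (cp t).2 * (cp s).1 + (cp t).1 * (cp s).2).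
Proof. by rewrite /circle_point mulrDr cosD sinD. Qed.

(** Cosine decreases on [[0, pi]], so an inner product above [cos (2 pi d)] means angular distance
    below [d]. The witness is the difference of the two angles, brought into [[-1/2, 1/2]] by a full
    turn. *)
Lemma cp_near t d z : 0 < d <= 2^-1 -> nsq z = 1 -> cos (2 * pi * d) < dot (cp t) z ->
  exists2 s, `|s| < d & z = cp (t + s).
Proof.
move=> hd /cp_surj[u hu <-]; have [v hv ev] := cp_frac t; rewrite -ev dot_cp.
have [s hs e] : exists2 s, `|s| <= 2^-1 & cp u = cp (v + s).
  have [h1|h1] := ltP 2^-1 (u - v).
    exists (u - v - 1); first by rewrite ler_norml; lra.
    by rewrite -cpB1; congr cp; lra.
  have [h2|h2] := ltP (u - v) (- 2^-1).
    exists (u - v + 1); first by rewrite ler_norml; lra.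
    by rewrite -cpD1; congr cp; lra.
  by exists (u - v); [rewrite ler_norml; lra | congr cp; lra].
have -> : cos (2 * pi * (u - v)) = cos (2 * pi * `|s|).
  have -> : 2 * pi * `|s| = `|2 * pi * s| by rewrite normrM (ger0_norm (_ : 0 <= 2 * pi)) ?mulr_ge0 ?pi_ge0.
  rewrite cos_norm -dot_cp e dot_cp; congr (cos (_ * _)); lra.
have pi0 := pi_gt0 R; have s0 := normr_ge0 s.
rewrite ltr_cos; last 2 first.
- by rewrite in_itv /=; nra.
- by rewrite in_itv /=; nra.
by rewrite ltr_pM2l ?mulr_gt0 // => hlt; exists s => //; rewrite e [LHS]cpD [RHS]cpD ev.
Qed.

End Circle.

(** * Continuity at a point of real and planar functions *)

Section ContinuityTools.
Variables (R : realType) (T : topologicalType).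
Local Open Scope ring_scope.
Local Open Scope classical_set_scope.
Implicit Types (f g : T -> R) (x : T).

Lemma cont_cst (c : R) x : {for x, continuous (fun _ : T => c)}.
Proof. exact: cvg_cst. Qed.

Lemma contD f g x : {for x, continuous f} -> {for x, continuous g} ->
  {for x, continuous (fun y => f y + g y)}.
Proof. by move=> cf cg; apply: (@continuousD _ R^o). Qed.

Lemma contN f x : {for x, continuous f} -> {for x, continuous (fun y => - f y)}.
Proof. by move=> cf; apply: (@continuousN _ R^o). Qed.

Lemma contB f g x : {for x, continuous f} -> {for x, continuous g} ->
  {for x, continuous (fun y => f y - g y)}.
Proof. by move=> cf cg; apply: contD => //; apply: contN. Qed.

Lemma contM f g x : {for x, continuous f} -> {for x, continuous g} ->
  {for x, continuous (fun y => f y * g y)}.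
Proof. by move=> cf cg; apply: continuousM. Qed.

Lemma cont_max f g x : {for x, continuous f} -> {for x, continuous g} ->
  {for x, continuous (fun y => Num.max (f y) (g y))}.
Proof. exact: continuous_max. Qed.

Lemma cont_min f g x : {for x, continuous f} -> {for x, continuous g} ->
  {for x, continuous (fun y => Num.min (f y) (g y))}.
Proof. exact: continuous_min. Qed.

Lemma cont_div f g x : g x != 0 -> {for x, continuous f} -> {for x, continuous g} ->
  {for x, continuous (fun y => f y / g y)}.
Proof. by move=> g0 cf cg; apply: contM => //; apply: continuousV. Qed.

Lemma cont_comp (h : R -> R) f x : continuous h -> {for x, continuous f} ->
  {for x, continuous (fun y => h (f y))}.
Proof. by move=> ch cf; apply: (continuous_comp (f := f) (g := h)) => //; apply: ch. Qed.

Lemma cont_pair f g x : {for x, continuous f} -> {for x, continuous g} ->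
  {for x, continuous (fun y => (f y, g y))}.
Proof. move=> cf cg; exact: (@cvg_pair _ _ _ (nbhs x) (nbhs (f x)) (nbhs (g x)) _ _ _ f g cf cg). Qed.

Lemma cont_sum (I : Type) (r : seq I) (F : I -> T -> R) x :
  (forall i, {for x, continuous (F i)}) -> {for x, continuous (fun y => \sum_(i <- r) F i y)}.
Proof.
move=> h; elim: r => [|i r IH].
  rewrite (_ : (fun _ => _) = fun _ => 0); first exact: cont_cst.
  by apply/funext => y; rewrite big_nil.
rewrite (_ : (fun _ => _) = fun y => F i y + \sum_(j <- r) F j y); first exact: contD.
by apply/funext => y; rewrite big_cons.
Qed.

Lemma cont_fst (h : T -> R * R) x : {for x, continuous h} -> {for x, continuous (fun y => (h y).1)}.
Proof. by move=> ch; apply: (cvg_comp _ _ ch); apply: cvg_fst. Qed.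

Lemma cont_snd (h : T -> R * R) x : {for x, continuous h} -> {for x, continuous (fun y => (h y).2)}.
Proof. by move=> ch; apply: (cvg_comp _ _ ch); apply: cvg_snd. Qed.

(** [g] may be discontinuous at [x]. This serves polar coordinates at points where the angle breaks
    down but the radial factor vanishes. *)
Lemma cont_squeeze f g x : {for x, continuous f} -> f x = 0 -> (forall y, `|g y| <= 1) ->
  {for x, continuous (fun y => f y * g y)}.
Proof.
move=> cf f0 gb; change (f y * g y @[y --> x] --> f x * g x); rewrite f0 mul0r.
apply/cvgr0Pnorm_lt => e e0.
have /cvgr0Pnorm_lt/(_ _ e0) : f y @[y --> x] --> 0 by rewrite -[X in _ --> X]f0; exact: cf.
apply: filterS => y; apply: le_lt_trans.
by rewrite normrM ler_piMr.
Qed.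

End ContinuityTools.

(** * Separation and charts from functions to the plane *)

Section SurfaceTools.
Variables (R : realType).
Local Open Scope ring_scope.
Local Open Scope classical_set_scope.

Lemma cont_nsq (T : topologicalType) (h : T -> R * R) x :
  {for x, continuous h} -> {for x, continuous (fun y => nsq (h y))}.
Proof.
move=> ch.
exact: (contD (contM (cont_fst ch) (cont_fst ch)) (contM (cont_snd ch) (cont_snd ch))).
Qed.

Lemma fst_cont : continuous (fun z : R * R => z.1).
Proof. by move=> z; apply: (@cont_fst R (R * R)%type id z); exact: cvg_id. Qed.

Lemma snd_cont : continuous (fun z : R * R => z.2).
Proof. by move=> z; apply: (@cont_snd R (R * R)%type id z); exact: cvg_id. Qed.

Lemma hausdorff_of_functions (M : topologicalType) :
  (forall x y : M, x <> y -> exists2 f : M -> R * R, continuous f & f x <> f y) ->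
  hausdorff_space M.
Proof.
move=> sep x y cl; apply: contrapT => /sep[f cf]; apply.
have : hausdorff_space (R * R)%type by apply: norm_hausdorff.
apply=> A B fA fB.
have [z [Az Bz]] := cl (f @^-1` A) (f @^-1` B) (cf _ _ fA) (cf _ _ fB).
by exists (f z).
Qed.

(* A continuous injection of a compact set into the plane is an embedding, so
   a chart need only be continuous, injective and of open image. *)
Lemma chart_of_functions (M : topologicalType) (D : M -> R) (h : M -> R * R) (c : R) (x : M) :
  compact [set: M] -> continuous D -> continuous h -> D x < c ->
  set_inj [set m | D m <= c] h -> open (h @` [set m | D m < c]) ->
  exists (U : set M) (h : M -> R * R),
    [/\ open U /\ U x, {within U, continuous h}, set_inj U h &
        forall O : set M, open O -> O `<=` U -> open (h @` O)].
Proof.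
move=> cM cD ch Dx hinj hop; exists [set m | D m < c], h.
have UK m : D m < c -> D m <= c by apply: ltW.
split.
- split => //; move/continuousP: (cD) => /(_ [set y | y < c] (@open_lt _ c)); exact.
- exact: continuous_subspaceT.
- by move=> m m' /set_mem hm /set_mem hm'; apply: hinj; apply/mem_set/UK.
- move=> O oO OU.
  have -> : h @` O = (h @` [set m | D m < c]) `&` ~` (h @` ([set m | D m <= c] `&` ~` O)).
    apply/seteqP; split => [_ [m Om <-]|w [[m Um <-] nw]].
      split; first by exists m => //; apply: OU.
      move=> [m' [Km' Om'] e]; apply: Om'.
      by rewrite (hinj m' m) //; apply/mem_set => //; apply/UK/OU.
    exists m => //; apply: contrapT => nO; apply: nw; exists m => //; split => //; exact: UK.
  apply: openI => //; apply: closed_openC; apply: compact_closed; first exact: norm_hausdorff.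
  apply: continuous_compact; first exact: continuous_subspaceT.
  apply: subclosed_compact cM _ => //; apply: closedI; last exact: open_closedC.
  by apply: (@closed_comp _ _ D [set y | y <= c]) => [y _|]; [exact: cD | exact: closed_le].
Qed.

End SurfaceTools.

(** * The quotient topology *)

Section Glued.
Variables (R : realType) (T : Type) (kappa : R * R -> T).
Local Open Scope ring_scope.
Local Open Scope classical_set_scope.

Definition glued (k : R * R -> T) : Type := T.

HB.instance Definition _ := gen_eqMixin (glued kappa).
HB.instance Definition _ := gen_choiceMixin (glued kappa).

(** The quotient is taken of the whole plane and not of the disc, which avoids subspace topologies;
    the maps [kappa] used here factor through the retraction onto the disc. *)
Definition glued_open (U : set (glued kappa)) := open (kappa @^-1` U).

Lemma glued_openT : glued_open setT.
Proof. by rewrite /glued_open preimage_setT; exact: openT. Qed.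

Lemma glued_openI : setI_closed glued_open.
Proof. by move=> A B oA oB; exact: openI. Qed.

Lemma glued_open_bigU (I : Type) (f : I -> set (glued kappa)) :
  (forall i, glued_open (f i)) -> glued_open (\bigcup_i f i).
Proof. by move=> ofi; apply: bigcup_open => i _; exact: ofi. Qed.

HB.instance Definition _ := @isOpenTopological.Build (glued kappa) glued_open
  glued_openT glued_openI glued_open_bigU.

Lemma kappa_continuous : continuous (kappa : R * R -> glued kappa).
Proof. exact/continuousP. Qed.

Lemma glued_continuous (Z : topologicalType) (f : glued kappa -> Z) :
  continuous (f \o kappa) -> continuous f.
Proof. by move=> /continuousP cf; apply/continuousP => A oA; exact: cf. Qed.

End Glued.

(** * The radial retraction onto the disc *)

Section Retraction.
Variable R : realType.
Local Open Scope ring_scope.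
Local Open Scope classical_set_scope.
Implicit Types z : R * R.

Definition retr_norm z : R := Num.max 1 (Num.sqrt (nsq z)).
Definition retr z : R * R := (z.1 / retr_norm z, z.2 / retr_norm z).

Lemma retr_den z : 0 < retr_norm z.
Proof. by rewrite lt_max ltr01. Qed.

Lemma nsq_scale z n : nsq (z.1 / n, z.2 / n) = nsq z / n ^+ 2.
Proof. by rewrite /nsq /= !expr_div_n mulrDl. Qed.

Lemma nsq_retr z : nsq (retr z) <= 1.
Proof.
rewrite /retr nsq_scale ler_pdivrMr ?exprn_gt0 ?retr_den // mul1r.
have h := ltW (retr_den z); rewrite -[leLHS]sqr_sqrtr ?nsq_ge0 //.
by rewrite ler_sqr ?nnegrE ?sqrtr_ge0 // le_max lexx orbT.
Qed.

Lemma retr_disc z : nsq z <= 1 -> retr z = z.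
Proof.
move=> h; rewrite /retr (_ : retr_norm z = 1) ?divr1; first by case: z h.
by apply/max_idPl; rewrite -sqrtr1 ler_wsqrtr.
Qed.

Lemma retr_continuous : continuous retr.
Proof.
have id_cont (x : R * R) : {for x, continuous (fun y : R * R => y)} by exact: cvg_id.
have norm_cont (x : R * R) : {for x, continuous retr_norm}.
  apply: cont_max; first exact: cont_cst.
  by apply: cont_comp; [exact: sqrt_continuous | exact: cont_nsq].
move=> z; have n0 : retr_norm z != 0 by rewrite gt_eqF // retr_den.
apply: (@cont_pair _ _ (fun z => z.1 / retr_norm z) (fun z => z.2 / retr_norm z)).
- exact: cont_div n0 (@fst_cont R z) (norm_cont z).
- exact: cont_div n0 (@snd_cont R z) (norm_cont z).
Qed.

End Retraction.

(** * Quotients of the disc: compactness, connectedness, interior charts *)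

Section DiscGluing.
Variables (R : realType) (T : Type) (kappa : R * R -> T).
Local Open Scope ring_scope.
Local Open Scope classical_set_scope.
Implicit Types (z : R * R) (m : T).

Local Notation cp := (@circle_point R).

(* Near the boundary point [cp t0] the circle consists of [d] arcs of angular
   radius [del] centred at the [b i], and [kappa] sends the right half of the
   [i]-th arc and the left half of the [(i - 1)]-st arc to the same curve
   [ray i]. *)
Record corner (t0 : R) (d : nat) (b : nat -> R) (ray : nat -> R -> T) (del : R) : Prop := Corner {
  corner_gt0 : (0 < d)%N;
  corner_del : 0 < del <= 2^-1;
  corner_center : forall i, (i < d)%N -> kappa (cp (b i)) = kappa (cp t0);
  corner_right : forall i t, (i < d)%N -> 0 <= t < del -> kappa (cp (b i + t)) = ray i t;
  corner_left : forall i t, (i < d)%N -> 0 <= t < del ->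
    kappa (cp (b i - t)) = ray (i.+1 %% d)%N t;
  corner_ray : forall i j t s, (i < d)%N -> (j < d)%N -> 0 <= t < del -> 0 <= s < del ->
    ray i t = ray j s -> t = s /\ (t = 0 \/ i = j);
  corner_inj : forall i j, (i < d)%N -> (j < d)%N -> cp (b i) = cp (b j) -> i = j;
  corner_sat : forall i t a, (i < d)%N -> 0 <= t < del -> kappa (cp a) = ray i t ->
    exists j s, [/\ (j < d)%N, `|s| = t & cp a = cp (b j + s)]
}.

Record disc_gluing : Prop := DiscGluing {
  glue_retr : forall z, kappa z = kappa (retr z);
  glue_onto : forall m, exists2 z, nsq z <= 1 & kappa z = m;
  glue_int : forall z z', nsq z < 1 -> nsq z' <= 1 -> kappa z = kappa z' -> z = z';
  glue_bd : forall t0, exists d b ray del, corner t0 d b ray del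
}.

Hypothesis glueP : disc_gluing.

Local Notation M := (glued kappa).

Definition rep m : R * R := s2val (cid2 (glue_onto glueP m)).

Lemma nsq_rep m : nsq (rep m) <= 1.
Proof. exact: (s2valP (cid2 (glue_onto glueP m))). Qed.

Lemma kappa_rep m : kappa (rep m) = m.
Proof. exact: (s2valP' (cid2 (glue_onto glueP m))). Qed.

Definition compat (Y : Type) (F : R * R -> Y) := forall z z',
  nsq z <= 1 -> nsq z' <= 1 -> kappa z = kappa z' -> F z = F z'.

Lemma lift_kappa (Y : Type) (F : R * R -> Y) z : compat F -> nsq z <= 1 -> F (rep (kappa z)) = F z.
Proof. by move=> cF hz; apply: cF; rewrite ?nsq_rep // kappa_rep. Qed.

(** Composed with [kappa], the lifted map equals [F] after the retraction, which is continuous on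
    the plane. *)
Lemma lift_continuous (Y : topologicalType) (F : R * R -> Y) : compat F -> continuous F ->
  continuous (F \o rep : M -> Y).
Proof.
move=> cF contF; apply: glued_continuous.
rewrite (_ : _ \o _ = F \o @retr R).
  by move=> z; apply: continuous_comp; [exact: retr_continuous | exact: contF].
apply/funext => z /=; apply: cF; rewrite ?nsq_rep ?nsq_retr // kappa_rep.
exact: glue_retr.
Qed.

Lemma glued_compact : compact [set: M].
Proof.
have -> : [set: M] = (kappa : R * R -> M) @` (`[-1, 1] `*` `[-1, 1]).
  apply/seteqP; split => // m _; exists (rep m); last exact: kappa_rep.
  have := nsq_rep m; case: (rep m) => x y; rewrite /nsq /= => h.
  by split; rewrite /= in_itv /=; apply/andP; split; nra.
apply: continuous_compact.
  by apply: continuous_subspaceT; exact: kappa_continuous.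
by apply: compact_setX; exact: segment_compact.
Qed.

(** The space is the union of the images of segments from the origin, which all contain the image of
    the origin. *)
Lemma glued_connected : connected [set: M].
Proof.
pose ray z := (fun t : R => kappa (t * z.1, t * z.2) : M) @` `[0, 1].
have -> : [set: M] = \bigcup_(z in [set: R * R]) ray z.
  apply/seteqP; split => // m _; exists (rep m) => //.
  exists 1; first by rewrite /= in_itv /= ler01 lexx.
  by rewrite !mul1r -[RHS]kappa_rep; case: (rep m).
apply: bigcup_connected.
  exists (kappa (0, 0)) => z _; exists 0; first by rewrite /= in_itv /= lexx ler01.
  by rewrite !mul0r.
move=> z _; apply: connected_continuous_connected.
  exact: segment_connected.
apply: continuous_subspaceT => t.
apply: (@continuous_comp _ _ _ (fun t : R => (t * z.1, t * z.2)) (kappa : R * R -> M)).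
  by apply: cont_pair; apply: contM; try exact: cvg_id; exact: cont_cst.
exact: kappa_continuous.
Qed.

Section Interior.

Lemma compat_nsq : compat (@nsq R).
Proof.
move=> z z' h h' e; have [l|l] := ltP (nsq z) 1.
  by rewrite (glue_int glueP l h' e).
have [l'|l'] := ltP (nsq z') 1; last by apply/eqP; rewrite eq_le (le_trans h) // (le_trans h').
by rewrite (glue_int glueP l' h (esym e)).
Qed.

Lemma nsq_continuous : continuous (@nsq R).
Proof. by move=> z; apply: cont_nsq; exact: cvg_id. Qed.

(* With [g 1 = 0] the boundary circle collapses to the origin, hence the map is
   compatible with any gluing of the circle. *)
Definition flatten_disc (g : R -> R) z : R * R := (g (nsq z) * z.1, g (nsq z) * z.2).

Lemma compat_flatten g : g 1 = 0 -> compat (flatten_disc g).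
Proof.
move=> g1 z z' h h' e; have en := compat_nsq h h' e.
have [l|l] := ltP (nsq z) 1; first by rewrite (glue_int glueP l h' e).
have n1 : nsq z = 1 by apply/eqP; rewrite eq_le h.
by rewrite /flatten_disc -en n1 g1 !mul0r.
Qed.

Lemma flatten_continuous g : continuous g -> continuous (flatten_disc g).
Proof.
move=> cg z.
have gz : {for z, continuous (fun z => g (nsq z))} by apply: cont_comp => //; exact: nsq_continuous.
apply: (@cont_pair _ _ (fun z => g (nsq z) * z.1) (fun z => g (nsq z) * z.2)).
- exact: contM gz (@fst_cont R z).
- exact: contM gz (@snd_cont R z).
Qed.

Lemma open_ball_nsq (c : R) : open [set w : R * R | nsq w < c].
Proof. by move/continuousP: nsq_continuous => /(_ [set y | y < c] (@open_lt _ c)). Qed.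

Lemma interior_chart z0 : nsq z0 < 1 ->
  exists (U : set M) (h : M -> R * R),
    [/\ open U /\ U (kappa z0), {within U, continuous h}, set_inj U h &
        forall O : set M, open O -> O `<=` U -> open (h @` O)].
Proof.
move=> h0; pose c := (1 + nsq z0) / 2.
have c0 : nsq z0 < c by rewrite /c; lra.
have c1 : c < 1 by rewrite /c; lra.
(* A cutoff equal to 1 up to [c] and to 0 at 1: the map is the identity on a disc around [z0], yet
   collapses the circle and so descends to the quotient. *)
pose g (u : R) := Num.max 0 (Num.min 1 ((1 - u) / (1 - c))).
have g1 : g 1 = 0 by rewrite /g subrr mul0r minEle ler10 maxxx.
have gc u : u <= c -> g u = 1.
  move=> hu; have : 1 <= (1 - u) / (1 - c) by rewrite ler_pdivlMr; lra.
  by move=> h; rewrite /g (min_idPl h); apply/max_idPr; exact: ler01.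
have gcont : continuous g.
  have cid (u : R) : {for u, continuous (fun v : R => v)} by exact: cvg_id.
  have c1u (u : R) : {for u, continuous (fun v : R => (1 - v) / (1 - c))}.
    exact: contM (contB (@cont_cst R R 1 u) (cid u)) (@cont_cst R R _ u).
  move=> u; exact: cont_max (@cont_cst R R 0 u) (cont_min (@cont_cst R R 1 u) (c1u u)).
have gid z : nsq z <= c -> flatten_disc g z = z.
  by move=> h; rewrite /flatten_disc gc // !mul1r; case: z h.
have cf := compat_flatten g1.
apply: (@chart_of_functions R M (@nsq R \o rep) (flatten_disc g \o rep) c).
- exact: glued_compact.
- by apply: lift_continuous; [exact: compat_nsq | exact: nsq_continuous].
- by apply: lift_continuous cf _; exact: flatten_continuous.
- by rewrite /= lift_kappa //; [exact: compat_nsq | exact: ltW].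
- move=> m m' /set_mem /= hm /set_mem /= hm'.
  by rewrite !gid // => e; rewrite -(kappa_rep m) e kappa_rep.
- rewrite (_ : _ @` _ = [set w | nsq w < c]); first exact: open_ball_nsq.
  apply/seteqP; split => [_ [m /= hm <-]|w /= hw].
    by rewrite gid // ltW.
  have w1 : nsq w <= 1 by apply/ltW/(lt_trans hw).
  exists (kappa w); rewrite /= lift_kappa //; first exact: compat_nsq.
  by rewrite gid // ltW.
Qed.

(** Points of different norm are separated by the norm. For equal norms a collapse of the circle
    works, because its factor [1 - nsq z] is the same nonzero number at both points. *)
Lemma separate_interior z z' : nsq z < 1 -> nsq z' < 1 -> kappa z <> kappa z' ->
  exists2 f : M -> R * R, continuous f & f (kappa z) <> f (kappa z').
Proof.
move=> h h' ne; have [e|e] := eqVneq (nsq z) (nsq z'); last first.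
  exists (fun m => (nsq (rep m), 0)).
    move=> m; have cn := @lift_continuous _ _ compat_nsq nsq_continuous m.
    exact: (@cont_pair R M (fun m => nsq (rep m)) (fun=> 0) m cn (@cont_cst R M 0 m)).
  by move=> [/eqP]; rewrite !lift_kappa ?ltW //; [rewrite (negbTE e) | exact: compat_nsq..].
pose g (u : R) := 1 - u.
have cf : compat (flatten_disc g) by apply: compat_flatten; rewrite /g subrr.
exists (flatten_disc g \o rep).
  apply: lift_continuous cf _; apply: flatten_continuous => u.
  by apply: (contB (@cont_cst R R 1 u)); exact: cvg_id.
rewrite /= !lift_kappa ?ltW // /flatten_disc -e => -[].
have g0 : g (nsq z) != 0 by rewrite gt_eqF // subr_gt0.
move=> /(mulfI g0) e1 /(mulfI g0) e2; apply: ne; congr kappa.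
by case: z z' e1 e2 {h h' e g0} => x y [x' y'] /= -> ->.
Qed.

End Interior.

End DiscGluing.

(** * Charts at boundary points *)

Section BoundaryChart.
Variables (R : realType) (T : Type) (kappa : R * R -> T).
Local Open Scope ring_scope.
Local Open Scope classical_set_scope.
Implicit Types (z : R * R) (m : T).

Local Notation cp := (@circle_point R).

Hypothesis glueP : disc_gluing kappa.
Local Notation M := (glued kappa).
Variables (t0 : R) (d : nat) (b : nat -> R) (ray : nat -> R -> T) (del : R).
Hypothesis C : corner kappa t0 d b ray del.

Let p i z := dot (cp (b i)) z.
Let sn i z := crs (cp (b i)) z.
(** The distance of [z] from the tangent at [cp (b i)]; cap [i] is where it is small. On the circle
    it depends only on the angular distance from [b i], so boundary points identified near a corner
    have equal heights. *)
Definition height i z := 1 - p i z.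
Local Notation rd := height.

Lemma p_sn i z : p i z ^+ 2 + sn i z ^+ 2 = nsq z.
Proof. by rewrite dot_crs // nsq_cp. Qed.

Lemma height_ge0 i z : nsq z <= 1 -> 0 <= rd i z.
Proof. by have := p_sn i z; have := sqr_ge0 (sn i z); rewrite /rd; nra. Qed.

Lemma cos_del : cos (2 * pi * del) < 1.
Proof.
have /andP[d0 d1] := corner_del C; rewrite lt_neqAle cos_le1 andbT; apply/eqP => /cos_eq1 h.
by have : del = 0; [apply: h; lra | lra].
Qed.

Lemma pos_lower_bound (s : seq R) : all (fun x => 0 < x) s ->
  exists2 e, 0 < e & forall x, x \in s -> e <= x.
Proof.
elim: s => [|x s IH] /=; first by exists 1.
case/andP => x0 /IH[e e0 he]; exists (Num.min x e); first by rewrite lt_min x0.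
by move=> y; rewrite inE => /orP[/eqP ->|/he h]; rewrite ge_min ?lexx // h orbT.
Qed.

Lemma cap_radius : exists e, [/\ 0 < e <= 1, cos (2 * pi * del) <= 1 - e &
  forall i j z, (i < d)%N -> (j < d)%N -> nsq z <= 1 -> rd i z < e -> rd j z < e -> i = j].
Proof.
(* For centres [P], [Q] and [|z| <= 1], the inequality [|2 z - P - Q| ^ 2 >= 0] shows that the two
   heights add up to at least [(1 - dot P Q) / 2]; hence they are not both below half of that. *)
pose gap i j := if i == j then 1 else (1 - dot (cp (b i)) (cp (b j))) / 4.
have gap0 i j : (i < d)%N -> (j < d)%N -> 0 < gap i j.
  move=> hi hj; rewrite /gap; case: eqP => // ne.
  have := @height_ge0 i (cp (b j)); rewrite nsq_cp lexx => /(_ isT).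
  rewrite le_eqVlt => /orP[/eqP e|]; last by rewrite /rd /p; lra.
  have dij : dot (cp (b i)) (cp (b j)) = 1 by move: e; rewrite /rd /p; lra.
  have dii : dot (cp (b i)) (cp (b i)) = 1 by rewrite dot_cp subrr mulr0 cos0.
  have cij : crs (cp (b i)) (cp (b j)) = 0.
    have := p_sn i (cp (b j)); rewrite nsq_cp /p /sn dij expr1n => h.
    by apply/eqP; rewrite -sqrf_eq0; apply/eqP; lra.
  case: ne; apply: (corner_inj C) => //; apply: (@dot_crs_inj _ (cp (b i))).
  - exact: nsq_cp.
  - by rewrite dii dij.
  - by rewrite cij crs_cp subrr mulr0 sin0.
have [|e e0 he] := @pos_lower_bound (1 :: (1 - cos (2 * pi * del)) :: [seq gap i j | i <- iota 0 d, j <- iota 0 d]).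
  rewrite /= ltr01 subr_gt0 cos_del /=; apply/allP => x /allpairsP[[i j] /= []].
  by rewrite !mem_iota /= => hi hj ->; exact: gap0.
exists e; split.
- by rewrite e0 he ?inE ?eqxx.
- by have := he (1 - cos (2 * pi * del)); rewrite !inE eqxx orbT => /(_ isT); lra.
move=> i j z hi hj hz hri hrj; apply/eqP; apply: contraT => ne.
have : e <= gap i j.
  by apply: he; rewrite !inE; apply/orP; right; apply/orP; right; apply: allpairs_f; rewrite mem_iota.
rewrite /gap (negbTE ne) => hg.
have ni := nsq_cp (b i); have nj := nsq_cp (b j).
move: hri hrj hz hg ni nj; rewrite /rd /p /dot /nsq.
case: (cp (b i)) (cp (b j)) z => [a1 a2] [c1 c2] [x y] /=.
move=> h1 h2 h3 h4 h5 h6.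
have := sqr_ge0 (2 * x - a1 - c1); have := sqr_ge0 (2 * y - a2 - c2); nra.
Qed.

Variable e : R.
Hypothesis e01 : 0 < e <= 1.
Hypothesis ecos : cos (2 * pi * del) <= 1 - e.
Hypothesis esep : forall i j z, (i < d)%N -> (j < d)%N -> nsq z <= 1 -> rd i z < e -> rd j z < e -> i = j.

(* [slope i z] in [0, 1] is the relative position of [z] on the chord
   [p i = const], so that [angle] lays the caps [height i < e] side by side as [d]
   sectors of a disc around the origin. *)
Definition slope i z := (1 - sn i z / Num.sqrt (1 - p i z ^+ 2)) / 2.
Definition angle i z := (i%:R + slope i z) / d%:R.

(* Multiplying by [bump] instead of [height i] makes [chart] continuous on the
   whole plane; they agree where [height i <= e / 2]. *)
Definition bump (r : R) := Num.max 0 (Num.min r (e - r)).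

Lemma bump_small r : 0 <= r <= e / 2 -> bump r = r.
Proof.
move=> /andP[r0 r1]; rewrite /bump (min_idPl _); last lra.
by rewrite (max_idPr _).
Qed.

Lemma bump_big r : e <= r -> bump r = 0.
Proof. by move=> h; rewrite /bump (max_idPl _) // ge_min; apply/orP; right; lra. Qed.

Lemma bump_neg r : r <= 0 -> bump r = 0.
Proof. by move=> h; rewrite /bump (max_idPl _) // ge_min h. Qed.

(** On the disc the caps are disjoint and at most one summand is nonzero: the value is [height i] on
    cap [i] and [e] off the caps. The sum makes it visibly continuous on the plane. *)
Definition radius z := e - \sum_(i <- iota 0 d) Num.max 0 (e - rd i z).
Definition chart z : R * R :=
  (\sum_(i <- iota 0 d) bump (rd i z) * (cp (angle i z)).1,
   \sum_(i <- iota 0 d) bump (rd i z) * (cp (angle i z)).2).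

Lemma sum_cap (F : nat -> R) i : (i < d)%N -> (forall j, (j < d)%N -> j != i -> F j = 0) ->
  \sum_(j <- iota 0 d) F j = F i.
Proof.
move=> hi h; rewrite (bigD1_seq i) ?mem_iota ?iota_uniq //=.
rewrite big_seq_cond big1 ?addr0 // => j; rewrite mem_iota => /andP[/andP[_ hj]] ne.
exact: h.
Qed.

Lemma sum_out (F : nat -> R) : (forall j, (j < d)%N -> F j = 0) -> \sum_(j <- iota 0 d) F j = 0.
Proof. by move=> h; rewrite big_seq big1 // => j; rewrite mem_iota => /andP[_ hj]; exact: h. Qed.

Lemma other_cap i j z : (i < d)%N -> (j < d)%N -> nsq z <= 1 -> rd i z < e -> j != i -> e <= rd j z.
Proof.
by move=> hi hj hz hr ne; rewrite leNgt; apply: contraNN ne => hr'; apply/eqP/(esep hj hi hz).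
Qed.

Lemma radius_cap i z : (i < d)%N -> nsq z <= 1 -> rd i z < e -> radius z = rd i z.
Proof.
move=> hi hz hr; rewrite /radius (@sum_cap _ i) //.
  by rewrite (max_idPr _) ?subr_ge0 ?ltW // subKr.
by move=> j hj ne; apply/max_idPl; rewrite subr_le0; exact: other_cap hr ne.
Qed.

Lemma chart_cap i z : (i < d)%N -> nsq z <= 1 -> rd i z < e ->
  chart z = (bump (rd i z) * (cp (angle i z)).1, bump (rd i z) * (cp (angle i z)).2).
Proof.
by move=> hi hz hr; rewrite /chart !(@sum_cap _ i) // => j hj ne;
  rewrite bump_big ?mul0r //; exact: other_cap hr ne.
Qed.

Lemma radius_out z : (forall i, (i < d)%N -> e <= rd i z) -> radius z = e.
Proof.
by move=> h; rewrite /radius sum_out ?subr0 // => j hj; apply/max_idPl; rewrite subr_le0 h.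
Qed.

Lemma chart_out z : (forall i, (i < d)%N -> e <= rd i z) -> chart z = (0, 0).
Proof. by move=> h; rewrite /chart !sum_out // => j hj; rewrite bump_big ?mul0r ?h. Qed.

Lemma capP z : (exists2 i, (i < d)%N & rd i z < e) \/ (forall i, (i < d)%N -> e <= rd i z).
Proof.
have [h|h] := pselect (exists2 i, (i < d)%N & rd i z < e); [by left | right => i hi].
by rewrite leNgt; apply/negP => hr; apply: h; exists i.
Qed.

(** The number of the ray on which [kappa] puts the point [cp (b i + u)]. *)
Definition side i (u : R) : nat := if 0 <= u then i else (i.+1 %% d)%N.

Lemma side_lt i u : (i < d)%N -> (side i u < d)%N.
Proof. by move=> hi; rewrite /side; case: ifP => // _; rewrite ltn_mod (corner_gt0 C). Qed.

Lemma kappa_arc i u : (i < d)%N -> `|u| < del -> kappa (cp (b i + u)) = ray (side i u) `|u|.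
Proof.
move=> hi hu; rewrite /side; case: ifP => h.
  by rewrite ger0_norm // in hu *; apply: (corner_right C) => //; rewrite h.
have u0 : u < 0 by rewrite ltNge h.
rewrite ltr0_norm // in hu *; rewrite -(corner_left C) ?opprK //.
by rewrite hu andbT; lra.
Qed.

Lemma cap_arc i z : (i < d)%N -> nsq z = 1 -> rd i z < e ->
  exists2 u, `|u| < del & z = cp (b i + u).
Proof.
move=> hi hz hr; apply: (cp_near (corner_del C) hz); apply: le_lt_trans ecos _.
by move: hr; rewrite /rd /p; lra.
Qed.

Lemma height_arc i u : rd i (cp (b i + u)) = 1 - cos (2 * pi * `|u|).
Proof.
rewrite /rd /p dot_cp (addrC (b i)) addrK.
have -> : 2 * pi * `|u| = `|2 * pi * u|; last by rewrite cos_norm.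
by rewrite normrM (ger0_norm (_ : 0 <= 2 * pi)) ?mulr_ge0 ?pi_ge0.
Qed.

Lemma sin_arc u : 0 < u < del -> 0 < sin (2 * pi * u).
Proof.
have /andP[d0 d1] := corner_del C; have pi0 := pi_gt0 R.
by move=> /andP[u0 u1]; apply: sin_gt0_pi; apply/andP; split; nra.
Qed.

(** On the circle [sn] is plus or minus the square root in [slope], so the slope is 0 on the right
    half of the arc and 1 on the left half. These are the two edges of sector [i]; the left edge of
    the last sector is a full turn and agrees with angle 0. *)
Lemma angle_arc i u : (i < d)%N -> 0 < `|u| < del ->
  cp (angle i (cp (b i + u))) = cp ((side i u)%:R / d%:R).
Proof.
move=> hi hu; rewrite /angle /slope /sn /p dot_cp crs_cp (addrC (b i)) addrK -sin2cos2 sqrtr_sqr /side.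
have d0 : d%:R != 0 :> R by rewrite pnatr_eq0 -lt0n (corner_gt0 C).
case: ifP => h.
  rewrite ger0_norm // in hu; have s0 := sin_arc hu.
  by rewrite gtr0_norm // divff ?gt_eqF // subrr mul0r addr0.
have u0 : u < 0 by rewrite ltNge h.
rewrite ltr0_norm // in hu; have := sin_arc hu; rewrite mulrN sinN oppr_gt0 => s0.
rewrite ltr0_norm // invrN mulrN divff ?lt_eqF // opprK.
rewrite (_ : (1 + 1) / 2 = 1); last lra.
move: hi; rewrite leq_eqVlt => /orP[/eqP hd|hd].
  have -> : i%:R + 1 = d%:R :> R by rewrite natr1 hd.
  by rewrite hd modnn mul0r divff // -[1]add0r cpD1.
by rewrite modn_small // natr1.
Qed.

(** Interior points are identified with nothing else. For circle points [corner_sat] yields an arc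
    at the same angular distance, and distinct rays meet only at their origin, so the two angles
    agree as well. Hence [radius] and [chart] descend to the quotient. *)
Lemma cap_sat i z z' : (i < d)%N -> nsq z <= 1 -> nsq z' <= 1 -> kappa z = kappa z' -> rd i z < e ->
  exists j, [/\ (j < d)%N, rd j z' = rd i z & rd i z = 0 \/ cp (angle j z') = cp (angle i z)].
Proof.
move=> hi hz hz' ek hr.
have [l|l] := ltP (nsq z) 1.
  by rewrite -(glue_int glueP l hz' ek); exists i; split => //; right.
have [l'|l'] := ltP (nsq z') 1.
  by rewrite -(glue_int glueP l' hz (esym ek)); exists i; split => //; right.
have z1 : nsq z = 1 by apply/eqP; rewrite eq_le hz.
have z1' : nsq z' = 1 by apply/eqP; rewrite eq_le hz'.
have [u hu eu] := cap_arc hi z1 hr; have [a _ ea] := cp_surj z1'.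
have u0 : 0 <= `|u| < del by rewrite normr_ge0.
have k1 : kappa (cp a) = ray (side i u) `|u| by rewrite ea -ek eu kappa_arc.
have [j [s [hj hs es]]] := corner_sat C (side_lt u hi) u0 k1.
have hs' : `|s| < del by rewrite hs.
have k2 : ray (side i u) `|u| = ray (side j s) `|s| by rewrite -k1 es kappa_arc.
rewrite -ea es eu; exists j; split => //; first by rewrite !height_arc hs.
have [un0|un0] := eqVneq u 0.
  by left; rewrite height_arc un0 normr0 mulr0 cos0 subrr.
right; rewrite !angle_arc //; last 2 first.
- by rewrite normr_gt0 un0.
- by rewrite hs normr_gt0 un0.
have s0 : 0 <= `|s| < del by rewrite normr_ge0.
have [_ [u00|->]] // := corner_ray C (side_lt u hi) (side_lt s hj) u0 s0 k2.
by move/eqP: u00; rewrite normr_eq0 (negbTE un0).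
Qed.

Lemma compat_radius : compat kappa radius.
Proof.
move=> z z' hz hz' ek; have [[i hi hr]|h] := capP z.
  have [j [hj ej _]] := cap_sat hi hz hz' ek hr.
  by rewrite (radius_cap hi hz hr) (radius_cap hj hz') ej.
rewrite (radius_out h); have [[i hi hr]|h'] := capP z'; last by rewrite radius_out.
have [j [hj ej _]] := cap_sat hi hz' hz (esym ek) hr.
by have := h j hj; rewrite ej leNgt hr.
Qed.

Lemma compat_chart : compat kappa chart.
Proof.
move=> z z' hz hz' ek; have [[i hi hr]|h] := capP z.
  have [j [hj ej h]] := cap_sat hi hz hz' ek hr.
  rewrite (chart_cap hi hz hr) (chart_cap hj hz') ej //.
  by case: h => [->|->] //; rewrite bump_neg // !mul0r.
rewrite (chart_out h); have [[i hi hr]|h'] := capP z'; last by rewrite chart_out.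
have [j [hj ej _]] := cap_sat hi hz' hz (esym ek) hr.
by have := h j hj; rewrite ej leNgt hr.
Qed.


Lemma p_continuous i : continuous (p i).
Proof.
move=> z; exact: contD (contM (@cont_cst R (R * R)%type _ z) (@fst_cont R z))
  (contM (@cont_cst R (R * R)%type _ z) (@snd_cont R z)).
Qed.

Lemma sn_continuous i : continuous (sn i).
Proof.
move=> z; exact: contB (contM (@cont_cst R (R * R)%type _ z) (@snd_cont R z))
  (contM (@cont_cst R (R * R)%type _ z) (@fst_cont R z)).
Qed.

Lemma height_continuous i : continuous (rd i).
Proof. by move=> z; exact: contB (@cont_cst R (R * R)%type 1 z) (@p_continuous i z). Qed.

Lemma radius_continuous : continuous radius.
Proof.
move=> z; apply: contB (@cont_cst R (R * R)%type e z) _; apply: cont_sum => i.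
exact: cont_max (@cont_cst R (R * R)%type 0 z)
  (contB (@cont_cst R (R * R)%type e z) (@height_continuous i z)).
Qed.

Lemma bump_continuous : continuous bump.
Proof.
have cid (u : R) : {for u, continuous (fun v : R => v)} by exact: cvg_id.
move=> u; exact: cont_max (@cont_cst R R 0 u) (cont_min (cid u) (contB (@cont_cst R R e u) (cid u))).
Qed.

Lemma angle_continuous i z : 0 < rd i z < e -> {for z, continuous (angle i)}.
Proof.
move=> /andP[r0 r1]; have hp : 1 - p i z ^+ 2 > 0.
  by move: r0 r1 e01; rewrite /rd => r0 r1 /andP[? ?]; nra.
have ck (k : R) : {for z, continuous (fun _ : R * R => k)} by exact: cont_cst.
have cq : {for z, continuous (fun y => Num.sqrt (1 - p i y ^+ 2))}.
  apply: cont_comp; first exact: sqrt_continuous.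
  by apply: contB (ck 1) _; exact: contM (@p_continuous i z) (@p_continuous i z).
have q0 : Num.sqrt (1 - p i z ^+ 2) != 0 by rewrite gt_eqF // sqrtr_gt0.
have cs : {for z, continuous (slope i)}.
  have cs := @cont_div _ _ (sn i) (fun y => Num.sqrt (1 - p i y ^+ 2)) z q0 (@sn_continuous i z) cq.
  exact: contM (contB (ck 1) cs) (ck 2^-1).
exact: contM (contD (ck i%:R) cs) (ck d%:R^-1).
Qed.

Lemma bump_support r : bump r = 0 \/ 0 < r < e.
Proof.
have [h|h] := leP r 0; first by left; exact: bump_neg.
by have [h'|h'] := leP e r; [left; exact: bump_big | right].
Qed.

(** Where [bump] vanishes only the boundedness of cosine and sine is used; elsewhere
    [0 < height i < e] and the angle is continuous. *)
Lemma chart_continuous : continuous chart.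
Proof.
have cb i z : {for z, continuous (fun y => bump (rd i y))}.
  by apply: cont_comp; [exact: bump_continuous | exact: height_continuous].
have tr (f : R -> R) i z : continuous f -> (forall u, `|f u| <= 1) ->
    {for z, continuous (fun y => bump (rd i y) * f (2 * pi * angle i y))}.
  move=> cf fb; have [h|h] := bump_support (rd i z).
    by apply: cont_squeeze => //; exact: cb.
  apply: contM (cb i z) _; apply: cont_comp cf _.
  exact: contM (@cont_cst R (R * R)%type _ z) (angle_continuous h).
move=> z; apply: (@cont_pair _ _ (fun z => \sum_(i <- iota 0 d) bump (rd i z) * (cp (angle i z)).1)
  (fun z => \sum_(i <- iota 0 d) bump (rd i z) * (cp (angle i z)).2)).
- by apply: cont_sum => i; apply: (tr cos); [exact: continuous_cos | exact: cos_max].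
- by apply: cont_sum => i; apply: (tr sin); [exact: continuous_sin | exact: sin_max].
Qed.

Lemma nsq_polar (r u : R) : nsq (r * (cp u).1, r * (cp u).2) = r ^+ 2.
Proof. by rewrite -[RHS]mulr1 -(nsq_cp u) /nsq /=; ring. Qed.

Lemma polar_inj (r s u v : R) : 0 <= r -> 0 <= s ->
  (r * (cp u).1, r * (cp u).2) = (s * (cp v).1, s * (cp v).2) ->
  r = s /\ (r = 0 \/ cp u = cp v).
Proof.
move=> r0 s0 [e1 e2].
have rs : r = s.
  by apply/eqP; rewrite -(eqrXn2 (isT : (0 < 2)%N) r0 s0) -(nsq_polar r u) e1 e2 nsq_polar.
split => //; have [->|rn0] := eqVneq r 0; [by left | right].
by rewrite [cp u]surjective_pairing [cp v]surjective_pairing;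
  congr pair; apply: (mulfI rn0); rewrite ?e1 ?e2 rs.
Qed.

Lemma slope_bounds i z : 0 < rd i z < e -> nsq z <= 1 -> 0 <= slope i z <= 1.
Proof.
move=> /andP[r0 r1] hz; have hp : 1 - p i z ^+ 2 > 0.
  by move: r0 r1 e01; rewrite /rd => r0 r1 /andP[? ?]; nra.
have q0 : 0 < Num.sqrt (1 - p i z ^+ 2) by rewrite sqrtr_gt0.
have : `|sn i z| <= Num.sqrt (1 - p i z ^+ 2).
  by rewrite -sqrtr_sqr; apply: ler_wsqrtr; have := p_sn i z; lra.
rewrite ler_norml => /andP[h1 h2].
have : -1 <= sn i z / Num.sqrt (1 - p i z ^+ 2) by rewrite ler_pdivlMr // mulN1r.
have : sn i z / Num.sqrt (1 - p i z ^+ 2) <= 1 by rewrite ler_pdivrMr // mul1r.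
by rewrite /slope; lra.
Qed.

Lemma sn_slope i z : 0 < rd i z < e -> sn i z = (1 - 2 * slope i z) * Num.sqrt (1 - p i z ^+ 2).
Proof.
move=> /andP[r0 r1]; have hp : 1 - p i z ^+ 2 > 0.
  by move: r0 r1 e01; rewrite /rd => r0 r1 /andP[? ?]; nra.
have q0 : Num.sqrt (1 - p i z ^+ 2) != 0 by rewrite gt_eqF // sqrtr_gt0.
by rewrite /slope; field.
Qed.

Lemma height_sn_inj i z z' : rd i z = rd i z' -> sn i z = sn i z' -> z = z'.
Proof.
move=> h1 h2; apply: (@dot_crs_inj _ (cp (b i))) => //; first exact: nsq_cp.
by move: h1; rewrite /rd /p; lra.
Qed.

Lemma cap_center i z : (i < d)%N -> nsq z <= 1 -> rd i z = 0 -> kappa z = kappa (cp t0).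
Proof.
move=> hi hz h; rewrite -(corner_center C hi); congr kappa.
have p1 : p i z = 1 by move: h; rewrite /rd; lra.
have s0 : sn i z = 0.
  have := p_sn i z; rewrite p1 expr1n => hh.
  by apply/eqP; rewrite -sqrf_eq0 eq_le sqr_ge0 andbT; lra.
apply: (@dot_crs_inj _ (cp (b i))); first exact: nsq_cp.
- by rewrite -/(p i z) p1 dot_cp subrr mulr0 cos0.
- by rewrite -/(sn i z) s0 crs_cp subrr mulr0 sin0.
Qed.

(* Full left slope in one cap and full right slope in the next one: the two
   boundary points that [kappa] identifies. *)
Lemma cap_glue i j z z' : (i < d)%N -> j = (i.+1 %% d)%N -> nsq z <= 1 -> nsq z' <= 1 ->
  0 < rd i z < e -> rd j z' = rd i z -> slope i z = 1 -> slope j z' = 0 -> kappa z = kappa z'.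
Proof.
move=> hi ej hz hz' hr er s1 s0.
have hj : (j < d)%N by rewrite ej ltn_mod (corner_gt0 C).
have hr' : 0 < rd j z' < e by rewrite er.
have hp : 0 < 1 - p i z ^+ 2.
  by move: hr e01; rewrite /rd => /andP[r0 r1] /andP[? ?]; nra.
have ep : p j z' = p i z by move: er; rewrite /rd; lra.
set q := Num.sqrt (1 - p i z ^+ 2).
have q0 : 0 < q by rewrite sqrtr_gt0.
have qq : q ^+ 2 = 1 - p i z ^+ 2 by rewrite sqr_sqrtr // ltW.
have sz : sn i z = - q by rewrite (sn_slope hr) s1 -/q; ring.
have sz' : sn j z' = q by rewrite (sn_slope hr') s0 ep -/q; ring.
have n1 : nsq z = 1 by rewrite -(p_sn i) sz sqrrN qq; ring.
have n1' : nsq z' = 1 by rewrite -(p_sn j) sz' ep qq; ring.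
have /andP[_ hre] := hr; have /andP[_ hre'] := hr'.
have [u hu eu] := cap_arc hi n1 hre; have [v hv ev] := cap_arc hj n1' hre'.
have nu : u < 0.
  rewrite ltNge le_eqVlt; apply/negP => /orP[/eqP u0|u0].
    by move: sz; rewrite /sn eu -u0 addr0 crs_cp subrr mulr0 sin0; lra.
  have := @sin_arc u; rewrite u0 -[X in X < del](gtr0_norm u0) hu => /(_ isT).
  by move: sz; rewrite /sn eu crs_cp (addrC (b i)) addrK; lra.
have pv : 0 < v.
  rewrite ltNge le_eqVlt; apply/negP => /orP[/eqP v0|v0].
    by move: sz'; rewrite /sn ev v0 addr0 crs_cp subrr mulr0 sin0; lra.
  have := @sin_arc (- v); rewrite oppr_gt0 v0 -[X in X < del](ltr0_norm v0) hv => /(_ isT).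
  by rewrite mulrN sinN; move: sz'; rewrite /sn ev crs_cp (addrC (b j)) addrK; lra.
have euv : u = - v.
  have : cos (2 * pi * `|u|) = cos (2 * pi * `|v|).
    by move: er; rewrite eu ev !height_arc; lra.
  have /andP[d0 d1] := corner_del C; have pi0 := pi_gt0 R.
  move/cos_inj; rewrite !in_itv /= => h.
  have : 2 * pi * `|u| = 2 * pi * `|v|.
    by apply: h; apply/andP; split; rewrite ?mulr_ge0 ?pi_ge0 //; nra.
  have p0 : 2 * pi != 0 :> R by rewrite gt_eqF // mulr_gt0.
  by move/(mulfI p0); rewrite ltr0_norm // gtr0_norm //; lra.
by rewrite eu ev !kappa_arc // /side (ltW pv) leNgt nu /= -ej euv normrN.
Qed.

Lemma angleE i z : i%:R + slope i z = d%:R * angle i z.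
Proof. by rewrite /angle mulrC divfK // pnatr_eq0 -lt0n (corner_gt0 C). Qed.

(** With slopes in [[0, 1]], [i + slope = j + slope'] leaves two cases: the same sector with the
    same slope, where height and slope determine the point, or neighbouring sectors meeting with
    slopes 1 and 0. *)
Lemma same_angle i j z z' : (i < d)%N -> (j < d)%N -> nsq z <= 1 -> nsq z' <= 1 ->
    0 < rd i z < e -> rd i z = rd j z' -> 0 <= slope i z <= 1 -> 0 <= slope j z' <= 1 ->
    angle i z = angle j z' -> kappa z = kappa z'.
Proof.
move=> hi hj hz hz' hr er si sj ea.
have {}ea : i%:R + slope i z = j%:R + slope j z' by rewrite !angleE ea.
wlog ij : i j z z' hi hj hz hz' hr er si sj ea / (i <= j)%N.
  move=> h; have [l|/ltnW l] := leqP i j; first exact: (h i j).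
  by apply/esym/(h j i) => //; rewrite -er.
move: ij; rewrite leq_eqVlt => /orP[/eqP eij|ij].
  congr kappa; subst j; apply: (@height_sn_inj i) => //.
  have hr2 : 0 < rd i z' < e by rewrite -er.
  rewrite (sn_slope hr) (sn_slope hr2).
  have -> : slope i z = slope i z' by lra.
  by have -> : p i z = p i z' by move: er; rewrite /rd; lra.
have hij : i%:R + 1 <= j%:R :> R by rewrite natr1 ler_nat.
have eij : j = i.+1 by apply/eqP; rewrite eqn_leq ij andbT -(ler_nat R) -natr1; lra.
have ej : j%:R = i%:R + 1 :> R by rewrite eij natr1.
apply: (@cap_glue i j) => //; last 2 first.
- by lra.
- by lra.
by rewrite eij modn_small // -eij.
Qed.

(** Angle 1 occurs only at slope 1 of the last sector and angle 0 only at slope 0 of sector 0: the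
    same meeting of neighbours, across the full turn. *)
Lemma wrap_angle i j z z' : (i < d)%N -> (j < d)%N -> nsq z <= 1 -> nsq z' <= 1 ->
    0 < rd i z < e -> rd i z = rd j z' -> 0 <= slope i z <= 1 -> 0 <= slope j z' <= 1 ->
    angle i z = 1 -> angle j z' = 0 -> kappa z = kappa z'.
Proof.
move=> hi hj hz hz' hr er si sj ai aj.
have := angleE i z; have := angleE j z'; rewrite ai aj mulr0 mulr1 => ej ei.
have hi1 : i%:R + 1 <= d%:R :> R by rewrite natr1 ler_nat.
have ed : i.+1 = d by apply/eqP; rewrite eqn_leq hi -(ler_nat R) -natr1 /=; lra.
have j0 : j = 0%N.
  by apply/eqP; rewrite -(eqr_nat R) eq_le ler0n andbT; lra.
apply: (@cap_glue i j) => //.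
- by rewrite ed modnn.
- by have : d%:R = i%:R + 1 :> R; [rewrite -ed natr1 | lra].
- by have : j%:R = 0 :> R; [rewrite j0 | lra].
Qed.

Lemma chart_inj z z' : nsq z <= 1 -> nsq z' <= 1 -> radius z <= e / 2 -> radius z' <= e / 2 ->
  chart z = chart z' -> kappa z = kappa z'.
Proof.
have /andP[e0 e1] := e01.
have cap w : radius w <= e / 2 -> exists2 i, (i < d)%N & rd i w < e.
  by have [//|h] := capP w; rewrite (radius_out h); lra.
move=> hz hz' /[dup] /cap[i hi hr] rz /[dup] /cap[j hj hr'] rz'.
rewrite (radius_cap hi hz hr) in rz; rewrite (radius_cap hj hz' hr') in rz'.
have r0 := height_ge0 i hz; have r0' := height_ge0 j hz'.
rewrite (chart_cap hi hz hr) (chart_cap hj hz' hr') !bump_small ?r0 ?r0' //.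
case/(polar_inj r0 r0') => er [r00|].
  by rewrite (cap_center hi hz r00) (cap_center hj hz') // -er.
have [r00|rn0] := eqVneq (rd i z) 0.
  by rewrite (cap_center hi hz r00) (cap_center hj hz') // -er.
have ri : 0 < rd i z < e by rewrite hr andbT lt_def rn0.
have rj : 0 < rd j z' < e by rewrite -er.
have si := slope_bounds ri hz; have sj := slope_bounds rj hz'.
have d0 : 0 < d%:R :> R by rewrite ltr0n (corner_gt0 C).
have bound k w : (k < d)%N -> 0 <= slope k w <= 1 -> 0 <= angle k w <= 1.
  move=> hk /andP[s0 s1]; have hk1 : k%:R + 1 <= d%:R :> R by rewrite natr1 ler_nat.
  by rewrite /angle divr_ge0 ?addr_ge0 ?ler0n //= ler_pdivrMr // mul1r; lra.
have bi := bound i z hi si; have bj := bound j z' hj sj.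
(* Angles lie in [[0, 1]], where [cp] identifies only 0 and 1. *)
move=> ecp; have [a1|a1] := eqVneq (angle i z) 1; have [a1'|a1'] := eqVneq (angle j z') 1.
- by apply: (@same_angle i j) => //; rewrite a1 a1'.
- by apply: (@wrap_angle i j) => //; apply: cp_inj; [lra | lra | rewrite -ecp a1 -[1]add0r cpD1].
- apply/esym/(@wrap_angle j i) => //; rewrite -?er //.
  by apply: cp_inj; [lra | lra | rewrite ecp a1' -[1]add0r cpD1].
- apply: (@same_angle i j) => //; apply: cp_inj => //.
  + by move: bi; rewrite [_ <= 1]le_eqVlt (negbTE a1).
  + by move: bj; rewrite [_ <= 1]le_eqVlt (negbTE a1').
Qed.

Lemma dot_crs_basis (u : R * R) x y : nsq u = 1 ->
  let z := (x * u.1 - y * u.2, x * u.2 + y * u.1) in dot u z = x /\ crs u z = y.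
Proof.
case: u => a c; rewrite /nsq /dot /crs /= => h; split.
- by transitivity (x * (a ^+ 2 + c ^+ 2)); [ring | rewrite h mulr1].
- by transitivity (y * (a ^+ 2 + c ^+ 2)); [ring | rewrite h mulr1].
Qed.

Lemma chart_onto w c : 0 < c <= e / 2 -> nsq w < c ^+ 2 ->
  exists z, [/\ nsq z <= 1, radius z < c & chart z = w].
Proof.
move=> hc hw; have /andP[e0 e1] := e01.
set r := Num.sqrt (nsq w).
have r0 : 0 <= r by exact: sqrtr_ge0.
have rr : r ^+ 2 = nsq w by rewrite sqr_sqrtr ?nsq_ge0.
have rc : r < c by nra.
have [rz|rn0] := eqVneq r 0.
  have w0 : w = (0, 0).
    have := rr; rewrite rz expr0n /=; case: (w) => x y; rewrite /nsq /= => /esym/eqP.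
    by rewrite paddr_eq0 ?sqr_ge0 // !expf_eq0 /= => /andP[/eqP -> /eqP ->].
  have d0 := corner_gt0 C.
  have h0 : rd 0 (cp (b 0)) = 0 by rewrite /rd /p dot_cp subrr mulr0 cos0 subrr.
  have n1 : nsq (cp (b 0)) <= 1 by rewrite nsq_cp.
  have r0e : rd 0 (cp (b 0)) < e by rewrite h0.
  exists (cp (b 0)); rewrite (radius_cap d0 n1 r0e) (chart_cap d0 n1 r0e) h0.
  split => //; first by case/andP: hc.
  by rewrite bump_neg // !mul0r w0.
have rp : 0 < r by rewrite lt_def rn0.
have [t ht et] : exists2 t, 0 <= t < 1 & cp t = (w.1 / r, w.2 / r).
  by apply: cp_surj; rewrite nsq_scale -rr divff // sqrf_eq0.
have d0 : 0 < d%:R :> R by rewrite ltr0n (corner_gt0 C).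
(* [t * d] splits into the number of the sector and the slope [a]; the point is then rebuilt from
   its height [r] and from [a], inverting the formula for [slope]. *)
pose i := Num.truncn (t * d%:R).
have /andP[i0 i1] : i%:R <= t * d%:R < i.+1%:R.
  by apply: Num.Theory.truncn_itv; apply: mulr_ge0; lra.
have hi : (i < d)%N by rewrite -(ltr_nat R); apply: le_lt_trans i0 _; rewrite gtr_pMl //; lra.
pose a := t * d%:R - i%:R.
have a01 : 0 <= a <= 1 by move: i1; rewrite -natr1 /a; lra.
pose pz := 1 - r; pose q := Num.sqrt (1 - pz ^+ 2); pose s := (1 - 2 * a) * q.
have hq : 0 < 1 - pz ^+ 2 by rewrite /pz; nra.
have q0 : 0 < q by rewrite sqrtr_gt0.
have qq : q ^+ 2 = 1 - pz ^+ 2 by rewrite sqr_sqrtr // ltW.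
pose z := (pz * (cp (b i)).1 - s * (cp (b i)).2, pz * (cp (b i)).2 + s * (cp (b i)).1).
have [epz esz] : p i z = pz /\ sn i z = s by apply: dot_crs_basis; exact: nsq_cp.
have hz : nsq z <= 1.
  rewrite -(p_sn i) epz esz /s exprMn qq.
  have : (1 - 2 * a) ^+ 2 <= 1 by nra.
  have := sqr_ge0 (1 - 2 * a); nra.
have er : rd i z = r by rewrite /rd epz /pz; ring.
have re : rd i z < e by rewrite er; lra.
exists z; split => //; first by rewrite (radius_cap hi hz re) er.
rewrite (chart_cap hi hz re) er bump_small; last lra.
have -> : angle i z = t.
  rewrite /angle /slope epz esz -/q /s mulfK ?gt_eqF //.
  by rewrite (_ : i%:R + _ = t * d%:R) ?mulfK ?gt_eqF // /a; lra.
by rewrite et /= ![r * _]mulrC !divfK //; case: (w).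
Qed.

(** [radius] vanishes only at the centres of the caps, which are all the same point of the quotient;
    so the function that bounds the chart domain also separates this point from every other. *)
Lemma boundary_chart_eps :
  (exists (U : set M) (h : M -> R * R),
    [/\ open U /\ U (kappa (cp t0)), {within U, continuous h}, set_inj U h &
        forall O : set M, open O -> O `<=` U -> open (h @` O)]) /\
  forall m, m <> kappa (cp t0) ->
    exists2 f : M -> R * R, continuous f & f (kappa (cp t0)) <> f m.
Proof.
have /andP[e0 e1] := e01; have d0 := corner_gt0 C.
have nb : nsq (cp (b 0)) <= 1 by rewrite nsq_cp.
have h0 : rd 0 (cp (b 0)) = 0 by rewrite /rd /p dot_cp subrr mulr0 cos0 subrr.
have rep0 : radius (rep glueP (kappa (cp t0))) = 0.
  rewrite -(corner_center C d0) (lift_kappa glueP compat_radius nb).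
  by rewrite (radius_cap d0 nb) h0.
have cr := @lift_continuous _ _ _ glueP _ _ compat_radius radius_continuous.
have cc := @lift_continuous _ _ _ glueP _ _ compat_chart chart_continuous.
split; last first.
  move=> m ne; exists (fun m => (radius (rep glueP m), 0)).
    move=> m'; exact: (@cont_pair R M (fun m => radius (rep glueP m)) (fun=> 0) m' (cr m') (@cont_cst R M 0 m')).
  rewrite rep0 => -[] /esym h; apply: ne; rewrite -(kappa_rep glueP m).
  have hm := nsq_rep glueP m.
  have [[i hi hr]|h'] := capP (rep glueP m).
    by apply: (cap_center hi hm); rewrite -(radius_cap hi hm hr).
  by exfalso; move: h; rewrite (radius_out h'); lra.
apply: (@chart_of_functions R M (radius \o rep glueP) (chart \o rep glueP) (e / 2)) => //.
- exact: glued_compact.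
- by rewrite /= rep0; lra.
- move=> m m' /set_mem /= hm /set_mem /= hm' ec.
  by rewrite -(kappa_rep glueP m) -(kappa_rep glueP m'); apply: chart_inj => //; exact: nsq_rep.
- rewrite (_ : _ @` _ = [set w | nsq w < (e / 2) ^+ 2]); first exact: open_ball_nsq.
  apply/seteqP; split => [_ [m /= hm <-]|w /= hw].
    have hn := nsq_rep glueP m; have [[i hi hr]|h'] := capP (rep glueP m); last first.
      by exfalso; move: hm; rewrite (radius_out h'); lra.
    move: hm; rewrite (radius_cap hi hn hr) (chart_cap hi hn hr) => hm.
    have r0 := height_ge0 i hn; rewrite /= nsq_polar bump_small; last by rewrite r0 ltW.
    by rewrite ltr_sqr ?nnegrE //; lra.
  have [|z [hz hr ez]] := @chart_onto w (e / 2) _ hw; first lra.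
  exists (kappa z); rewrite /= lift_kappa //.
  - exact: compat_radius.
  - exact: compat_chart.
Qed.

End BoundaryChart.

(** * A glued disc is a closed surface *)

Section GluedSurface.
Variables (R : realType) (T : Type) (kappa : R * R -> T).
Local Open Scope ring_scope.
Hypothesis glueP : disc_gluing kappa.

Theorem glued_surface : closed_surface R (glued kappa).
Proof.
have bd z : nsq z = 1 -> exists t0, exists d b ray del,
    corner kappa t0 d b ray del /\ z = circle_point t0.
  move=> /cp_surj[t _ <-]; have [d [b [ray [del C]]]] := glue_bd glueP t.
  by exists t, d, b, ray, del.
split; [|exact: glued_compact|exact: glued_connected|].
- apply: (@hausdorff_of_functions R) => x y.
  rewrite -(kappa_rep glueP x) -(kappa_rep glueP y) => ne.
  have hx := nsq_rep glueP x; have hy := nsq_rep glueP y.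
  have [lx|lx] := ltP (nsq (rep glueP x)) 1; last first.
    have [|t0 [d [b [ray [del [C et]]]]]] := bd (rep glueP x); first by apply/eqP; rewrite eq_le hx.
    have [e [E1 E2 E3]] := cap_radius C.
    rewrite et in ne *; have [_ h] := boundary_chart_eps glueP C E1 E2 E3.
    by apply: h => /esym.
  have [ly|ly] := ltP (nsq (rep glueP y)) 1; first exact: separate_interior.
  have [|t0 [d [b [ray [del [C et]]]]]] := bd (rep glueP y); first by apply/eqP; rewrite eq_le hy.
  have [e [E1 E2 E3]] := cap_radius C.
  rewrite et in ne *; have [_ h] := boundary_chart_eps glueP C E1 E2 E3.
  by have [f cf hf] := h _ ne; exists f => // /esym.
- move=> x; rewrite -(kappa_rep glueP x); have hx := nsq_rep glueP x.
  have [lx|lx] := ltP (nsq (rep glueP x)) 1; first exact: interior_chart.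
  have [|t0 [d [b [ray [del [C et]]]]]] := bd (rep glueP x); first by apply/eqP; rewrite eq_le hx.
  have [e [E1 E2 E3]] := cap_radius C.
  by rewrite et; have [h _] := boundary_chart_eps glueP C E1 E2 E3.
Qed.

End GluedSurface.

(** * Darts and rotations at a vertex *)

Definition dart_rev (X : graph) (d : dart X) : dart X := (d.1, ~~ d.2).

Lemma dart_revK X : involutive (@dart_rev X).
Proof. by case=> e s; rewrite /dart_rev /= negbK. Qed.

Lemma dart_rev_neq X (d : dart X) : dart_rev d != d.
Proof. by case: d => e []; rewrite /dart_rev xpair_eqE /= andbF. Qed.

(* [s] lists the darts leaving [v] in the cyclic order in which the corners of
   the polygon [W] meet around [v]. *)
Definition rotation_at (X : graph) (W : seq (dart X)) (v : 'I_(nv X)) (s : seq (dart X)) : Prop :=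
  [/\ uniq s, s != [::], (forall d, (d \in s) = (dart_src d == v)) &
      path.cycle (fun d d' => path.next W (dart_rev d') == d) s].

Lemma cycle_nth (T : Type) (x0 : T) (e : rel T) w j : path.cycle e w -> j < size w ->
  e (nth x0 w j) (nth x0 w (j.+1 %% size w)).
Proof.
case: w => // x w /= /(pathP x0) h hj; have := h j; rewrite size_rcons => /(_ hj).
rewrite -rcons_cons nth_rcons /= hj nth_rcons.
move: hj; rewrite ltnS leq_eqVlt => /orP[/eqP ->|hj]; first by rewrite ltnn eqxx modnn.
by rewrite hj modn_small.
Qed.

(** * Complexes with one 2-cell *)

Section OneFace.
Variables (R : realType) (X : graph) (W : seq (dart X)).
Hypothesis Wclosed : closed_walk W.
Hypothesis Wuniq : uniq W.
Hypothesis Wall : forall d, d \in W.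
Hypothesis Wrot : forall v, exists s, rotation_at W v s.

Local Open Scope ring_scope.
Local Open Scope classical_set_scope.
Local Notation cp := (@circle_point R).

Definition one_face : complex2 := @Complex2 X 1 (fun _ => W) (fun _ => Wclosed).
Local Notation K := one_face.
Local Notation L := (size W).

(** The points are by construction the disjoint union of the open cells, so that part of the CW
    axioms costs nothing; the work lies in the topology. *)
Definition surface_point := {x : cell_point R K | open_cells x}.

Lemma surface_point_inj (x y : surface_point) : sval x = sval y -> x = y.
Proof. by case: x y => [x hx] [y hy] /= e; apply: eq_exist. Qed.

Definition vertex (v : 'I_(nv X)) : surface_point :=
  exist (@open_cells R K) (inl (inl v)) I.

Definition edge_point (e : 'I_(ne X)) (t : R) : surface_point :=
  match pselect (0 < t < 1) with
  | left h => exist (@open_cells R K) (inl (inr (e, t))) h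
  | right _ => if t <= 0 then vertex (src e) else vertex (tgt e)
  end.

Definition dart_point (d : dart X) (t : R) : surface_point :=
  edge_point d.1 (if d.2 then t else 1 - t).

Lemma edge_pointE e t : 0 < t < 1 -> sval (edge_point e t) = inl (inr (e, t)).
Proof. by rewrite /edge_point; case: pselect. Qed.

Lemma edge_point0 e : edge_point e 0 = vertex (src e).
Proof. by rewrite /edge_point; case: pselect => [h|_]; [exfalso; lra | rewrite lexx]. Qed.

Lemma edge_point1 e : edge_point e 1 = vertex (tgt e).
Proof. by rewrite /edge_point; case: pselect => [h|_]; [exfalso; lra | rewrite ler10]. Qed.

Lemma dart_point0 d : dart_point d 0 = vertex (dart_src d).
Proof.
by case: d => e []; rewrite /dart_point /dart_src /= ?subr0 ?edge_point0 ?edge_point1.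
Qed.

Lemma dart_point1 d : dart_point d 1 = vertex (dart_tgt d).
Proof.
by case: d => e []; rewrite /dart_point /dart_tgt /= ?subrr ?edge_point0 ?edge_point1.
Qed.

Lemma dart_point_rev d t : dart_point (dart_rev d) (1 - t) = dart_point d t.
Proof. by case: d => e []; rewrite /dart_point /= ?subKr. Qed.

Lemma vertex_inj v v' : vertex v = vertex v' -> v = v'.
Proof. by case. Qed.

Lemma dart_pointE d t : 0 < t < 1 ->
  sval (dart_point d t) = inl (inr (d.1, if d.2 then t else 1 - t)).
Proof. by move=> h; rewrite /dart_point edge_pointE //; case: (d.2) => //; lra. Qed.

Lemma dart_point_inj d d' t t' : 0 < t < 1 -> 0 <= t' < 1 -> dart_point d t = dart_point d' t' ->
  (d' = d /\ t' = t) \/ (d' = dart_rev d /\ t' = 1 - t).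
Proof.
move=> ht /andP[]; rewrite le_eqVlt => /orP[/eqP <- _|t0 t1].
  by move/(congr1 sval); rewrite dart_point0 dart_pointE.
have ht' : 0 < t' < 1 by rewrite t0.
move/(congr1 sval); rewrite !dart_pointE //.
case: d d' => [e []] [e' []] /= [-> h]; [left|right|right|left]; split => //; lra.
Qed.

Lemma L_gt0 : (0 < L)%N.
Proof. by have /andP[] := Wclosed; rewrite -size_eq0 lt0n. Qed.

Let LR : 0 < L%:R :> R. Proof. by rewrite ltr0n L_gt0. Qed.

Variable d0 : dart X.
Local Notation "W_[ i ]" := (nth d0 W i) (at level 0).
Local Notation pos d := (index d W).

Lemma pos_lt d : (pos d < L)%N.
Proof. by rewrite index_mem. Qed.

Lemma nth_pos d : W_[pos d] = d.
Proof. exact: nth_index. Qed.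

(** Taken of [retr z], so that [polygon_map] factors through the retraction. It is used only for
    [nsq z >= 1], where the angle exists and the default 0 of [xget] is not reached by default. *)
Definition circ_angle (z : R * R) : R := xget 0 [set t | 0 <= t < 1 /\ cp t = retr z].

Definition floor_pos (t : R) : nat := Num.truncn (t * L%:R).

Definition polygon_map (z : R * R) : surface_point :=
  match pselect (nsq z < 1) with
  | left h => exist (@open_cells R K) (inr (ord0, z)) h
  | right _ => let t := circ_angle z in
      dart_point W_[floor_pos t] (t * L%:R - (floor_pos t)%:R)
  end.
Local Notation kappa := polygon_map.

Lemma polygon_int z : nsq z < 1 -> sval (kappa z) = inr (ord0, z).
Proof. by rewrite /kappa; case: pselect. Qed.

Lemma circ_angle_cp t : 0 <= t < 1 -> circ_angle (cp t) = t.
Proof.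
move=> ht; have rt : retr (cp t) = cp t by rewrite retr_disc ?nsq_cp.
have [h1 h2] : [set t' | 0 <= t' < 1 /\ cp t' = retr (cp t)] (circ_angle (cp t)).
  by apply: xgetPex; exists t.
by apply: cp_inj => //; rewrite h2.
Qed.

Lemma polygon_angle t : 0 <= t < 1 ->
  kappa (cp t) = dart_point W_[floor_pos t] (t * L%:R - (floor_pos t)%:R).
Proof.
move=> ht; rewrite /kappa; case: pselect => [h|_]; first by exfalso; move: h; rewrite nsq_cp ltxx.
by rewrite circ_angle_cp.
Qed.

Lemma floor_pos_bounds t : 0 <= t < 1 ->
  (floor_pos t < L)%N /\ 0 <= t * L%:R - (floor_pos t)%:R < 1.
Proof.
move=> /andP[t0 t1]; have := LR => l0.
have /andP[h1 h2] : (floor_pos t)%:R <= t * L%:R < (floor_pos t).+1%:R.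
  by apply: Num.Theory.truncn_itv; apply: mulr_ge0 => //; exact: ltW.
split; last by rewrite -natr1 in h2; lra.
by rewrite -(ltr_nat R); apply: le_lt_trans h1 _; rewrite gtr_pMl.
Qed.

Lemma dart_tgt_pos j : (j < L)%N -> dart_tgt W_[j] = dart_src W_[j.+1 %% L].
Proof. by have /andP[_ hc] := Wclosed; move/(cycle_nth d0 hc)/eqP. Qed.

Lemma polygon_pos j t : (j < L)%N -> 0 <= t <= 1 ->
  kappa (cp ((j%:R + t) / L%:R)) = dart_point W_[j] t.
Proof.
move=> hj /andP[t0]; rewrite le_eqVlt => /orP[/eqP ->|t1]; last first.
  have hj1 : j%:R + 1 <= L%:R :> R by rewrite natr1 ler_nat.
  have e : (j%:R + t) / L%:R * L%:R = j%:R + t by rewrite divfK // gt_eqF // LR.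
  have fe : floor_pos ((j%:R + t) / L%:R) = j.
    by apply: Num.Theory.truncn_def; rewrite e -natr1; lra.
  rewrite polygon_angle; first by rewrite fe e addrC addKr.
  by rewrite divr_ge0 ?addr_ge0 ?ler0n //= ltr_pdivrMr ?LR // mul1r; lra.
rewrite dart_point1 dart_tgt_pos // -dart_point0.
have step i : (i < L)%N -> kappa (cp (i%:R / L%:R)) = dart_point W_[i] 0.
  move=> hi; have e : i%:R / L%:R * L%:R = i%:R :> R by rewrite divfK // gt_eqF // LR.
  have fe : floor_pos (i%:R / L%:R) = i.
    by apply: Num.Theory.truncn_def; rewrite e -natr1; lra.
  rewrite polygon_angle; first by rewrite fe e subrr.
  by rewrite divr_ge0 ?ler0n //= ltr_pdivrMr ?LR // mul1r ltr_nat.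
move: hj; rewrite leq_eqVlt => /orP[/eqP ej|hj].
  rewrite natr1 ej divff ?gt_eqF ?LR // modnn -step ?L_gt0 // mul0r.
  by rewrite -[1]add0r cpD1.
by rewrite natr1 modn_small // step.
Qed.

(** Going back by [t] from the start of [d] is going forward by [1 - t] along its predecessor; if
    [d] is the first dart this needs a full turn. *)
Lemma angle_before d d' t : path.next W d' = d ->
  cp (((pos d)%:R - t) / L%:R) = cp (((pos d')%:R + (1 - t)) / L%:R).
Proof.
move=> en; have hq := pos_lt d'; set q := pos d' in hq *.
have ed : pos d = (q.+1 %% L)%N.
  have -> : d = W_[q.+1 %% L].
    rewrite -en path.next_nth Wall -/q.
    move: hq; rewrite leq_eqVlt => /orP[/eqP eL|hq].
      rewrite eL modnn; case: (W) eL => [|x W'] //= [eL].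
      by rewrite nth_default // eL.
    rewrite modn_small //; case: (W) hq => [|x W'] //= hq.
    exact: set_nth_default.
  by rewrite index_uniq // ltn_mod L_gt0.
rewrite ed; move: (hq); rewrite leq_eqVlt => /orP[/eqP eL|hq1].
  rewrite eL modnn sub0r -cpD1; congr cp.
  have -> : q%:R = L%:R - 1 :> R by rewrite -eL -natr1 addrK.
  by have := LR => l0; field; rewrite gt_eqF.
by rewrite modn_small // -natr1; congr cp; congr (_ / _); lra.
Qed.

Lemma polygon_before d d' t : path.next W d' = d -> 0 <= t <= 1 ->
  kappa (cp (((pos d)%:R - t) / L%:R)) = dart_point (dart_rev d') t.
Proof.
move=> en ht; rewrite (angle_before _ en) polygon_pos ?pos_lt //; last lra.
by rewrite nth_pos -(dart_point_rev d') subKr.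
Qed.

Lemma size_W_ge2 : (1 < L)%N.
Proof.
have h : uniq [:: d0; dart_rev d0] by rewrite /= inE eq_sym dart_rev_neq.
by apply: (uniq_leq_size h) => d _.
Qed.

Lemma frac_pos t : exists a j u, [/\ cp a = cp t, (j < L)%N, 0 <= u < 1, a = (j%:R + u) / L%:R &
  kappa (cp a) = dart_point W_[j] u].
Proof.
have [a ha ea] := cp_frac t; have [hj hu] := floor_pos_bounds ha.
exists a, (floor_pos a), (a * L%:R - (floor_pos a)%:R); split => //.
  by rewrite addrC subrK mulfK // gt_eqF // LR.
exact: polygon_angle.
Qed.

Let Lneq0 : L%:R != 0 :> R. Proof. by rewrite gt_eqF // LR. Qed.

Lemma scale_del (c t : R) : 0 <= t < c / L%:R -> 0 <= L%:R * t < c.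
Proof.
by move=> /andP[t0]; rewrite ltr_pdivlMr ?LR // mulrC => ->; rewrite mulr_ge0 ?ler0n.
Qed.

Lemma pos_shift (x t : R) : x / L%:R + t = (x + L%:R * t) / L%:R.
Proof. by rewrite mulrDl mulrAC mulfV // mul1r. Qed.

Lemma pos_shiftN (x t : R) : x / L%:R - t = (x - L%:R * t) / L%:R.
Proof. by rewrite -mulrN pos_shift. Qed.

Lemma pos_bounds j (u : R) : (j < L)%N -> 0 <= u < 1 -> 0 <= (j%:R + u) / L%:R < 1.
Proof.
move=> hj /andP[u0 u1]; have hj1 : j%:R + 1 <= L%:R :> R by rewrite natr1 ler_nat.
by rewrite divr_ge0 ?addr_ge0 ?ler0n //= ltr_pdivrMr ?LR // mul1r; lra.
Qed.

Lemma pos_frac_inj i j (u v : R) : 0 <= u < 1 -> 0 <= v < 1 -> i%:R + u = j%:R + v -> i = j.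
Proof.
move=> hu hv; wlog ij : i j u v hu hv / (i <= j)%N => [h e|e].
  by have [l|/ltnW l] := leqP i j; [apply: h e | apply/esym/(h _ _ _ _ hv hu l)/esym].
apply/eqP; rewrite eqn_leq ij leqNgt; apply/negP => lt.
by have : i%:R + 1 <= j%:R :> R; [rewrite natr1 ler_nat | lra].
Qed.

(** An interior point of an edge lies exactly twice on the circle: at [u] in a dart and at [1 - u]
    in the reverse dart. The two rays are the two directions along the edge. *)
Lemma edge_corner j u : (j < L)%N -> 0 < u < 1 ->
  exists d b ray del, corner kappa ((j%:R + u) / L%:R) d b ray del.
Proof.
move=> hj hu; set D := W_[j]; set j' := pos (dart_rev D).
have hj' : (j' < L)%N by exact: pos_lt.
have ej' : W_[j'] = dart_rev D by exact: nth_pos.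
have jj' : j <> j'.
  by move=> e; have := dart_rev_neq D; rewrite -ej' -e eqxx.
pose b i : R := if i is 0 then (j%:R + u) / L%:R else (j'%:R + (1 - u)) / L%:R.
pose ray i (t : R) : surface_point := dart_point D (if i is 0 then u + L%:R * t else u - L%:R * t).
(* Keeps both arcs inside the open edge; dividing by [L] turns a length along the edge into an
   angle. *)
pose c := Num.min u (1 - u).
have hc : 0 < c <= 2^-1.
  by rewrite /c lt_min ge_min; apply/andP; split; [lra | case: (lerP u 2^-1) => //=; lra].
have cu : c <= u by rewrite /c ge_min lexx.
have cu' : c <= 1 - u by rewrite /c ge_min lexx orbT.
have L1 : 1 <= L%:R :> R by rewrite ler1n L_gt0.
exists 2%N, b, ray, (c / L%:R); split => //.
- rewrite divr_gt0 ?LR //=; last by case/andP: hc.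
  by rewrite ler_pdivrMr ?LR //; lra.
- case=> [|[]] // _; rewrite /b !polygon_pos //; last 2 first.
  + by lra.
  + by lra.
  by rewrite ej' dart_point_rev.
- case=> [|[|//]] t _ /scale_del ht; rewrite /b /ray pos_shift -addrA polygon_pos //; [lra| |lra].
  by rewrite ej' -(dart_point_rev D); congr dart_point; lra.
- case=> [|[|//]] t _ /scale_del ht; rewrite /b /ray pos_shiftN -addrA polygon_pos //=; [lra| |lra].
  by rewrite ej' -(dart_point_rev D); congr dart_point; lra.
- move=> i k t s hi hk /scale_del ht /scale_del hs; rewrite /ray => e.
  have inj (x y : R) : 0 < x < 1 -> 0 < y < 1 -> dart_point D x = dart_point D y -> x = y.
    move=> hx hy e1; have hy' : 0 <= y < 1 by lra.
    have [[_ ->]//|[e2 _]] := dart_point_inj hx hy' e1.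
    by have := dart_rev_neq D; rewrite -e2 eqxx.
  have Linj (x y : R) : L%:R * x = L%:R * y -> x = y by exact: mulfI.
  case: i k hi hk e => [|[|//]] [|[|//]] _ _ e.
  + have {}e : u + L%:R * t = u + L%:R * s by apply: inj e; lra.
    by split; [apply: Linj; lra | right].
  + have {}e : u + L%:R * t = u - L%:R * s by apply: inj e; lra.
    have t0 : t = 0 by apply: Linj; lra.
    by split; [rewrite t0; apply: Linj; lra | left].
  + have {}e : u - L%:R * t = u + L%:R * s by apply: inj e; lra.
    have t0 : t = 0 by apply: Linj; lra.
    by split; [rewrite t0; apply: Linj; lra | left].
  + have {}e : u - L%:R * t = u - L%:R * s by apply: inj e; lra.
    by split; [apply: Linj; lra | right].
- have ne : cp ((j%:R + u) / L%:R) <> cp ((j'%:R + (1 - u)) / L%:R).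
    move=> /cp_inj h; apply: jj'; apply: (@pos_frac_inj j j' u (1 - u)); [lra | lra |].
    by apply: (mulIf (invr_neq0 Lneq0)); apply: h; apply: pos_bounds => //; lra.
  by case=> [|[|//]] [|[|//]] _ _ // /esym.
- move=> i t a hi /scale_del ht ek.
  move: ek; have [a1 [k1 [v1 [ea1 hk1 hv1 eav1 kv1]]]] := frac_pos a.
  rewrite -ea1 kv1 => ek; rewrite eav1.
  have hw : 0 < (if i is 0 then u + L%:R * t else u - L%:R * t) < 1 by case: i hi {ek} => [|[|//]] _; lra.
  have t0 : 0 <= t by case/andP: ht; rewrite pmulr_rge0 ?LR.
  have [[e1 e2]|[e1 e2]] := dart_point_inj hw hv1 (esym ek).
    have -> : k1 = j by apply/eqP; rewrite -(nth_uniq d0 _ _ Wuniq) // e1.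
    exists 0%N; rewrite e2 /b; case: i hi {ek hw e2} => [|[|//]] _.
      by exists t; rewrite ger0_norm // pos_shift -addrA.
    by exists (- t); rewrite normrN ger0_norm // pos_shiftN -addrA.
  have -> : k1 = j' by apply/eqP; rewrite -(nth_uniq d0 _ _ Wuniq) // e1 ej'.
  exists 1%N; rewrite e2 /b; case: i hi {ek hw e2} => [|[|//]] _.
    by exists (- t); split; rewrite ?normrN ?ger0_norm // pos_shiftN; congr cp; congr (_ / _); lra.
  by exists t; split; rewrite ?ger0_norm // pos_shift; congr cp; congr (_ / _); lra.
Qed.

(** The centres are the starts of the darts leaving the vertex. To the right of the start of [S i]
    lies [S i], to the left its predecessor in the walk, which by the rotation condition is the
    reverse of the next dart of the rotation: exactly the pattern of [corner]. *)
Lemma vertex_corner j : (j < L)%N ->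
  exists d b ray del, corner kappa (j%:R / L%:R) d b ray del.
Proof.
move=> hj; set v := dart_src W_[j]; have [s [su s0 smem scyc]] := Wrot v.
set n := size s; have n0 : (0 < n)%N by rewrite /n lt0n size_eq0.
pose S i := nth d0 s i.
have Sv i : (i < n)%N -> dart_src (S i) = v.
  by move=> hi; apply/eqP; rewrite -smem mem_nth.
pose b i : R := (pos (S i))%:R / L%:R.
pose ray i (t : R) : surface_point := dart_point (S i) (L%:R * t).
have L2 : 2 <= L%:R :> R by rewrite ler_nat size_W_ge2.
have before i t : (i < n)%N -> 0 <= t <= 1 ->
    kappa (cp (((pos (S i))%:R - t) / L%:R)) = dart_point (S (i.+1 %% n)%N) t.
  move=> hi ht; have /eqP en := cycle_nth d0 scyc hi.
  by rewrite (polygon_before en ht) dart_revK.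
have start i : (i < n)%N -> kappa (cp (b i)) = vertex v.
  move=> hi; rewrite /b -[X in X / _]addr0 polygon_pos ?pos_lt //; last lra.
  by rewrite nth_pos dart_point0 Sv.
have jv : kappa (cp (j%:R / L%:R)) = vertex v.
  by rewrite -[X in X / _]addr0 polygon_pos //; [rewrite dart_point0 | lra].
(* Half an edge: otherwise the rays along the two ends of a loop would overlap. *)
exists n, b, ray, (2^-1 / L%:R); split => //.
- rewrite divr_gt0 ?LR //= ler_pdivrMr ?LR //; lra.
- by move=> i hi; rewrite start.
- move=> i t hi /scale_del ht; rewrite /b pos_shift polygon_pos ?pos_lt ?nth_pos //; lra.
- move=> i t hi /scale_del ht; rewrite /b pos_shiftN before //; lra.
- move=> i k t r hi hk /scale_del /andP[t0 t1] /scale_del /andP[r0 r1]; rewrite /ray.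
  have Linj (x y : R) : L%:R * x = L%:R * y -> x = y by exact: mulfI.
  move: t0 r0; rewrite !le_eqVlt => /orP[/eqP t0|t0] /orP[/eqP r0|r0] e.
  + by split; [apply: Linj; lra | left; apply: Linj; lra].
  + have [||[_ e']|[_ e']] := @dart_point_inj (S k) (S i) (L%:R * r) (L%:R * t) _ _ (esym e);
      [lra | lra | by exfalso; lra | by exfalso; lra].
  + have [||[_ e']|[_ e']] := @dart_point_inj (S i) (S k) (L%:R * t) (L%:R * r) _ _ e;
      [lra | lra | by exfalso; lra | by exfalso; lra].
  + have [||[e1 e2]|[e1 e2]] := @dart_point_inj (S i) (S k) (L%:R * t) (L%:R * r) _ _ e;
      [lra | lra | | by exfalso; lra].
    split; first by apply: Linj.
    by right; apply/eqP; rewrite -(nth_uniq d0 _ _ su) // -/(S i) -/(S k) e1.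
- have hb m : 0 <= b m < 1.
    by rewrite /b -[X in X / _]addr0; apply: pos_bounds; [exact: pos_lt | lra].
  move=> i k hi hk /(cp_inj (hb i) (hb k)) /(mulIf (invr_neq0 Lneq0)) /eqP.
  rewrite eqr_nat => /eqP ep; apply/eqP; rewrite -(nth_uniq d0 _ _ su) //.
  by rewrite -/(S i) -/(S k) -(nth_pos (S i)) ep nth_pos.
- move=> i t a hi /scale_del ht.
  have [a1 [k [w [ea1 hk hw eaw kw]]]] := frac_pos a.
  rewrite -ea1 kw eaw /ray => ek.
  have t0 : 0 <= t by case/andP: ht; rewrite pmulr_rge0 ?LR.
  have [tz|tn0] := eqVneq t 0.
    move: ek; rewrite tz mulr0 dart_point0 Sv // => ek.
    have w0 : w = 0.
      apply/eqP; apply: contraT => wn0; have hw' : 0 < w < 1.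
        by case/andP: hw => w0 ->; rewrite lt_def wn0 w0.
      by have := congr1 sval ek; rewrite dart_pointE.
    move: ek; rewrite w0 dart_point0 => /vertex_inj ek.
    have ks : W_[k] \in s by rewrite smem ek.
    exists (index W_[k] s), 0; split; rewrite ?normr0 // ?index_mem //.
    by rewrite /b /S nth_index // index_uniq // !addr0.
  have tp : 0 < L%:R * t < 1.
    by rewrite mulr_gt0 ?LR ?lt_def ?tn0 //=; lra.
  have [[e1 e2]|[e1 e2]] := dart_point_inj tp hw (esym ek).
    exists i, t; split => //; first by rewrite ger0_norm.
    by rewrite /b -e1 index_uniq // e2 pos_shift.
  (* The cyclic predecessor of [i]: a point on the reverse of [S i] lies to the left of the centre
     [b i']. *)
  pose i' := ((i + n.-1) %% n)%N; have hi' : (i' < n)%N by rewrite ltn_mod.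
  have ei : (i'.+1 %% n = i)%N.
    by rewrite /i' -addn1 modnDml -addnA addn1 prednK // modnDr modn_small.
  exists i', (- t); split; rewrite ?normrN ?ger0_norm //.
  have /eqP := cycle_nth d0 scyc hi'; rewrite -/n ei -/(S i) -/(S i') => en.
  by rewrite /b pos_shiftN (angle_before _ en) -e1 index_uniq // e2.
Qed.

Lemma polygon_gluing : disc_gluing kappa.
Proof.
split.
- move=> z; have [h|h] := ltP (nsq z) 1; first by rewrite retr_disc // ltW.
  have n1 : nsq (retr z) = 1.
    rewrite /retr nsq_scale /retr_norm (max_idPr _) ?sqr_sqrtr ?nsq_ge0 //.
      by rewrite divff // gt_eqF // (lt_le_trans ltr01).
    by rewrite -sqrtr1 ler_wsqrtr.
  have ea : circ_angle (retr z) = circ_angle z by rewrite /circ_angle (@retr_disc _ (retr z)) // n1.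
  rewrite /kappa; case: pselect => [h1|_]; first by exfalso; move: h1; rewrite ltNge h.
  by case: pselect => [h1|_]; [exfalso; move: h1; rewrite n1 ltxx | rewrite ea].
- move=> [[[v|[e t]]|[f z]] h].
  + have [s [_ s0 smem _]] := Wrot v; case: s s0 smem => // d s _ smem.
    have dv : dart_src d = v by apply/eqP; rewrite -smem mem_head.
    exists (cp ((pos d)%:R / L%:R)); first by rewrite nsq_cp.
    rewrite -[X in X / _]addr0 polygon_pos ?pos_lt //; last lra.
    by rewrite nth_pos dart_point0 dv; apply: surface_point_inj.
  + have ht : 0 < t < 1 by [].
    exists (cp (((pos (e, true))%:R + t) / L%:R)); first by rewrite nsq_cp.
    rewrite polygon_pos ?pos_lt ?nth_pos //; last lra.
    by apply: surface_point_inj; exact: edge_pointE.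
  + exists z; first exact: ltW.
    by apply: surface_point_inj; rewrite /= polygon_int //; congr (inr (_, _)); rewrite [f]ord1.
- move=> z z' h h' /(congr1 sval); rewrite polygon_int //.
  have [l|l] := ltP (nsq z') 1; first by rewrite polygon_int // => -[].
  have [t ht <-] : exists2 t, 0 <= t < 1 & cp t = z' by apply: cp_surj; apply/eqP; rewrite eq_le h'.
  rewrite polygon_angle // /dart_point /edge_point.
  by case: pselect => // _; case: ifP.
- move=> t; have [a [j [u [ea hj /andP[u0 u1] eau _]]]] := frac_pos t.
  have [d [b [ray [del C]]]] : exists d b ray del, corner kappa a d b ray del.
    rewrite eau; move: u0; rewrite le_eqVlt => /orP[/eqP <-|u0]; last first.
      by apply: edge_corner; rewrite ?u0.
    by rewrite addr0; exact: vertex_corner.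
  by exists d, b, ray, del; case: C => *; split => // i hi; rewrite -ea; auto.
Qed.

Lemma one_face_surface : surface_decomposition R one_face.
Proof.
exists (glued kappa); split; first exact: (glued_surface polygon_gluing).
pose fm (f : 'I_(nf K)) (z : R * R) : glued kappa := kappa z.
exists (vertex : _ -> glued kappa), (edge_point : _ -> _ -> glued kappa), fm.
(* An edge inherits its continuity from the arc of the circle occupied by one of its darts. *)
have cont_edge d : {within `[0, 1], continuous (dart_point d : R -> glued kappa)}.
  have := pos_lt d; set j := pos d => hj.
  apply: (@subspace_eq_continuous R `[0, 1]%classic (glued kappa)
    (fun t => kappa (cp ((j%:R + t) / L%:R))) (dart_point d)).
    move=> t /set_mem; rewrite /= in_itv /= => ht.
    by rewrite polygon_pos // nth_pos.
  apply: continuous_subspaceT => t.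
  apply: (@continuous_comp _ _ _ (fun t : R => cp ((j%:R + t) / L%:R)) (kappa : _ -> glued kappa)).
    have ca : {for t, continuous (fun t : R => 2 * pi * ((j%:R + t) / L%:R))}.
      have cid : {for t, continuous (fun v : R => v)} by exact: cvg_id.
      exact: contM (@cont_cst R R _ t) (contM (contD (@cont_cst R R _ t) cid) (@cont_cst R R _ t)).
    by apply: cont_pair; apply: cont_comp ca; [exact: continuous_cos | exact: continuous_sin].
  exact: kappa_continuous.
split.
- move=> e; split; [exact: (cont_edge (e, true)) | exact: edge_point0 | exact: edge_point1].
- by move=> f; apply: continuous_subspaceT; exact: kappa_continuous.
- move=> f d1 i t hi ht.
  by rewrite /fm polygon_pos // (set_nth_default d0).
- have cellE p : open_cells p -> sval (@cell_map R K (glued kappa) vertex edge_point fm p) = p.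
    case: p => [[v|[e t]]|[f z]] //= h; first exact: edge_pointE.
    by rewrite /fm polygon_int //; congr (inr (_, _)); rewrite [f]ord1.
  split => //.
  + by move=> p p' /set_mem hp /set_mem hp' /(congr1 sval); rewrite !cellE.
  + move=> [p hp] _; exists p => //; apply: surface_point_inj; exact: cellE.
Qed.

End OneFace.

(** * Thickening a graph to a surface *)

Section Thickening.
Variables (X : graph) (H : nat).
Local Notation n := (nv X).
Local Notation m := (ne X).

Lemma edge_of_subproof (q : 'I_(m * H.*2)) : q %/ H.*2 < m.
Proof. by case: q => q /=; case: (posnP H.*2) => [->|h]; [rewrite muln0 | rewrite ltn_divLR]. Qed.

Definition edge_of (q : 'I_(m * H.*2)) : 'I_m := Ordinal (edge_of_subproof q).

(** The hub is the last vertex, so old vertices keep their numbers; the star edges are numbered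
    before the copies, and the copies of an edge are consecutive. This lets nested loops write the
    code in order. *)
Definition thick : graph := @Graph n.+1 (n + m * H.*2)
  (fun i => match fintype.split i with inl _ => ord_max | inr q => widen_ord (leqnSn n) (src (edge_of q)) end)
  (fun i => match fintype.split i with
            | inl v => widen_ord (leqnSn n) v
            | inr q => widen_ord (leqnSn n) (tgt (edge_of q))
            end).

Definition thick_label (k : nat) (g : labelling k X) : labelling k thick :=
  fun i => match fintype.split i with inl _ => 1%g | inr q => g (edge_of q) end.

Definition hub : 'I_(nv thick) := ord_max.
Definition old (v : 'I_n) : 'I_(nv thick) := widen_ord (leqnSn n) v.

Definition star (v : 'I_n) : 'I_(ne thick) := lshift _ v.

Lemma parallel_subproof (e : 'I_m) (c : 'I_H) (b : bool) : e * H.*2 + (c.*2 + b) < m * H.*2.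
Proof.
case: e c => [e he] [c hc] /=; apply: (@leq_trans (e.+1 * H.*2)); last by rewrite leq_mul2r he orbT.
by rewrite mulSn addnC ltn_add2r; case: b; lia.
Qed.

Definition parallel (e : 'I_m) (c : 'I_H) (b : bool) : 'I_(ne thick) :=
  rshift n (Ordinal (parallel_subproof e c b)).

Lemma edge_of_parallel e c b : edge_of (Ordinal (parallel_subproof e c b)) = e.
Proof.
apply: val_inj => /=; have h := ltn_ord c; have h2 : c.*2 + b < H.*2 by case: b; lia.
by rewrite divnMDl ?divn_small ?addn0 //; lia.
Qed.

Lemma src_star v : src (star v) = hub.
Proof. by rewrite /= (unsplitK (inl v)). Qed.

Lemma tgt_star v : tgt (star v) = old v.
Proof. by rewrite /= (unsplitK (inl v)). Qed.

Lemma src_parallel e c b : src (parallel e c b) = old (src e).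
Proof. by rewrite /= (unsplitK (inr _)) edge_of_parallel. Qed.

Lemma tgt_parallel e c b : tgt (parallel e c b) = old (tgt e).
Proof. by rewrite /= (unsplitK (inr _)) edge_of_parallel. Qed.

Lemma parallel_inj e c b e' c' b' : parallel e c b = parallel e' c' b' -> [/\ e = e', c = c' & b = b'].
Proof.
move/rshift_inj => h; have ee : e = e' by rewrite -(edge_of_parallel e c b) h edge_of_parallel.
move: h => /(congr1 val) /=; rewrite ee => /addnI h.
have hb : b = b' by have := congr1 odd h; rewrite !oddD !odd_double; case: (b) (b') => [] [].
by split => //; apply: val_inj; apply: double_inj; apply: (@addIn b); rewrite h hb.
Qed.

Lemma thick_edgeP (i : 'I_(ne thick)) :
  (exists v, i = star v) \/ (exists e c b, i = parallel e c b).
Proof.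
rewrite -(splitK i); case: (fintype.split i) => [v|q]; [by left; exists v | right].
have H0 : 0 < H.*2 by case: q => q; case: (posnP H.*2) => [->|//]; rewrite muln0.
have hr : (q %% H.*2) < H.*2 by rewrite ltn_mod.
have hc : (q %% H.*2)./2 < H by lia.
exists (edge_of q), (Ordinal hc), (odd (q %% H.*2)).
rewrite /parallel /=; congr rshift; apply: val_inj => /=.
by rewrite [_.*2 + _]addnC odd_double_half -divn_eq.
Qed.

(* The half-edge [(s, e, c)] stands for the [c]-th pair of parallel copies of [e],
   seen from the source of [e] if [s] and from its target otherwise. *)
Definition half : Type := (bool * 'I_m * 'I_H)%type.
Definition foot (x : half) : 'I_n := if x.1.1 then src x.1.2 else tgt x.1.2.
Definition side_dart (x : half) (b : bool) : dart thick := (parallel x.1.2 x.2 b, x.1.1).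
Definition mate (x : half) : half := (~~ x.1.1, x.1.2, x.2).

Definition halves : seq half :=
  [seq (p, c) | p <- [seq (s, e) | s <- [:: true; false], e <- enum 'I_m], c <- enum 'I_H].

Definition blocks (v : 'I_n) : seq half := [seq x <- halves | foot x == v].

(** Together, the blocks of [x] and [mate x] traverse both copies once in each direction. A loop has
    both of its blocks at the same vertex. *)
Definition block (x : half) : seq (dart thick) :=
  [:: side_dart x false; dart_rev (side_dart x true)].

Definition segment (v : 'I_n) : seq (dart thick) :=
  (star v, true) :: flatten (map block (blocks v)) ++ [:: (star v, false)].

Definition tour : seq (dart thick) := flatten (map segment (enum 'I_n)).

Lemma halves_uniq : uniq halves.
Proof.
apply: allpairs_uniq; [apply: allpairs_uniq | exact: enum_uniq | by move=> [p c] [p' c']].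
- by [].
- exact: enum_uniq.
- by move=> [p c] [p' c'].
Qed.

Lemma mem_halves x : x \in halves.
Proof.
case: x => [[s e] c]; apply/allpairsP; exists ((s, e), c); split; rewrite ?mem_enum //.
by apply/allpairsP; exists (s, e); split; rewrite ?mem_enum //; case: s.
Qed.

Lemma size_halves : size halves = m * H.*2.
Proof. by rewrite size_allpairs size_allpairs /= !size_enum_ord mul2n -doubleMl doubleMr. Qed.

Lemma mem_blocks v x : (x \in blocks v) = (foot x == v).
Proof. by rewrite mem_filter mem_halves andbT. Qed.

Lemma src_side x b : dart_src (side_dart x b) = old (foot x).
Proof. by case: x => [[[] e] c]; [exact: src_parallel | exact: tgt_parallel]. Qed.

Lemma tgt_side x b : dart_tgt (side_dart x b) = old (foot (mate x)).
Proof. by case: x => [[[] e] c]; [exact: tgt_parallel | exact: src_parallel]. Qed.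

Lemma rev_side x b : dart_rev (side_dart x b) = side_dart (mate x) b.
Proof. by []. Qed.

Lemma mateK : involutive mate.
Proof. by case=> [[s e] c]; rewrite /mate /= negbK. Qed.

Lemma side_inj x b x' b' : side_dart x b = side_dart x' b' -> x = x' /\ b = b'.
Proof.
case: x x' => [[s e] c] [[s' e'] c'] h.
by have := congr1 snd h; have /parallel_inj[/= -> -> ->] := congr1 fst h => /= ->.
Qed.

Lemma star_neq_side v s x b : (star v, s) == side_dart x b = false.
Proof.
apply/eqP => h; have := congr1 (fun d : dart thick => val d.1) h => /= e.
by have := ltn_ord v; rewrite e; lia.
Qed.

Lemma dartP (d : dart thick) :
  (exists v, d = (star v, true)) \/ (exists v, d = (star v, false)) \/ exists x b, d = side_dart x b.
Proof.
case: d => i s; have [[v ->]|[e [c [b ->]]]] := thick_edgeP i.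
  by case: s; [left | right; left]; exists v.
by right; right; exists (s, e, c), b.
Qed.

Lemma mem_tour d : d \in tour.
Proof.
have mt v d' : d' \in segment v -> d' \in tour.
  by move=> h; apply/flattenP; exists (segment v) => //; apply: map_f; rewrite mem_enum.
have [[v ->]|[[v ->]|[x [b ->]]]] := dartP d.
- by apply: (mt v); rewrite inE eqxx.
- by apply: (mt v); rewrite inE mem_cat mem_head !orbT.
- have [y hy] : exists2 y, side_dart x b \in block y & true.
    case: b; last by exists x => //; rewrite inE eqxx.
    by exists (mate x) => //; rewrite /block !inE rev_side mateK eqxx orbT.
  move=> _; apply: (mt (foot y)); rewrite inE mem_cat; apply/orP; right; apply/orP; left.
  by apply/flattenP; exists (block y) => //; apply: map_f; rewrite mem_blocks.
Qed.

Lemma size_flatten_block (s : seq half) : size (flatten (map block s)) = (size s).*2.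
Proof. by elim: s => //= x s ->. Qed.

Lemma size_tour : size tour = (n + m * H.*2).*2.
Proof.
rewrite /tour size_flatten /shape -map_comp sumnE big_map big_enum /=.
under eq_bigr => v _ do rewrite size_cat size_flatten_block addn1.
rewrite (eq_bigr (fun v => 2 + (size (blocks v)).*2)) // big_split /= sum_nat_const card_ord.
rewrite -size_halves doubleD muln2; congr (_ + _).
rewrite -(big_morph double doubleD double0); congr double.
under eq_bigr => v _ do rewrite size_filter -sum1_count big_mkcond /=.
rewrite exchange_big /= -sum1_size; apply: eq_bigr => x _.
by rewrite -big_mkcond /= sum1_card -(card1 (foot x)); apply: eq_card => v; rewrite !inE eq_sym.
Qed.

(** By counting: every dart occurs, and the length is the number of darts. *)
Lemma tour_uniq : uniq tour.
Proof.
apply: (leq_size_uniq (enum_uniq {: 'I_(ne thick) * bool})) => [d _|]; first exact: mem_tour.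
by rewrite size_tour -cardT card_prod card_ord card_bool muln2.
Qed.

Local Notation E := (fun d d' : dart thick => dart_tgt d == dart_src d').

Lemma path_blocks v d s : dart_tgt d = old v -> all (fun x => foot x == v) s ->
  path.path E d (flatten (map block s) ++ [:: (star v, false)]).
Proof.
elim: s d => [|x s IH] d hd /=; first by rewrite hd /dart_src /= (unsplitK (inl v)) eqxx.
case/andP=> /eqP hx hs; rewrite src_side hx hd eqxx rev_side src_side tgt_side eqxx /=.
by apply: IH => //; rewrite tgt_side mateK hx.
Qed.

Lemma path_segments d vs : dart_tgt d = hub ->
  path.path E d (flatten (map segment vs)) /\ dart_tgt (last d (flatten (map segment vs))) = hub.
Proof.
elim: vs d => [|v vs IH] d hd //=.
have hz : dart_tgt (star v, false) = hub by rewrite /dart_tgt /= (unsplitK (inl v)).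
have [h1 h2] := IH (star v, false) hz.
rewrite cat_path !last_cat /= h1 h2 andbT; split => //.
rewrite hd {1}/dart_src /= (unsplitK (inl v)) eqxx /=.
apply: path_blocks; first by rewrite /dart_tgt /= (unsplitK (inl v)).
exact: filter_all.
Qed.

Lemma tour_closed : 0 < n -> closed_walk tour.
Proof.
move=> n0; case e: (enum 'I_n) (size_enum_ord n) => [|v0 vs] /= hs.
  by rewrite -hs in n0.
have hz : dart_tgt (star v0, false) = hub by rewrite /dart_tgt /= (unsplitK (inl v0)).
have [h1 h2] := path_segments (enum 'I_n) hz.
rewrite /closed_walk /tour; move: h1 h2; rewrite e /=.
case/andP => h0 h1 h2; rewrite rcons_path h1 /= h2.
by rewrite /dart_src /= (unsplitK (inl v0)).
Qed.

Lemma holonomy_tour k (g : labelling k X) : holonomy (thick_label g) tour = 1%g.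
Proof.
rewrite /holonomy /tour big_flatten big_map big1_seq // => v _.
have gs w : thick_label g (star w) = 1%g by rewrite /thick_label (unsplitK (inl w)).
have gc e c b : thick_label g (parallel e c b) = g e by rewrite /thick_label (unsplitK (inr _)) edge_of_parallel.
rewrite /segment big_cons big_cat /= big_seq1 /= gs invg1 mulg1 mul1g big_flatten big_map.
rewrite big1_seq // => -[[s e] c] _; rewrite /block !big_cons big_nil /= !gc mulg1.
by case: s; rewrite ?mulgV ?mulVg.
Qed.

(** The darts leaving [v] in the order in which the tour, arriving by the reverse of one, departs by
    the next. This is opposite to the order asked for by [rotation_at], hence the [rev] in the
    end. *)
Definition spin (v : 'I_n) : seq (dart thick) :=
  (star v, false) :: flatten [seq [:: side_dart x false; side_dart x true] | x <- blocks v].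

Lemma tour_next : path.cycle (fun d d' => path.next tour d == d') tour.
Proof. exact: path.cycle_next tour_uniq. Qed.

Local Notation N := (fun d d' : dart thick => path.next tour d == d').

Lemma segment_path v : path.path N (star v, true) (flatten (map block (blocks v)) ++ [:: (star v, false)]).
Proof.
have hp : path.sorted N tour.
  by have := tour_next; case: (tour) => //= d w; rewrite rcons_path => /andP[].
have /splitPr vin : v \in enum 'I_n by rewrite mem_enum.
move: hp; rewrite /tour; case: vin => a b; rewrite map_cat flatten_cat /=.
set A := flatten (map segment a); set B := flatten (map segment b).
rewrite -cat_cons; case: A => [|d A] /=.
  by rewrite cat_path => /andP[].
by rewrite cat_path /= cat_path => /and3P[_ _ /andP[]].
Qed.

(** These are the two darts of [block (mate x)], which meet at the foot of [x]. This corner links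
    the two copies of a pair there, while the corners between successive blocks link one pair to the
    next: all corners at a vertex form one cycle. *)
Lemma mate_next x : N (side_dart (mate x) false) (side_dart x true).
Proof.
have := segment_path (foot (mate x)).
have /splitPr xin : mate x \in blocks (foot (mate x)) by rewrite mem_blocks.
case: xin => a b; rewrite map_cat flatten_cat /= -catA cat_path => /andP[_] /=.
by rewrite rev_side mateK => /and3P[].
Qed.

Lemma spin_path z y s : path.path N (dart_rev y) (flatten (map block s) ++ [:: z]) ->
  path.path (fun d d' => N (dart_rev d) d') y
    (flatten [seq [:: side_dart x false; side_dart x true] | x <- s] ++ [:: z]).
Proof.
elim: s y => [|x s IH] y //=; case/and3P => h1 h2 h3.
by rewrite h1 /= mate_next /=; apply: IH.
Qed.

Lemma spin_cycle v : path.cycle (fun d d' => N (dart_rev d) d') (spin v).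
Proof. by rewrite /= -cats1; apply: spin_path; exact: segment_path. Qed.

Lemma star_notin_sides v s B :
  (star v, s) \in flatten [seq [:: side_dart x false; side_dart x true] | x <- B] = false.
Proof.
by apply/negbTE/flattenP => -[_ /mapP[x _ ->]]; rewrite !inE !star_neq_side.
Qed.

Lemma mem_sides x b B :
  (side_dart x b \in flatten [seq [:: side_dart x false; side_dart x true] | x <- B]) = (x \in B).
Proof.
apply/flattenP/idP => [[_ /mapP[y hy ->]]|hx].
  by rewrite !inE => /orP[] /eqP/side_inj[-> _].
exists [:: side_dart x false; side_dart x true]; first exact: (map_f (fun x => [:: _; _])).
by rewrite !inE; case: b; rewrite eqxx ?orbT.
Qed.

Lemma spin_uniq v : uniq (spin v).
Proof.
rewrite cons_uniq star_notin_sides /=.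
have -> : flatten [seq [:: side_dart x false; side_dart x true] | x <- blocks v] =
  [seq side_dart x b | x <- blocks v, b <- [:: false; true]] by [].
apply: allpairs_uniq; [by rewrite filter_uniq ?halves_uniq | by [] |].
by move=> [x b] [x' b'] _ _ /side_inj[-> ->].
Qed.

Lemma mem_spin v d : (d \in spin v) = (dart_src d == old v).
Proof.
have old_inj : injective old by move=> a b /(congr1 val) /= h; apply: val_inj.
rewrite inE; have [[w ->]|[[w ->]|[x [b ->]]]] := dartP d.
- have -> : (star w, true) == (star v, false) = false by rewrite xpair_eqE andbF.
  by rewrite star_notin_sides /dart_src src_star -val_eqE /= gtn_eqF.
- have -> : dart_src (star w, false) = old w by exact: tgt_star.
  rewrite star_notin_sides orbF xpair_eqE andbT (inj_eq old_inj).
  exact: (inj_eq (@lshift_inj _ _)).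
- by rewrite eq_sym star_neq_side mem_sides mem_blocks src_side (inj_eq old_inj).
Qed.

Lemma hub_path z c vs : path.path N z (flatten (map segment vs) ++ [:: c]) ->
  path.path (fun d d' => N (dart_rev d) d') (dart_rev z) ([seq (star v, true) | v <- vs] ++ [:: c]).
Proof.
elim: vs z => [|v vs IH] z /=; first by rewrite dart_revK.
case/andP=> h; rewrite -!catA cat_path => /andP[_ /= /andP[_ /IH h2]].
by rewrite dart_revK h h2.
Qed.

(** The tour enters the hub along one star edge and leaves it along that of the next vertex, so the
    star darts follow each other in the order of enumeration. *)
Lemma hub_rotation : 0 < n -> rotation_at tour hub (rev [seq (star v, true) | v <- enum 'I_n]).
Proof.
move=> n0; set s := [seq _ | v <- _].
split.
- by rewrite rev_uniq map_inj_uniq ?enum_uniq // => v w [e]; apply: val_inj.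
- by rewrite -size_eq0 size_rev size_map size_enum_ord -lt0n.
- move=> d; rewrite mem_rev; have [[w ->]|[[w ->]|[x [b ->]]]] := dartP d.
  + by rewrite map_f ?mem_enum // /dart_src src_star eqxx.
  + have -> : dart_src (star w, false) = old w by exact: tgt_star.
    rewrite -val_eqE /= ltn_eqF //.
    by apply/mapP => -[v _ []].
  + rewrite src_side -val_eqE /= ltn_eqF //.
    by apply/mapP => -[v _ /esym/eqP]; rewrite star_neq_side.
rewrite path.rev_cycle.
have := tour_next; rewrite [X in path.cycle _ X -> _]/tour /s; case e: (enum 'I_n) (size_enum_ord n) => [|v0 vs] /= hs.
  by rewrite -hs in n0.
rewrite -!cats1 -!catA cat_path => /andP[_ /= /andP[_]].
exact: hub_path.
Qed.

Lemma old_rotation v : rotation_at tour (old v) (rev (spin v)).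
Proof.
split.
- by rewrite rev_uniq spin_uniq.
- by rewrite -size_eq0 size_rev.
- by move=> d; rewrite mem_rev mem_spin.
- by rewrite path.rev_cycle; exact: spin_cycle.
Qed.

End Thickening.

(** * The thickened surface and its optimum *)

Section ThickSurface.
Variables (R : realType) (X : graph) (H : nat).

Lemma thick_surface (n0 : 0 < nv X) : surface_decomposition R (one_face (tour_closed H n0)).
Proof.
apply: one_face_surface.
- exact: tour_uniq.
- exact: mem_tour.
- move=> i; have [hi|hi] := ltnP i (nv X).
    have -> : i = old H (Ordinal hi) by apply: val_inj.
    by exists (rev (spin H (Ordinal hi))); exact: old_rotation.
  have -> : i = hub X H by apply: val_inj; apply/eqP; rewrite eqn_leq hi -ltnS ltn_ord.
  by exists (rev [seq (star H v, true) | v <- enum 'I_(nv X)]); exact: hub_rotation.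
- exact: (star H (Ordinal n0), true).
Qed.

Lemma sum_div p q (F : nat -> nat) :
  \sum_(0 <= i < q * p) F (i %/ p) = p * \sum_(0 <= e < q) F e.
Proof.
elim: q => [|q IH]; first by rewrite mul0n !big_geq // muln0.
rewrite big_nat_recr //= mulnDr -IH mulSn addnC (@big_cat_nat _ _ _ (q * p)) ?leq_addr //=.
congr (_ + _); rewrite -{1}[q * p]add0n big_addn addKn.
rewrite (eq_big_nat _ _ (F2 := fun=> F q)); first by rewrite sum_nat_const_nat subn0.
move=> i /andP[_ hi]; congr F; have p0 : 0 < p by apply: leq_trans hi.
by rewrite addnC divnMDl // divn_small // addn0.
Qed.

Variables (k : nat) (g : labelling k X).
Local Notation n := (nv X).
Local Notation m := (ne X).

Lemma sum_edge_of (P : pred 'I_m) :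
  \sum_(q < m * H.*2) P (edge_of q) = H.*2 * \sum_(e < m) P e.
Proof.
pose F (e : nat) : nat := if insub e is Some e' then P e' else 0.
have -> : \sum_(e < m) P e = \sum_(0 <= e < m) F e.
  by rewrite big_mkord; apply: eq_bigr => e _; rewrite /F valK.
rewrite -sum_div big_mkord; apply: eq_bigr => q _.
by rewrite /F -[_ %/ _]/(val (edge_of q)) valK.
Qed.

Definition restrict (x : {ffun 'I_(nv (thick X H)) -> 'I_k}) : {ffun 'I_n -> 'I_k} :=
  [ffun v => x (old H v)].

(** The witness [a] counts the satisfied star edges; each satisfied edge of [X] is counted once for
    every copy. *)
Lemma card_section_thick x : exists2 a, a <= n &
  #|section_edges (@thick_label X H k g) x| = a + H.*2 * #|section_edges g (restrict x)|.
Proof.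
pose P (i : 'I_(ne (thick X H))) : bool := @thick_label X H k g i (x (src i)) == x (tgt i).
exists (\sum_(v < n) P (star H v)).
  rewrite -[leqRHS]card_ord -sum1_card; apply: leq_sum => v _; exact: leq_b1.
have cardE (T : finType) (Q : pred T) : #|[set i | Q i]%SET| = \sum_i Q i.
  by rewrite cardsE -sum1_card big_mkcond.
rewrite /section_edges !cardE -/(P _) big_split_ord /=; congr (_ + _).
rewrite -sum_edge_of; apply: eq_bigr => q _; congr nat_of_bool.
by rewrite /thick_label /= !(unsplitK (inr q)) !ffunE.
Qed.

Definition opt := \max_(x : {ffun 'I_n -> 'I_k}) #|section_edges g x|.
Definition opt_of_thick :=
  \max_(x : {ffun 'I_(nv (thick X H)) -> 'I_k}) #|section_edges (@thick_label X H k g) x|.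

(** Below: an optimal assignment extends to the hub by any label, at worst losing all star edges.
    Above: restriction to the old vertices, with all star edges conceded. *)
Lemma opt_thick : 0 < k -> H.*2 * opt <= opt_of_thick <= n + H.*2 * opt.
Proof.
move=> k0; apply/andP; split; last first.
  apply/bigmax_leqP => x _; have [a ha ->] := card_section_thick x.
  by rewrite leq_add // leq_mul2l (@leq_bigmax _ (fun y => #|section_edges g y|) (restrict x)) orbT.
have c0 : 0 < #|{: {ffun 'I_n -> 'I_k}}| by apply/card_gt0P; exists [ffun=> Ordinal k0].
have [x hx] := @bigop.eq_bigmax _ (fun y => #|section_edges g y|) c0.
pose x' : {ffun 'I_(nv (thick X H)) -> 'I_k} := [ffun i : 'I_n.+1 => if insub (val i) is Some v then x v else Ordinal k0].
have rx : restrict x' = x.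
  by apply/ffunP => v; rewrite !ffunE /= valK.
apply: leq_trans (@leq_bigmax _ (fun y => #|section_edges (@thick_label X H k g) y|) x'); have [a _ ->] := card_section_thick x'.
by rewrite rx /opt hx leq_addl.
Qed.

End ThickSurface.

(** * The loss in the thresholds *)

Section Gap.
Variables (R : realType) (X : graph) (k : nat) (g : labelling k X) (C : nat).
Hypotheses (k0 : 0 < k) (m0 : 0 < ne X).
Local Notation H := (C * nv X).
Local Open Scope ring_scope.

Lemma nv_gt0 : (0 < nv X)%N.
Proof. exact: leq_ltn_trans (leq0n _) (ltn_ord (src (Ordinal m0))). Qed.

(** With [m >= 1] edges, the [n] star edges are at most the fraction [1 / (2 C)] of the [2 C n m]
    copies. *)
Lemma gap_arith (d : R) : (2 * C)%:R^-1 <= d -> (0 < C)%N ->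
  (nv X)%:R <= (ne X)%:R * H.*2%:R * d.
Proof.
move=> hd C0; have c0 : 0 < (2 * C)%:R :> R by rewrite ltr0n muln_gt0.
have -> : H.*2%:R = (2 * C)%:R * (nv X)%:R :> R by rewrite -natrM -mulnA mul2n.
have h1 : 1 <= (2 * C)%:R * d by rewrite -ler_pdivrMl // mulr1.
have -> : (ne X)%:R * ((2 * C)%:R * (nv X)%:R) * d = (2 * C)%:R * d * (ne X)%:R * (nv X)%:R by ring.
by apply: ler_peMl; [exact: ler0n | apply: mulr_ege1; rewrite ?ler1n].
Qed.

Lemma ne_thick : (ne (thick X H))%:R = (nv X)%:R + (ne X)%:R * H.*2%:R :> R.
Proof. by rewrite natrD natrM. Qed.

(** Only the denominator grows, by [n], and [c' n <= n <= (c - c') m 2H]. *)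
Lemma thick_complete (c c' : R) : (0 < C)%N -> (2 * C)%:R^-1 <= c - c' -> c <= 1 ->
  c <= max_section R g -> c' <= max_section R (@thick_label X H k g).
Proof.
move=> C0 hd c1; have hm : 0 < (ne X)%:R :> R by rewrite ltr0n.
have hn : 0 < (nv X)%:R :> R by rewrite ltr0n nv_gt0.
have hN : 0 <= H.*2%:R :> R by rewrite ler0n.
have ga := gap_arith hd C0.
have d0 : 0 < (2 * C)%:R^-1 :> R by rewrite invr_gt0 ltr0n muln_gt0.
rewrite /max_section ne_thick ler_pdivlMr // ler_pdivlMr; last by nra.
have /andP[h _] := opt_thick H g k0; move: h; rewrite -(ler_nat R) natrM => h1 h2.
apply: le_trans h1; apply: le_trans (ler_wpM2l hN h2).
nra.
Qed.

Lemma thick_sound (s s' : R) : (0 < C)%N -> (2 * C)%:R^-1 <= s' - s -> 0 <= s ->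
  max_section R g <= s -> max_section R (@thick_label X H k g) <= s'.
Proof.
move=> C0 hd s0; have hm : 0 < (ne X)%:R :> R by rewrite ltr0n.
have hn : 0 < (nv X)%:R :> R by rewrite ltr0n nv_gt0.
have hN : 0 <= H.*2%:R :> R by rewrite ler0n.
have ga := gap_arith hd C0.
have d0 : 0 < (2 * C)%:R^-1 :> R by rewrite invr_gt0 ltr0n muln_gt0.
rewrite /max_section ne_thick ler_pdivrMr // ler_pdivrMr; last by nra.
have /andP[_ h] := opt_thick H g k0; move: h; rewrite -(ler_nat R) natrD natrM => h1 h2.
apply: (le_trans h1); have h3 := ler_wpM2l hN h2.
have : (nv X)%:R + H.*2%:R * (opt g)%:R <= (nv X)%:R + H.*2%:R * (s * (ne X)%:R) :> R by rewrite lerD2l.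
move/le_trans; apply; nra.
Qed.

End Gap.

(** * The reductions as terms *)

Section TermLibrary.
Implicit Types (env : seq (seq bool)) (x : seq bool).

(** The language has no variables as terms, so a word is copied bit by bit; under the binder of the
    counter, variable [i] has number [i.+1]. *)
Definition Var i : term := For i (Case i.+1 0 (Emit true) (Emit false) Empty).

Lemma den_Var i env : den (Var i) env = nth [::] env i.
Proof.
rewrite /=; set x := nth [::] env i.
transitivity (flatten [seq [:: nth false x c] | c <- iota 0 (size x)]).
  congr flatten; apply/eq_in_map => c; rewrite mem_iota add0n => /andP[_ hc].
  by rewrite size_nseq (nth_map false) //; case: (nth false x c).
by rewrite -[RHS](mkseq_nth false) -[RHS]flatten_seq1 /mkseq -map_comp.
Qed.

Definition Lit (s : seq bool) : term := foldr (fun b t => Cat (Emit b) t) Empty s.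

Lemma den_Lit s env : den (Lit s) env = s.
Proof. by elim: s => //= b s ->. Qed.

Definition Cats (ts : seq term) : term := foldr Cat Empty ts.

Lemma den_Cats ts env : den (Cats ts) env = flatten [seq den t env | t <- ts].
Proof. by elim: ts => //= t ts ->. Qed.

(** The last branch of [Case i j] is taken exactly when word [i] is not longer than word [j]; asking
    both ways tests equality of lengths. *)
Definition IfEq i j t e : term := Case i j e e (Case j i e e t).

Lemma den_IfEq i j t e env :
  den (IfEq i j t e) env =
  if size (nth [::] env i) == size (nth [::] env j) then den t env else den e env.
Proof.
rewrite /=; set x := nth [::] env i; set y := nth [::] env j.
case: (ltngtP (size x) (size y)) => h.
- rewrite nth_default ?size_map 1?ltnW // (nth_map false) //.
  by case: (nth false y _).
- by rewrite (nth_map false) //; case: (nth false x _).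
- by rewrite !nth_default ?size_map ?h.
Qed.

Definition code_nats (l : seq nat) : seq bool := flatten (map code_nat l).

(* The block of ones of variable [i] that is preceded by [size (env_j)] zeros. *)
Definition Field i j : term :=
  For i (Case i.+1 0
    (Let (For 0 (Case i.+2 0 Empty (Emit true) Empty)) (IfEq 0 j.+2 (Emit true) Empty)) Empty Empty).

(** The value of [Field] when [s] zeros have already been read, the generalisation that makes
    recursion on the word possible. *)
Definition ones_after (s r : nat) x : seq bool :=
  flatten [seq (if nth false x c && (s + count negb (take c x) == r) then [:: true] else [::])
          | c <- iota 0 (size x)].

Lemma ones_after_cons s r b x :
  ones_after s r (b :: x) = (if b && (s == r) then [:: true] else [::]) ++ ones_after (s + ~~ b) r x.
Proof.
rewrite /ones_after /= addn0; congr (_ ++ flatten _).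
rewrite -[1]/(1 + 0) iotaDl -map_comp; apply: eq_map => c /=.
by rewrite addnA.
Qed.

Lemma ones_after_code s r a x : ones_after s r (code_nat a ++ x) =
  (if s == r then nseq a true else [::]) ++ ones_after s.+1 r x.
Proof.
elim: a => [|a IH]; rewrite /code_nat /= ones_after_cons /=.
  by rewrite addn1; case: (s == r).
by rewrite addn0 -/(code_nat a) IH; case: (s == r).
Qed.

Lemma ones_after_lt s r x : r < s -> ones_after s r x = [::].
Proof.
elim: x s => [|b x IH] s h //; rewrite ones_after_cons IH; last by lia.
by rewrite gtn_eqF // andbF.
Qed.

Lemma ones_after_nats l s r x : s <= r -> r - s < size l ->
  ones_after s r (code_nats l ++ x) = nseq (nth 0 l (r - s)) true.
Proof.
elim: l s => [|a l IH] s //= h1 h2; rewrite -catA ones_after_code.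
move: h1; rewrite leq_eqVlt => /orP[/eqP ->|h1].
  by rewrite eqxx subnn ones_after_lt // cats0.
rewrite ltn_eqF // IH //; last by lia.
by rewrite -[r - s]prednK ?subn_gt0 //= subnS.
Qed.

Lemma den_Field i j env l x r : nth [::] env i = code_nats l ++ x -> size (nth [::] env j) = r ->
  r < size l -> den (Field i j) env = nseq (nth 0 l r) true.
Proof.
move=> ei ej hr; rewrite -[X in nth 0 l X]subn0 -(@ones_after_nats l 0 r x) ?subn0 // -ei.
rewrite /Field [LHS]/=; congr flatten; apply/eq_in_map => c; rewrite mem_iota add0n => /andP[_ hc].
rewrite size_nseq (nth_map false) //=; case hb: (nth false _ c) => //.
rewrite add0n.
set z := flatten _; have sz : size z = count negb (take c (nth [::] env i)).
  rewrite /z; have := ltnW hc; elim: c {hb hc z} => [|c IH] hc; first by rewrite take0.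
  rewrite flatten_iotaS size_cat IH 1?ltnW // (take_nth false) // -cats1 count_cat /=.
  by rewrite size_nseq (nth_map false) //; case: (nth false _ c).
have := den_IfEq 0 j.+2 (Emit true) Empty (z :: nseq c true :: env).
by rewrite /= => ->; rewrite ej sz.
Qed.

End TermLibrary.

Local Arguments den : simpl never.
Local Arguments wf_term : simpl never.

(** * The two reductions as programs *)

Section Reductions.
Implicit Types (env : seq (seq bool)).

Lemma flatten_cons (T : Type) (u : seq T) uu : flatten (u :: uu) = u ++ flatten uu.
Proof. by []. Qed.

Lemma den_Let t1 t2 env : den (Let t1 t2) env = den t2 (den t1 env :: env).
Proof. by []. Qed.

Lemma den_For i t env : den (For i t) env =
  flatten [seq den t (nseq c true :: env) | c <- iota 0 (size (nth [::] env i))].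
Proof. by []. Qed.

Lemma den_Emit b env : den (Emit b) env = [:: b].
Proof. by []. Qed.

Definition FieldConst i c : term := Let (Lit (nseq c true)) (Field i.+1 0).

Lemma den_FieldConst i c env l y : nth [::] env i = code_nats l ++ y -> c < size l ->
  den (FieldConst i c) env = nseq (nth 0 l c) true.
Proof.
move=> ei hc; apply: (@den_Field i.+1 0 (den (Lit (nseq c true)) env :: env) l y) => //.
by rewrite /= den_Lit size_nseq.
Qed.

Variable k : nat.

(* Field [r] of the record of edge [size (env_j)] in a code of a labelled graph. *)
Definition Entry i j r : term :=
  Let (Cats (Lit (nseq (2 + r) true) :: nseq k.+2 (Var j))) (Field i.+1 0).

Definition EdgeData i j : term :=
  Cats [seq Cats [:: Entry i j r; Emit false] | r <- iota 0 k.+2].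

(** Rereads exactly the numbers that form the code of the 1-skeleton; the faces that follow are
    dropped. *)
Definition strip : term := Cats [:: FieldConst 0 0; Emit false; FieldConst 0 1; Emit false;
  Let (FieldConst 0 1) (For 0 (EdgeData 2 0))].

(** To be evaluated in the environment [[2H; H; m; n; x]]; under the binder of the loop, [2H] has
    number 1. *)
Definition EdgeCount : term := Cats [:: Var 3; For 2 (Var 1)].

(** The environment is [[c; f; e; v; 2H; H; m; n; x]], with [f] the foot of the half-edge. The word
    bound by [Let] is the number [n + 2H e + 2c] of the first copy of the pair; its twin has the
    next number. *)
Definition DartPair (s : bool) : term :=
  Let (Cats [:: Var 7; For 2 (Var 5); Var 0; Var 0])
    (Cats [:: Var 0; Lit [:: false; s]; Var 0; Lit [:: true; false; ~~ s]]).

(** Read as a number, [~~ s] selects field 0 of the record, the source, or field 1, the target. *)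
Definition Corners (s : bool) : term :=
  For 3 (Let (Entry 6 0 (~~ s)) (IfEq 0 2 (For 4 (DartPair s)) Empty)).

(* Below the first four binders the environment is [2H; H; m; n; x] with
   [H = C * n], where [x] is the code of a graph with [n] vertices and [m]
   edges. *)
Definition thicken (C : nat) : term :=
  Let (FieldConst 0 0) (Let (FieldConst 1 1) (Let (Cats (nseq C (Var 1)))
    (Let (Cats [:: Var 0; Var 0])
      (Cats [:: Var 3; Lit [:: true; false]; EdgeCount; Emit false;
        For 3 (Cats [:: Var 4; Emit false; Var 0; Emit false; Lit (code_perm (1%g : 'S_k))]);
        For 2 (For 1 (EdgeData 6 1));
        Lit (code_nat 1); EdgeCount; EdgeCount; Emit false;
        For 3 (Cats [:: Var 0; Lit [:: false; true]; Corners true; Corners false;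
          Var 0; Lit [:: false; false]])])))).

Lemma wf_Let n t1 t2 : wf_term n (Let t1 t2) = wf_term n t1 && wf_term n.+1 t2.
Proof. by []. Qed.

Lemma wf_For n i t : wf_term n (For i t) = (i < n) && wf_term n.+1 t.
Proof. by []. Qed.

Lemma wf_Emit n b : wf_term n (Emit b).
Proof. by []. Qed.

Lemma wf_Lit n s : wf_term n (Lit s).
Proof. by elim: s => //= b s IH; apply/andP; split. Qed.

Lemma wf_Cats n ts : wf_term n (Cats ts) = all (wf_term n) ts.
Proof. by elim: ts => //= t ts <-. Qed.

Lemma wf_Field n i j : wf_term n (Field i j) = (i < n) && (j < n).
Proof. by rewrite /Field /IfEq /wf_term /=; lia. Qed.

Lemma wf_Var n i : wf_term n (Var i) = (i < n).
Proof. by rewrite /Var /wf_term /=; lia. Qed.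

Definition wfE := (wf_Let, wf_For, wf_Emit, wf_Lit, wf_Cats, wf_Var, wf_Field).

Lemma wf_Cats_cons n t ts : wf_term n (Cats (t :: ts)) = wf_term n t && wf_term n (Cats ts).
Proof. by []. Qed.

Lemma wf_Cats_nseq n t p : wf_term n t -> wf_term n (Cats (nseq p t)).
Proof. by move=> h; rewrite wf_Cats all_nseq h orbT. Qed.

Lemma wf_Cats_map n (F : nat -> term) s : (forall r, wf_term n (F r)) ->
  wf_term n (Cats [seq F r | r <- s]).
Proof. by move=> h; elim: s => //= r s IH; rewrite wf_Cats_cons h. Qed.

Lemma wf_Entry n i j r : i < n -> j < n -> wf_term n (Entry i j r).
Proof.
move=> hi hj; rewrite /Entry wf_Let wf_Cats_cons wf_Lit wf_Cats_nseq ?wf_Var // wf_Field; lia.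
Qed.

Lemma wf_EdgeData n i j : i < n -> j < n -> wf_term n (EdgeData i j).
Proof.
by move=> hi hj; apply: wf_Cats_map => r; rewrite wf_Cats_cons wf_Entry.
Qed.

Lemma wf_FieldConst n i c : i < n -> wf_term n (FieldConst i c).
Proof. by move=> hi; rewrite /FieldConst !wfE ltnS hi. Qed.

Lemma wf_IfEq n i j t e : i < n -> j < n -> wf_term n t -> wf_term n e -> wf_term n (IfEq i j t e).
Proof. by move=> hi hj ht he; rewrite /IfEq /wf_term -/wf_term hi hj ht he. Qed.

Lemma wf_strip : wf_term 1 strip.
Proof.
by rewrite /strip wf_Cats /= wf_Let wf_For wf_EdgeData // !wf_FieldConst //.
Qed.

Lemma wf_EdgeCount n : 3 < n -> wf_term n EdgeCount.
Proof. by move=> hn; rewrite /EdgeCount wf_Cats /= !wfE; lia. Qed.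

Lemma wf_Corners n s : 6 < n.+1 -> wf_term n (Corners s).
Proof.
move=> hn; rewrite /Corners wf_For wf_Let wf_Entry ?wf_IfEq ?andbT //=; try lia.
by rewrite /DartPair wf_For wf_Let !wf_Cats /= !wfE; lia.
Qed.

Lemma wf_thicken C : wf_term 1 (thicken C).
Proof.
rewrite /thicken (wf_Let _ (FieldConst 0 0)) (wf_Let _ (FieldConst 1 1)) !wf_FieldConst //.
rewrite wf_Let wf_Cats_nseq ?wf_Var // wf_Let; apply/andP; split=> [//|]; apply/andP; split=> [//|].
repeat match goal with
| |- is_true (_ && _) => apply/andP; split
| |- is_true (wf_term _ EdgeCount) => exact: wf_EdgeCount
| |- is_true (wf_term _ (Corners _)) => exact: wf_Corners
| |- is_true (wf_term _ (EdgeData _ _)) => exact: wf_EdgeData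
| |- is_true (wf_term _ (Lit _)) => exact: wf_Lit
| |- is_true (wf_term _ (Var _)) => by rewrite wf_Var
| |- is_true (wf_term _ (For _ _)) => rewrite wf_For
| |- is_true (wf_term _ (Cats _)) => rewrite wf_Cats /all
| |- _ => done
end.
Qed.

Section Graph.
Variables (X : graph) (g : labelling k X) (y : seq bool).
Local Notation n := (nv X).
Local Notation m := (ne X).

Definition fields (e : 'I_m) : seq nat :=
  [:: val (src e), val (tgt e) & [seq val (g e a) | a <- enum 'I_k]].

(** A code is a flat list of unary numbers in which the record of each edge has length [k.+2]. Entry
    [r] of edge [e] therefore has index [2 + r + e * k.+2], which [Entry] computes in unary. *)
Definition numbers : seq nat := [:: n, m & flatten [seq fields e | e <- enum 'I_m]].

Lemma code_nats_cons a l : code_nats (a :: l) = code_nat a ++ code_nats l.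
Proof. by []. Qed.

Lemma code_nats_cat l l' : code_nats (l ++ l') = code_nats l ++ code_nats l'.
Proof. by rewrite /code_nats map_cat flatten_cat. Qed.

Lemma code_nats_flatten ll : code_nats (flatten ll) = flatten (map code_nats ll).
Proof. by elim: ll => //= l ll IH; rewrite code_nats_cat IH. Qed.

Lemma code_fields e : code_nats (fields e) = code_nat (src e) ++ code_nat (tgt e) ++ code_perm (g e).
Proof. by rewrite /code_nats /= -map_comp. Qed.

Lemma code_labelledE : code_labelled g = code_nats numbers.
Proof.
rewrite /code_labelled /numbers !code_nats_cons code_nats_flatten -map_comp.
by congr (_ ++ (_ ++ flatten _)); apply: eq_map => e /=; rewrite code_fields.
Qed.

Lemma size_fields e : size (fields e) = k.+2.
Proof. by rewrite /= size_map size_enum_ord. Qed.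

Lemma nth_flatten_const (p : nat) (s : seq nat) (F : nat -> seq nat) e r :
  (forall i, i \in s -> size (F i) = p) -> r < p -> e < size s ->
  nth 0 (flatten (map F s)) (e * p + r) = nth 0 (F (nth 0 s e)) r.
Proof.
elim: s e => [|a s IH] [|e] //= hs hr he; rewrite nth_cat hs ?mem_head //.
  by rewrite mul0n hr.
rewrite mulSn -addnA ltnNge leq_addr /= addKn IH // => i hi.
by apply: hs; rewrite inE hi orbT.
Qed.

Lemma nth_numbers (e : 'I_m) r : r < k.+2 -> nth 0 numbers (2 + r + e * k.+2) = nth 0 (fields e) r.
Proof.
move=> hr; have -> : 2 + r + e * k.+2 = (e * k.+2 + r).+2 by lia.
rewrite /numbers /=; pose F i := if insub i is Some e' then fields e' else [::].
have -> : [seq fields e | e <- enum 'I_m] = map F (iota 0 m).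
  by rewrite -val_enum_ord -map_comp; apply: eq_map => e' /=; rewrite /F valK.
rewrite nth_flatten_const // ?size_iota ?nth_iota // ?add0n /F ?valK // => i.
by rewrite mem_iota /= add0n => hi; rewrite (insubT (fun i => i < m) hi) size_fields.
Qed.

Lemma size_numbers : size numbers = 2 + m * k.+2.
Proof.
rewrite /numbers /= size_flatten /shape -map_comp sumnE big_map big_enum /=.
under eq_bigr do rewrite size_map size_enum_ord.
by rewrite sum_nat_const card_ord.
Qed.

Lemma flatten_nseq b p q : flatten (nseq p (nseq q b)) = nseq (p * q) b :> seq bool.
Proof. by elim: p => //= p ->; rewrite -nseqD. Qed.

Lemma den_Entry i j (e : 'I_m) r env : nth [::] env i = code_labelled g ++ y ->
  nth [::] env j = nseq e true -> r < k.+2 ->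
  den (Entry i j r) env = nseq (nth 0 (fields e) r) true.
Proof.
move=> ei ej hr; rewrite -nth_numbers //.
have sz : size (den (Cats (Lit (nseq (2 + r) true) :: nseq k.+2 (Var j))) env) = 2 + r + e * k.+2.
  rewrite den_Cats map_cons den_Lit map_nseq den_Var ej.
  have -> (u : seq bool) uu : flatten (u :: uu) = u ++ flatten uu by [].
  by rewrite flatten_nseq size_cat !size_nseq mulnC.
apply: (@den_Field i.+1 0 (_ :: env) numbers y) => //.
- by rewrite -code_labelledE.
- by rewrite size_numbers; have := ltn_ord e; nia.
Qed.

Lemma den_EdgeData i j (e : 'I_m) env : nth [::] env i = code_labelled g ++ y ->
  nth [::] env j = nseq e true -> den (EdgeData i j) env = code_nats (fields e).
Proof.
move=> ei ej; rewrite /EdgeData den_Cats -map_comp /code_nats.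
rewrite -[fields e in RHS](mkseq_nth 0) size_fields /mkseq -map_comp.
congr flatten; apply/eq_in_map => r; rewrite mem_iota add0n => /andP[_ hr].
change (den (Cats [:: Entry i j r; Emit false]) env = code_nat (nth 0 (fields e) r)).
by rewrite den_Cats !map_cons (den_Entry ei ej hr).
Qed.

Lemma den_strip : den strip [:: code_labelled g ++ y] = code_labelled g.
Proof.
have n0 : 0 < size numbers by rewrite size_numbers.
have n1 : 1 < size numbers by rewrite size_numbers.
have ex : nth [::] [:: code_labelled g ++ y] 0 = code_nats numbers ++ y by rewrite code_labelledE.
rewrite /strip den_Cats !map_cons !den_Emit den_Let den_For.
rewrite (den_FieldConst ex n0) (den_FieldConst ex n1) size_nseq.
have -> : [seq den (EdgeData 2 0) [:: nseq c true; nseq (nth 0 numbers 1) true; code_labelled g ++ y]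
    | c <- iota 0 (nth 0 numbers 1)] = [seq code_nats (fields e) | e <- enum 'I_m].
  rewrite -[nth 0 numbers 1]/m -[in iota _ _]val_enum_ord -map_comp; apply: eq_map => e.
  exact: den_EdgeData.
rewrite code_labelledE /numbers !code_nats_cons code_nats_flatten -map_comp !flatten_cons.
by rewrite /code_nat -!catA cats0.
Qed.

End Graph.
End Reductions.

(** * The thickening program outputs the code of the thickened complex *)

Section Codes.

Lemma enum_ord_add a b :
  enum 'I_(a + b) = map (@lshift a b) (enum 'I_a) ++ map (@rshift a b) (enum 'I_b).
Proof.
apply: (inj_map (@val_inj _ _ 'I_(a + b))); rewrite val_enum_ord map_cat -(map_comp _ (@lshift a b)) -(map_comp _ (@rshift a b)) iotaD add0n.
congr (_ ++ _); first by rewrite -val_enum_ord; apply: eq_map.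
by rewrite -[X in iota X _]addn0 iotaDl -val_enum_ord -map_comp; apply: eq_map.
Qed.

Lemma map_const (A B : Type) (b : B) (s : seq A) : [seq b | _ <- s] = nseq (size s) b.
Proof. by elim: s => //= a s ->. Qed.

Lemma map_edge_of (X : graph) (H : nat) (A : Type) (F : 'I_(ne X) -> A) :
  [seq F (edge_of q) | q <- enum 'I_(ne X * H.*2)] = flatten [seq nseq H.*2 (F e) | e <- enum 'I_(ne X)].
Proof.
have divs p q : [seq i %/ p | i <- iota 0 (q * p)] = flatten [seq nseq p e | e <- iota 0 q].
  elim: q => [|q IH] //; rewrite mulSn addnC iotaD map_cat IH -[q.+1]addn1 iotaD map_cat flatten_cat /= cats0.
  congr (_ ++ _); rewrite add0n -[q * p]addn0 iotaDl -map_comp.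
  rewrite -[in RHS](size_iota 0 p) -map_const; apply/eq_in_map => i; rewrite mem_iota add0n /= => hi.
  by rewrite divnMDl ?divn_small ?addn0 //; lia.
have ee : map (@edge_of X H) (enum 'I_(ne X * H.*2)) = flatten [seq nseq H.*2 e | e <- enum 'I_(ne X)].
  apply: (inj_map (@val_inj _ _ 'I_(ne X))).
  have -> : map val (map (@edge_of X H) (enum 'I_(ne X * H.*2))) = [seq i %/ H.*2 | i <- iota 0 (ne X * H.*2)].
    by rewrite -val_enum_ord -[LHS]map_comp -[RHS]map_comp.
  rewrite divs map_flatten -val_enum_ord; congr flatten.
  by rewrite -[LHS]map_comp -[RHS]map_comp; apply: eq_map => e /=; rewrite map_nseq.
rewrite (map_comp F) ee map_flatten; congr flatten.
by rewrite -[LHS]map_comp; apply: eq_map => e /=; rewrite map_nseq.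
Qed.

Definition code_darts (X : graph) (w : seq (dart X)) : seq bool :=
  flatten [seq rcons (code_nat d.1) d.2 | d : dart X <- w].

Lemma code_darts_cat X (w w' : seq (dart X)) : code_darts (w ++ w') = code_darts w ++ code_darts w'.
Proof. by rewrite /code_darts map_cat flatten_cat. Qed.

Lemma code_darts_flatten X (ww : seq (seq (dart X))) :
  code_darts (flatten ww) = flatten (map (@code_darts X) ww).
Proof. by elim: ww => //= w ww IH; rewrite code_darts_cat IH. Qed.

Lemma flatten_map_filter (A B : Type) (P : pred A) (F : A -> seq B) s :
  flatten [seq F x | x <- s & P x] = flatten [seq (if P x then F x else [::]) | x <- s].
Proof. by elim: s => //= a s <-; case: (P a). Qed.

Lemma flatten_map_allpairs (A B D E : Type) (f : A -> B -> D) (F : D -> seq E) s t :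
  flatten [seq F x | x <- [seq f a b | a <- s, b <- t]] =
  flatten [seq flatten [seq F (f a b) | b <- t] | a <- s].
Proof. by elim: s => //= a s IH; rewrite map_cat flatten_cat IH -map_comp. Qed.

Lemma flatten_if (A B : Type) (b : bool) (F : A -> seq B) s :
  flatten [seq (if b then F x else [::]) | x <- s] = if b then flatten [seq F x | x <- s] else [::].
Proof. by case: b => //; elim: s. Qed.

Lemma nseq_cons (T : Type) (b : T) a l : nseq a b ++ b :: l = b :: nseq a b ++ l.
Proof. by elim: a => //= a ->. Qed.

Variables (k : nat) (X : graph) (g : labelling k X) (C : nat).
Local Notation n := (nv X).
Local Notation m := (ne X).
Local Notation H := (C * nv X).
Local Notation D := H.*2.

Definition base_env : seq (seq bool) :=
  [:: nseq D true; nseq H true; nseq m true; nseq n true; code_labelled g].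

Lemma den_EdgeCount : den EdgeCount base_env = nseq (n + m * D) true.
Proof.
rewrite /EdgeCount den_Cats !map_cons den_Var den_For.
rewrite (eq_map (g := fun=> nseq D true)); last by move=> c; rewrite den_Var.
by rewrite map_const size_iota size_nseq flatten_nseq /= cats0 -nseqD.
Qed.

Lemma den_DartPair s c e f v :
  den (DartPair s) (nseq c true :: f :: nseq e true :: v :: base_env) =
  code_nat (n + e * D + c.*2) ++ s :: code_nat (n + e * D + c.*2).+1 ++ [:: ~~ s].
Proof.
set env := _ :: _; have ew : den (Cats [:: Var 7; For 2 (Var 5); Var 0; Var 0]) env =
    nseq (n + e * D + c.*2) true.
  rewrite den_Cats !map_cons !den_Var den_For.
  rewrite (eq_map (g := fun=> nseq D true)); last by move=> i; rewrite den_Var.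
  rewrite map_const size_iota size_nseq flatten_nseq /= cats0 -!nseqD.
  by congr nseq; lia.
rewrite /DartPair den_Let ew.
rewrite den_Cats !map_cons !den_Var !den_Lit !flatten_cons /=.
by rewrite /code_nat -!catA /= nseq_cons.
Qed.

Definition corner_code (s : bool) (v : 'I_n) : seq bool :=
  flatten [seq (if (if s then src e else tgt e) == v then
    flatten [seq code_darts (@block X H (s, e, c)) | c <- enum 'I_H] else [::]) | e <- enum 'I_m].

Lemma code_block s e c : code_darts (@block X H (s, e, c)) =
  code_nat (n + e * D + c.*2) ++ s :: code_nat (n + e * D + c.*2).+1 ++ [:: ~~ s].
Proof.
rewrite /block /side_dart /code_darts /= cats0 /dart_rev /= !cat_rcons.
by rewrite /parallel /= -!cats1 !addnA addn0 addn1 -!catA.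
Qed.

Lemma den_Corners s (v : 'I_n) : den (Corners k s) (nseq v true :: base_env) = corner_code s v.
Proof.
rewrite /Corners den_For /corner_code; congr flatten.
rewrite -[nth _ _ _]/(nseq m true) size_nseq -val_enum_ord -[LHS]map_comp; apply: eq_map => e.
rewrite [LHS]/comp den_Let (@den_Entry _ _ g [::] 6 0 e); [|by rewrite /= cats0|by []|by case: s].
rewrite den_IfEq; set env := _ :: _.
have -> : (size (nth [::] env 0) == size (nth [::] env 2)) = ((if s then src e else tgt e) == v).
  by rewrite /= !size_nseq; case: s {env}.
case: ifP => // _; rewrite den_For -[nth _ _ _]/(nseq H true) size_nseq.
congr flatten; rewrite -val_enum_ord -[LHS]map_comp; apply: eq_map => c.
by rewrite code_block; apply: den_DartPair.
Qed.

Lemma code_segment v : code_darts (@segment X H v) =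
  code_nat v ++ true :: corner_code true v ++ corner_code false v ++ code_nat v ++ [:: false].
Proof.
rewrite /segment -cat1s !code_darts_cat code_darts_flatten -map_comp.
have -> : flatten [seq (@code_darts (thick X H) \o @block X H) x | x <- blocks H v] =
    corner_code true v ++ corner_code false v.
  rewrite /blocks flatten_map_filter /halves.
  rewrite [LHS]flatten_map_allpairs [LHS]flatten_map_allpairs /= cats0.
  by congr (flatten _ ++ flatten _); apply: eq_map => e; rewrite -flatten_if.
by rewrite /code_darts /= !cats0 -!cats1 -!catA.
Qed.

Lemma code_labelled_thick : code_labelled (@thick_label X H k g) =
  code_nat n.+1 ++ code_nat (n + m * D) ++
  flatten [seq code_nat n ++ code_nat v ++ code_perm (1%g : 'S_k) | v : 'I_n <- enum 'I_n] ++
  flatten [seq flatten (nseq D (code_nats (fields g e))) | e <- enum 'I_m].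
Proof.
pose K (e : 'I_(n + m * D)) := code_nat (@src (thick X H) e) ++ code_nat (@tgt (thick X H) e) ++
  code_perm (@thick_label X H k g e).
transitivity (code_nat n.+1 ++ code_nat (n + m * D) ++ flatten [seq K e | e <- enum 'I_(n + m * D)]); first by [].
rewrite enum_ord_add map_cat flatten_cat.
have -> : [seq K e | e <- [seq rshift n i | i <- enum 'I_(m * D)]] =
    [seq code_nats (fields g (edge_of q)) | q <- enum 'I_(m * D)].
  rewrite -[LHS]map_comp; apply: eq_map => q; rewrite /K /=.
  by rewrite code_fields /thick_label !(unsplitK (inr q)).
have -> : [seq K e | e <- [seq lshift (m * D) i | i <- enum 'I_n]] =
    [seq code_nat n ++ code_nat v ++ code_perm (1%g : 'S_k) | v : 'I_n <- enum 'I_n].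
  rewrite -[LHS]map_comp; apply: eq_map => v; rewrite /K /=.
  by rewrite /thick_label !(unsplitK (inl v)).
rewrite (map_edge_of _ (fun e => code_nats (fields g e))).
have ff (A : Type) (ss : seq (seq (seq A))) : flatten (flatten ss) = flatten (map flatten ss).
  by elim: ss => //= s ss IH; rewrite flatten_cat IH.
by rewrite ff -map_comp.
Qed.

Lemma den_thicken (n0 : 0 < n) : den (thicken k C) [:: code_labelled g] =
  @code_complex k (one_face (tour_closed H n0)) (@thick_label X H k g).
Proof.
have s0 : 0 < size (numbers g) by rewrite size_numbers.
have s1 : 1 < size (numbers g) by rewrite size_numbers.
have ex i env : nth [::] env i = code_labelled g -> nth [::] env i = code_nats (numbers g) ++ [::].
  by rewrite cats0 -code_labelledE.
rewrite /thicken den_Let (den_FieldConst (ex 0 [:: code_labelled g] erefl) s0).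
rewrite den_Let (den_FieldConst (ex 1 [:: _; code_labelled g] erefl) s1).
rewrite den_Let (den_Cats (nseq _ _)) map_nseq den_Var flatten_nseq.
rewrite den_Let (den_Cats [:: Var 0; Var 0]) !map_cons !den_Var.
have -> : flatten [:: nth [::] [:: nseq H true; nseq (nth 0 (numbers g) 1) true; nseq (nth 0 (numbers g) 0) true; code_labelled g] 0,
   nth [::] [:: nseq H true; nseq (nth 0 (numbers g) 1) true; nseq (nth 0 (numbers g) 0) true; code_labelled g] 0 &
   [seq den t [:: nseq H true; nseq (nth 0 (numbers g) 1) true; nseq (nth 0 (numbers g) 0) true; code_labelled g] | t <- [::]]] = nseq D true.
  by rewrite /= cats0 -nseqD addnn.
rewrite -[[:: nseq D true, _ & _]]/base_env.
rewrite den_Cats !map_cons !flatten_cons !den_EdgeCount !den_Lit !den_Emit den_Var.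
have -> : den (For 3 (Cats [:: Var 4; Emit false; Var 0; Emit false; Lit (code_perm (1%g : 'S_k))])) base_env =
    flatten [seq code_nat n ++ code_nat v ++ code_perm (1%g : 'S_k) | v : 'I_n <- enum 'I_n].
  rewrite den_For -[nth _ _ _]/(nseq n true) size_nseq -val_enum_ord -[in LHS]map_comp.
  congr flatten; apply: eq_map => v; rewrite [LHS]/comp den_Cats !map_cons !den_Var den_Lit !den_Emit.
  by rewrite /code_nat /= cats0 -!catA.
have -> : den (For 2 (For 1 (EdgeData k 6 1))) base_env =
    flatten [seq flatten (nseq D (code_nats (fields g e))) | e <- enum 'I_m].
  rewrite den_For -[nth _ _ _]/(nseq m true) size_nseq -val_enum_ord -[in LHS]map_comp.
  congr flatten; apply: eq_map => e; rewrite [LHS]/comp den_For -[nth _ _ _]/(nseq D true) size_nseq.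
  rewrite (eq_map (g := fun=> code_nats (fields g e))); last first.
    by move=> c; apply: (@den_EdgeData _ _ g [::]); rewrite /= ?cats0.
  by rewrite map_const size_iota.
have -> : den (For 3 (Cats [:: Var 0; Lit [:: false; true]; Corners k true; Corners k false;
    Var 0; Lit [:: false; false]])) base_env = code_darts (tour X H).
  rewrite den_For -[nth _ _ _]/(nseq n true) size_nseq -val_enum_ord -[in LHS]map_comp.
  rewrite /tour code_darts_flatten -map_comp; congr flatten; apply: eq_map => v.
  rewrite [LHS]/comp den_Cats !map_cons !den_Var !den_Lit !den_Corners [RHS]/comp code_segment.
  by rewrite /code_nat /= -!catA.
have e1 : enum 'I_1 = [:: ord0] by apply: (inj_map (@val_inj _ _ 'I_1)); rewrite val_enum_ord.
have -> : @code_complex k (one_face (tour_closed H n0)) (@thick_label X H k g) =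
    code_labelled (@thick_label X H k g) ++ code_nat 1 ++ (code_nat (size (tour X H)) ++ code_darts (tour X H)) ++ [::].
  by rewrite /code_complex -[nf _]/1 e1.
rewrite code_labelled_thick size_tour -[(n + m * D).*2]addnn /code_nat !nseqD /= -!catA /= !cats0 nseq_cons.
by [].
Qed.

End Codes.

(** * Gap-preserving reductions and completeness *)

Section GapReductions.
Variable R : realType.
Local Open Scope ring_scope.

(** Stronger than [poly_reducible]: a term can be run after any polynomial-time map, so hardness
    transfers along it. *)
Definition term_reducible (P Q : promise_problem) : Prop := exists t : term,
  [/\ wf_term 1 t, (forall x, yes_instance P x -> yes_instance Q (den t [:: x])) &
      (forall x, no_instance P x -> no_instance Q (den t [:: x]))].

Lemma term_reducible_poly P Q : term_reducible P Q -> poly_reducible P Q.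
Proof.
move=> [t [wt hy hn]]; exists (fun x => den t [:: x]); split => //.
exact: (polytime_den wt polytime_id).
Qed.

Lemma NP_hard_term P Q : term_reducible P Q -> NP_hard P -> NP_hard Q.
Proof.
move=> [t [wt hy hn]] hP L /hP[f [pf fy fn]].
exists (fun x => den t [:: f x]); split; first exact: polytime_den.
- by move=> x /fy/hy.
- by move=> x /fn/hn.
Qed.

Lemma gap_weaken (P : max_problem R) (c s c' s' : R) : c' <= c -> s <= s' ->
  term_reducible (gap P c s) (gap P c' s').
Proof.
move=> hc hs; exists (Var 0); split => // x; rewrite den_Var /= => -[I [v e h]]; exists I; split => //.
- exact: le_trans h.
- exact: le_trans hs.
Qed.

Lemma copies_exist (d : R) : 0 < d -> exists2 C : nat, (0 < C)%N & (2 * C)%:R^-1 <= d.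
Proof.
move=> d0; exists (Num.truncn d^-1).+1 => //.
have /andP[_ h] : (Num.truncn d^-1)%:R <= d^-1 < (Num.truncn d^-1).+1%:R.
  by apply: Num.Theory.truncn_itv; rewrite invr_ge0 ltW.
rewrite invf_ple ?posrE ?ltr0n //; apply: le_trans (ltW h) _.
by rewrite ler_nat; lia.
Qed.

Lemma graph_to_surface k (G : {group 'S_k}) (s s' c' c : R) : (0 < k)%N ->
  0 <= s -> s < s' -> s' < c' -> c' < c -> c <= 1 ->
  term_reducible (gap (MaxSectionGraph R G) c s) (gap (MaxSectionSurface R G) c' s').
Proof.
move=> k0 s0 ss' sc cc c1.
(* [C] depends on the thresholds only and not on the instance, so it may be built into the term. *)
have [C C0 hC] : exists2 C : nat, (0 < C)%N & (2 * C)%:R^-1 <= Num.min (c - c') (s' - s).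
  by apply: copies_exist; rewrite lt_min !subr_gt0 cc ss'.
move: hC; rewrite le_min => /andP[hc hs].
have val_thick X (g : labelling k X) (m0 : (0 < ne X)%N) (n0 : (0 < nv X)%N) : labelled_by G g ->
    valid (m := MaxSectionSurface R G)
      (existT (fun K => labelling k (skeleton K)) (one_face (tour_closed (C * nv X) n0)) (@thick_label X (C * nv X) k g)).
  move=> hg; split => /=.
  - by rewrite addn_gt0 n0.
  - exact: thick_surface.
  - by move=> e; rewrite /thick_label; case: (fintype.split e) => [_|q]; [exact: group1 | exact: hg].
  - by move=> f; exact: holonomy_tour.
exists (thicken k C); split; first exact: wf_thicken.
- move=> z [[X g] [[/= m0 hg] <- h]]; have n0 := nv_gt0 m0.
  exists (existT (fun K => labelling k (skeleton K)) (one_face (tour_closed (C * nv X) n0)) (@thick_label X (C * nv X) k g)).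
  split; [exact: val_thick | symmetry; exact: den_thicken | exact: thick_complete h].
- move=> z [[X g] [[/= m0 hg] <- h]]; have n0 := nv_gt0 m0.
  exists (existT (fun K => labelling k (skeleton K)) (one_face (tour_closed (C * nv X) n0)) (@thick_label X (C * nv X) k g)).
  split; [exact: val_thick | symmetry; exact: den_thicken | exact: thick_sound h].
Qed.

(** [max_section] sees only the 1-skeleton, so the optimum does not change. *)
Lemma surface_to_graph k (G : {group 'S_k}) (s s' c' c : R) : s <= s' -> c' <= c ->
  term_reducible (gap (MaxSectionSurface R G) c s) (gap (MaxSectionGraph R G) c' s').
Proof.
move=> ss cc; exists (strip k); split; first exact: wf_strip.
- move=> z [[K g] [[m0 _ hg _] <- h]].
  exists (existT (labelling k) (skeleton K) g); split => //; last exact: le_trans h.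
  by rewrite /= /code_complex den_strip.
- move=> z [[K g] [[m0 _ hg _] <- h]].
  exists (existT (labelling k) (skeleton K) g); split => //; last exact: le_trans ss.
  by rewrite /= /code_complex den_strip.
Qed.

Lemma gap_conjecture_transfer (P Q : nat -> max_problem R) :
  (forall k, (0 < k)%N -> forall s s' c' c : R, 0 <= s -> s < s' -> s' < c' -> c' < c -> c <= 1 ->
     term_reducible (gap (P k) c s) (gap (Q k) c' s')) ->
  gap_conjecture P -> gap_conjecture Q.
Proof.
move=> red hP eps del e0 d0.
(* The cap at [1/4] keeps [d < 1 - e], and starting from the halves leaves the strict room that
   [red] requires at both thresholds. *)
pose e := Num.min eps 4^-1; pose d := Num.min del 4^-1.
have /andP[ep e4] : 0 < e <= 4^-1 by rewrite /e lt_min e0 ge_min lexx orbT /= andbT; lra.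
have /andP[dp d4] : 0 < d <= 4^-1 by rewrite /d lt_min d0 ge_min lexx orbT /= andbT; lra.
have [||k k0 hk] := hP (e / 2) (d / 2); try lra.
exists k => //; have ee : e <= eps by rewrite /e ge_min lexx.
have dd : d <= del by rewrite /d ge_min lexx.
have hw : 1 - eps <= 1 - e by lra.
apply: NP_hard_term (gap_weaken _ hw dd) _.
apply: NP_hard_term (red k k0 _ _ _ _ _ _ _ _ _) hk.
all: by clearbody e d; lra.
Qed.

End GapReductions.

Theorem theorem27 (R : realType) :
  (forall (k : nat) (G : {group 'S_k}),
     (0 < k)%N ->
     (forall z : 'S_k, z \in [~: G, G]%g ->
        exists g h : 'S_k, [/\ g \in G, h \in G & z = [~ g, h]%g]) ->
     gap_reducible (MaxSectionGraph R G) (MaxSectionSurface R G)) /\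
  unique_games_complete (fun k : nat => MaxSectionSurface R [group of [set: 'S_k]]).
Proof.
split=> [k G k0 _|]; first by move=> *; exact/term_reducible_poly/graph_to_surface.
split=> [k k0|k k0|]; try by move=> *; exact/term_reducible_poly/graph_to_surface.
- by move=> s s' c' c _ ss _ cc _; apply/term_reducible_poly/surface_to_graph; exact: ltW.
- split; apply: gap_conjecture_transfer => k k0 s s' c' c s0 ss sc cc c1.
  + by apply: surface_to_graph; exact: ltW.
  + exact: graph_to_surface.
Qed.
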